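(* Let $\psi\in H$ and consider the non-local problem $$\partial_t w(t)+(1+\gamma\,\partial_t^\alpha)A w(t)=0,\quad 0<t\le T;\qquad w(t_0)=\beta w(0)+\psi. \qquad (P)$$ (i) If $\beta\notin[0,1)$, or $\beta\in(0,1)$ but $K_0$ is empty, then problem (P) has a unique solution, and this solution has the form $$w(t)=\sum_{k=1}^{\infty}\frac{\psi_k}{B_\alpha(\lambda_k,t_0)-\beta}\,B_\alpha(\lambda_k,t)\,v_k .$$ (ii) If $\beta\in(0,1)$ and $K_0$ is not empty, then a solution to problem (P) exists if and only if the orthogonality conditions $$\psi_k=(\psi,v_k)=0,\quad k\in K_0,$$ are satisfied. The solution of problem (P) then has the form $$w(t)=\sum_{k\notin K_0}\frac{\psi_k}{B_\alpha(\lambda_k,t_0)-\beta}\,B_\alpha(\lambda_k,t)\,v_k+\sum_{k\in K_0}h_k B_\alpha(\lambda_k,t)\,v_k$$ with arbitrary coefficients $h_k$, $k\in K_0$. Moreover, there is a constant $C_\beta>0$ such that the following coercive estimate holds for the solution $w$: $$\|\partial_t w(t)\|^2+\|Aw(t)\|^2+\|\partial_t^\alpha Aw(t)\|^2\le C_\beta\, t^{-2(2-\alpha)}\,\|\psi\|^2,\quad 0<t\le T.$$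
   Context: $H$ is a separable Hilbert space with inner product $(\cdot,\cdot)$ and norm $\|\cdot\|$. $A$ is an unbounded positive self-adjoint operator in $H$ with dense domain, having a system of orthonormal eigenvectors $\{v_k\}_{k\ge1}$ complete in $H$, with corresponding positive eigenvalues $0<\lambda_1\le\lambda_2\le\cdots\to+\infty$ (repeated according to multiplicity; the set $\{\lambda_k\}$ has no finite limit point). For $h\in H$, $h_k=(h,v_k)$. The numbers $T>0$, $\gamma>0$, $\alpha\in(0,1)$, $t_0\in(0,T]$ and $\beta\in\mathbb{R}$ are fixed. $C_\beta$ denotes a constant depending on $\beta$ and on the fixed data of the problem, but not on $\psi$ or $t$. $\partial_t=\partial/\partial t$, and $\partial_t^\alpha$ is the Riemann–Liouville fractional derivative $$\partial_t^\alpha h(t)=\frac{d}{dt}\int_0^t\omega_{1-\alpha}(t-s)h(s)\,ds,\qquad \omega_{\alpha}(t)=\frac{t^{\alpha-1}}{\Gamma(\alpha)},$$ the integral for $H$-valued functions being understood in the sense of Bochner. $C((a,b);H)$ (similarly for other intervals) is the set of continuous functions on $(a,b)$ with values in $H$. For $\lambda>0$, $B_\alpha(\lambda,t)$ denotes the solution $y(t)$ of the scalar Cauchy problem $y'(t)+\lambda(1+\gamma\,\partial_t^\alpha)y(t)=0$, $t>0$, $y(0)=1$. For $\beta\in(0,1)$, $K_0=\{k\ge1:\ B_\alpha(\lambda_k,t_0)=\beta\}$. A solution of problem (P) is a function $w\in C([0,T];H)$ such that $\partial_t w(t),\,Aw(t),\,\partial_t^\alpha Aw(t)\in C((0,T);H)$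 and which satisfies the conditions in (P) for all $t\in(0,T]$.
   Formalization: In case (ii) the coercive estimate is stated with ‖ψ‖² + Σ_{k∈K₀}|h_k|² (h_k = (w(0),v_k)) in place of ‖ψ‖², since with arbitrary h_k the printed bound fails: for ψ = 0 and some h_k ≠ 0 the solution is nonzero but the right side is 0. *)

(* Defs.v *)
From HB Require Import structures.
From mathcomp Require Import all_boot all_order all_algebra sesquilinear.
From mathcomp Require Import complex.
From mathcomp Require Import all_classical all_reals all_analysis.

Set Implicit Arguments.
Unset Strict Implicit.
Unset Printing Implicit Defensive.

Import Order.TTheory GRing.Theory Num.Theory.
Import numFieldNormedType.Exports.

Local Open Scope classical_set_scope.
Local Open Scope ring_scope.

(* Hilbert spaces are over the real numbers ([cplx = false]) or over the      *)
(* complex numbers ([cplx = true]).                                           *)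
Definition scalars (R : realType) (cplx : bool) : numFieldType :=
  if cplx then (R[i] : numFieldType) else (R : numFieldType).

Definition of_real (R : realType) (cplx : bool) : R -> scalars R cplx :=
  if cplx as b return R -> scalars R b then real_complex R else id.

Definition real_part (R : realType) (cplx : bool) : scalars R cplx -> R :=
  if cplx as b return scalars R b -> R then @complex.Re R else id.

Definition conj_scalar (R : realType) (cplx : bool) :
    scalars R cplx -> scalars R cplx :=
  if cplx as b return scalars R b -> scalars R b then @conjc R else id.

Arguments of_real {R} cplx r.
Arguments real_part {R cplx} z.
Arguments conj_scalar {R} cplx z.

Section Hilbert.
Variables (R : realType) (cplx : bool).
Let K := scalars R cplx.
Variable H : completeNormedModType K.

Definition separable_space : Prop := exists2 S : set H, countable S & dense S.

(* The library form is linear in its first argument and conjugate-linear in   *)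
(* the second one.                                                            *)
Definition inner_product_of_norm (ip : {dot H for conj_scalar cplx}) : Prop :=
  forall x : H, ip x x = `|x| ^+ 2.

(* An unbounded operator is a domain together with a total function whose     *)
(* values outside the domain are irrelevant. The third clause says that the   *)
(* graph of A is the graph of its adjoint.                                    *)
Record unbounded_positive_selfadjoint (ip : {dot H for conj_scalar cplx})
    (domA : set H) (A : H -> H) : Prop := {
  upsa_linear : domA 0 /\ forall (a : K) (x y : H), domA x -> domA y ->
    domA (a *: x + y) /\ A (a *: x + y) = a *: A x + A y ;
  upsa_dense : dense domA ;
  upsa_selfadjoint : forall x y : H,
    (domA x /\ A x = y) <-> (forall z : H, domA z -> ip (A z) x = ip z y) ;
  upsa_positive : forall x : H, domA x -> x != 0 -> 0 < ip (A x) x ;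
  upsa_unbounded :
    ~ exists M : K, forall x : H, domA x -> `|A x| <= M * `|x| }.

(* Numbering of the eigenpairs starts at 0. *)
Record complete_eigensystem (ip : {dot H for conj_scalar cplx})
    (domA : set H) (A : H -> H) (lam : nat -> R) (v : nat -> H) : Prop := {
  ces_orthonormal : forall j k : nat, ip (v j) (v k) = (j == k)%:R ;
  ces_complete : dense [set x : H | exists (n : nat) (c : nat -> K),
    x = \sum_(0 <= k < n) c k *: v k] ;
  ces_eigen : forall k : nat,
    domA (v k) /\ A (v k) = of_real cplx (lam k) *: v k ;
  ces_pos : forall k : nat, 0 < lam k ;
  ces_nondecreasing : {homo lam : j k / (j <= k)%N >-> j <= k} ;
  ces_infty : lam k @[k --> \oo] --> +oo }.

(* Bochner integral with respect to Lebesgue measure: a simple function       *)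
(* \sum_i c_i 1_(E_i) is represented by the list of the pairs (E_i, c_i).     *)
Definition simple_data (s : seq (set R * H)) : Prop :=
  forall p, p \in s ->
    measurable (p.1 : set (measurableTypeR R)) /\
    (lebesgue_measure p.1 < +oo)%E.

Definition simple_eval (s : seq (set R * H)) (x : R) : H :=
  \sum_(p <- s) of_real cplx (\1_(p.1) x) *: p.2.

Definition simple_integral (D : set R) (s : seq (set R * H)) : H :=
  \sum_(p <- s) of_real cplx (fine (lebesgue_measure (p.1 `&` D))) *: p.2.

Definition is_bochner_integral (D : set R) (f : R -> H) (I : H) : Prop :=
  exists s : nat -> seq (set R * H),
    [/\ forall n, simple_data (s n),
        {ae (@lebesgue_measure R), forall x, D x ->
          simple_eval (s n) x @[n --> \oo] --> f x},
        (\int[lebesgue_measure]_(x in D)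
          (real_part `|f x - simple_eval (s n) x|)%:E)%E @[n --> \oo]
          --> 0%E
      & simple_integral D (s n) @[n --> \oo] --> I].

Definition bochner_integrable (D : set R) (f : R -> H) : Prop :=
  exists I : H, is_bochner_integral D f I.

Definition bochner_integral (D : set R) (f : R -> H) : H :=
  xget 0 [set I | is_bochner_integral D f I].

(* Derivative of a function defined on [0, T]: two-sided at interior points,  *)
(* one-sided at T.                                                            *)
Definition diff_quotient (f : R -> H) (t s : R) : H :=
  of_real cplx (s - t)^-1 *: (f s - f t).

Definition derivable_upto (T : R) (f : R -> H) (t : R) : Prop :=
  cvg (diff_quotient f t s @[s --> within `[0, T] t^']).

Definition derive_upto (T : R) (f : R -> H) (t : R) : H :=
  lim (diff_quotient f t s @[s --> within `[0, T] t^']).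

End Hilbert.

Definition Gamma (R : realType) (x : R) : R :=
  \int[lebesgue_measure]_(u in `]0, +oo[) (u `^ (x - 1) * expR (- u)).

Definition omega (R : realType) (a t : R) : R := t `^ (a - 1) / Gamma a.

Section FractionalHilbert.
Variables (R : realType) (cplx : bool).
Variable H : completeNormedModType (scalars R cplx).

Definition frac_integrand (alpha : R) (h : R -> H) (t s : R) : H :=
  of_real cplx (omega (1 - alpha) (t - s)) *: h s.

Definition frac_primitive (alpha : R) (h : R -> H) (t : R) : H :=
  bochner_integral `]0, t[ (frac_integrand alpha h t).

Definition frac_derivable (T alpha : R) (h : R -> H) (t : R) : Prop :=
  bochner_integrable `]0, t[ (frac_integrand alpha h t) /\
  derivable_upto T (frac_primitive alpha h) t.

Definition frac_derive (T alpha : R) (h : R -> H) (t : R) : H :=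
  derive_upto T (frac_primitive alpha h) t.

Record is_solution (domA : set H) (A : H -> H) (T gamma alpha t0 beta : R)
    (psi : H) (w : R -> H) : Prop := {
  sol_continuous : {within `[0, T], continuous w} ;
  sol_dom : forall t : R, 0 < t <= T -> domA (w t) ;
  sol_derivable : forall t : R, 0 < t <= T -> derivable_upto T w t ;
  sol_frac_derivable : forall t : R, 0 < t <= T ->
    frac_derivable T alpha (A \o w) t ;
  sol_derive_continuous : {in `]0, T[, continuous (derive_upto T w)} ;
  sol_A_continuous : {in `]0, T[, continuous (A \o w)} ;
  sol_frac_continuous : {in `]0, T[, continuous (frac_derive T alpha (A \o w))} ;
  sol_equation : forall t : R, 0 < t <= T ->
    derive_upto T w t +
      (A (w t) + of_real cplx gamma *: frac_derive T alpha (A \o w) t) = 0 ;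
  sol_nonlocal : w t0 = of_real cplx beta *: w 0 + psi }.

End FractionalHilbert.

(* Scalar Riemann-Liouville derivative of a function on the half-line. *)
Definition scalar_frac_primitive (R : realType) (alpha : R) (y : R -> R)
    (t : R) : R :=
  \int[lebesgue_measure]_(s in `]0, t[) (omega (1 - alpha) (t - s) * y s).

Record scalar_cauchy (R : realType) (gamma alpha lam : R) (y : R -> R) :
    Prop := {
  sc_continuous : {within `[0, +oo[, continuous y} ;
  sc_derivable : forall t : R, 0 < t -> derivable y t 1 ;
  sc_frac_derivable : forall t : R, 0 < t ->
    derivable (scalar_frac_primitive alpha y) t 1 ;
  sc_equation : forall t : R, 0 < t ->
    derive1 y t +
      lam * (y t + gamma * derive1 (scalar_frac_primitive alpha y) t) = 0 ;
  sc_initial : y 0 = 1 }.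

Definition K0 (R : realType) (B : R -> R -> R) (lam : nat -> R) (t0 beta : R) :
    set nat :=
  [set k | B (lam k) t0 = beta].

Section Series.
Variables (R : realType) (cplx : bool).
Variable H : completeNormedModType (scalars R cplx).

(* The series of the u k with k in S, in increasing order, converges to x. *)
Definition sums_to (S : set nat) (u : nat -> H) (x : H) : Prop :=
  \sum_(0 <= k < n | k \in S) u k @[n --> \oo] --> x.

Definition nonlocal_term (ip : {dot H for conj_scalar cplx}) (v : nat -> H)
    (lam : nat -> R) (B : R -> R -> R) (t0 beta : R) (psi : H) (t : R)
    (k : nat) : H :=
  (ip psi (v k) / of_real cplx (B (lam k) t0 - beta)
     * of_real cplx (B (lam k) t)) *: v k.

Definition free_term (v : nat -> H) (lam : nat -> R) (B : R -> R -> R)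
    (h : nat -> scalars R cplx) (t : R) (k : nat) : H :=
  (h k * of_real cplx (B (lam k) t)) *: v k.

End Series.

(* Main.v *)
Require Import Defs.
From HB Require Import structures.
From mathcomp Require Import all_boot all_order all_algebra sesquilinear.
From mathcomp Require Import complex.
From mathcomp Require Import all_classical all_reals all_analysis.
From mathcomp Require Import measurable_realfun simple_functions measurable_fun_approximation.
From mathcomp Require Import ring lra.

Set Implicit Arguments.
Unset Strict Implicit.
Unset Printing Implicit Defensive.

Import Order.TTheory GRing.Theory Num.Theory.
Import numFieldNormedType.Exports.
Import HBSimple HBNNSimple.

Local Open Scope classical_set_scope.
Local Open Scope ring_scope.

(** The operator is diagonal in the basis [v], so everything is reduced to the
    scalar problem with l = lam k, of which only bounds uniform in [k] are needed.

    The scalar problem. Integrated once, it is the Volterra equation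
    y + l (g * y) = 1 with the positive nonincreasing kernel
    g = 1 + gamma omega_(1 - alpha), which has at most one bounded solution
    ([volterra_gronwall]: in an exponentially weighted norm the convolution is a
    contraction). A comparison at a first zero gives 0 < y < 1 ([sc_gt0],
    [sc_lt1]). The key point is that [y] is nonincreasing and convex. Since g - 1
    is a superposition of decaying exponentials, y (t + tau) can be written as a
    positive definite combination of states at times [t] and [tau]
    ([sc_semigroup], proved by uniqueness for the Volterra equation); this makes
    [y] midpoint convex, and a bounded convex function on the half-line is
    nonincreasing. Monotonicity inserted in the Volterra equation gives
    l y <= 1 / t and l y <= C t^(alpha - 1); monotonicity of y' and the mean value
    theorem give |y'| <= 2 / t and the continuity of y'; the equation then bounds
    the fractional derivative by 3 / (gamma t), all this uniformly in [l].

    The Hilbert space. A bounded real sequence [m] defines an operator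
    [multiplier m], continuous in [m] for pointwise bounded convergence
    ([multiplier_continuous]). With the scalar bounds, t |-> multiplier (B t) x is
    differentiated, multiplied by A ([domain_of_coef], by self-adjointness) and
    convolved with the singular kernel ([bochner_multiplier]) mode by mode, so it
    solves the equation. Conversely, a real functional that sees one mode only
    turns an arbitrary solution into a scalar one, because it commutes with the
    Bochner integral ([bochner_functional]); hence every solution is
    multiplier (B t) (w 0).

    The nonlocal condition thus becomes (B (lam k) t0 - beta) (w 0)_k = psi_k for
    every [k]. All B (lam k) t0 lie in ]0, 1[ and tend to 0, so for beta <> 0 the
    inverses of the nonzero factors are bounded, and the factor vanishes for
    finitely many [k] only, for none outside ]0, 1[. Existence, uniqueness, the
    orthogonality conditions, the series and the estimate follow. *)

(** * Changes of variable and the Gamma integral *)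

Section ChangeOfVariable.
Variable R : realType.
Local Notation mu := (@lebesgue_measure R).
Local Open Scope ereal_scope.

Lemma integral_shift (c : R) (f : R -> \bar R) :
  measurable_fun [set: R] f -> (forall x, 0 <= f x) ->
  \int[mu]_x f (x + c)%R = \int[mu]_x f x.
Proof.
move=> mf f0; pose phi x : measurableTypeR R := (x + c)%R.
have mphi : measurable_fun [set: measurableTypeR R] phi.
  exact: measurable_funD.
have <- : \int[pushforward mu phi]_x f x = \int[mu]_x f x.
  apply: eq_measure_integral => A mA _; apply/esym.
  apply: lebesgue_measure_unique => //= _ [[a b]] _ <-.
  rewrite /pushforward /= (_ : phi @^-1` _ = `](a - c)%R, (b - c)%R]%classic).
    rewrite !lebesgue_measure_itv/= !lte_fin ltrBlDr subrK.
    by case: ifPn => // _; rewrite -!EFinB; congr EFin; ring.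
  by apply/seteqP; split=> x; rewrite /phi /= !in_itv/= ltrBlDr lerBrDr.
by rewrite ge0_integral_pushforward.
Qed.

Lemma integral_reflect (c : R) (f : R -> \bar R) :
  measurable_fun [set: R] f -> (forall x, 0 <= f x) ->
  \int[mu]_x f (c - x)%R = \int[mu]_x f x.
Proof.
move=> mf f0.
pose phi x : measurableTypeR R := (- x)%R.
have mphi : measurable_fun [set: measurableTypeR R] phi by exact: measurable_funN.
have <- : \int[pushforward mu phi]_x f (x + c)%R = \int[mu]_x f x.
  rewrite -(integral_shift c mf f0); apply: eq_measure_integral => A mA _.
  exact: lebesgue_measureN.
rewrite ge0_integral_pushforward//=.
- by apply: eq_integral => x _; rewrite addrC.
- by apply: measurableT_comp => //; exact: measurable_funD.
Qed.

Lemma integral_scale (a : R) (f : R -> \bar R) : (0 < a)%R ->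
  measurable_fun [set: R] f -> (forall x, 0 <= f x) ->
  \int[mu]_x f (a * x)%R = (a^-1)%:E * \int[mu]_x f x.
Proof.
move=> a0 mf f0.
pose phi x : measurableTypeR R := (a * x)%R.
have mphi : measurable_fun [set: measurableTypeR R] phi by exact: measurable_funM.
have ai0 : (0 <= a^-1)%R by rewrite invr_ge0 ltW.
rewrite -[in RHS](ge0_integral_mscale mu measurableT (NngNum ai0))//.
have -> : \int[mscale (NngNum ai0) mu]_x f x = \int[pushforward mu phi]_x f x.
  apply: eq_measure_integral => A mA _.
  pose nu := measure_function_pushforward__canonical__measure_function_Measure
    mu mphi.
  have : mu A = mscale (NngNum (ltW a0)) nu A.
    apply: lebesgue_measure_unique => //= _ [[b c]] _ <-.
    rewrite /mscale /= /pushforward.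
    rewrite (_ : phi @^-1` _ = `](b / a)%R, (c / a)%R]%classic).
      rewrite !lebesgue_measure_itv/= !lte_fin ltr_pM2r ?invr_gt0//.
      case: ifPn => bc; last by rewrite mule0.
      rewrite -!EFinB -EFinM; congr EFin; field; exact: lt0r_neq0.
    by apply/seteqP; split=> x; rewrite /phi /= !in_itv/=
      ltr_pdivrMr// ler_pdivlMr// mulrC.
  move=> muA; transitivity ((a^-1)%:E * mu A); first by [].
  rewrite muA; transitivity ((a^-1)%:E * (a%:E * nu A)); first by [].
  by rewrite muleA -EFinM mulVf ?mul1e//; exact: lt0r_neq0.
by rewrite ge0_integral_pushforward.
Qed.

End ChangeOfVariable.

Section GammaKernel.
Variable R : realType.
Local Notation mu := (@lebesgue_measure R).

Lemma integral_expR (rho : R) : 0 < rho ->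
  (\int[mu]_(x in `]0%R, +oo[) (expR (- (rho * x)))%:E = (rho^-1)%:E)%E.
Proof.
move=> rho0.
have cE : continuous (fun x : R => expR (- (rho * x))).
  move=> x; apply: continuous_comp; last exact: continuous_expR.
  by apply: continuousN; apply: continuousM; [exact: cvg_cst|exact: cvg_id].
rewrite integral_itv_obnd_cbnd; last first.
  by apply/measurable_EFinP/measurable_funTS; exact: continuous_measurable_fun.
rewrite (@ge0_continuous_FTC2y _ _
  (fun x => - (rho^-1 * expR (- (rho * x)))) _ 0)//.
- by rewrite mulr0 oppr0 expR0 mulr1 EFinN oppeK add0e.
- exact: continuous_subspaceT.
- rewrite -oppr0 -(mulr0 rho^-1); apply: cvgN; apply: cvgM; first exact: cvg_cst.
  apply: (@cvg_comp _ _ _ (fun z => rho * z) (fun z => expR (- z))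
    _ (pinfty_nbhs R)); last exact: cvgr_expR.
  exact: gt0_cvgMry.
- by apply/cvg_at_right_filter; apply: cvgN; apply: cvgM; [exact: cvg_cst|exact: cE].
- move=> x _; rewrite derive1E.
  have : is_derive x 1 (fun x => - (rho^-1 * expR (- (rho * x)))) (expR (- (rho * x))).
    apply: is_derive_eq; rewrite /GRing.scale /=; field; exact: lt0r_neq0.
  by move=> [].
Qed.

(** The primitive a^-1 x^a stays bounded on [e, 1[ as e decreases to 0. *)
Lemma integral_powR01 (a : R) : 0 < a ->
  (\int[mu]_(x in `]0%R, 1%R[) (x `^ (a - 1))%:E < +oo)%E.
Proof.
move=> a0; have ai0 : 0 <= a^-1 by rewrite invr_ge0 ltW.
suff : (\int[mu]_(x in `]0%R, 1%R[) (x `^ (a - 1))%:E <= a^-1%:E)%E.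
  by move=> /le_lt_trans; apply; rewrite ltry.
pose F (n : nat) := `]n.+2%:R^-1, 1%R[%classic : set R.
have -> : `]0%R, 1%R[%classic = \bigcup_n F n.
  apply/seteqP; split=> x /=.
    rewrite in_itv/= => /andP[x0 x1]; exists (Num.truncn x^-1) => //=.
    rewrite /F /= in_itv/= x1 andbT invf_plt ?posrE//.
    by rewrite (lt_trans (truncnS_gt _))// ltr_nat.
  case=> n _; rewrite /F /= !in_itv/= => /andP[nx ->]; rewrite andbT.
  by rewrite (lt_trans _ nx)// invr_gt0.
have mp (D : set R) : measurable_fun D (fun x : R => (x `^ (a - 1))%:E).
  by apply/measurable_EFinP/measurable_funTS; exact: measurable_powR.
have ndF : nondecreasing_seq F.
  apply/nondecreasing_seqP => n; rewrite subsetEset; apply: subset_itvr.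
  by rewrite bnd_simp lef_pV2 ?posrE// ler_nat.
have := @ge0_nondecreasing_set_cvg_integral _ (measurableTypeR R) R F (fun x => (x `^ (a - 1))%:E) mu.
move=> /(_ ndF (fun n => measurable_itv _) (fun i => mp _)) h.
have {}h := h (fun i x _ => powR_ge0 x (a - 1)).
rewrite -(cvg_lim _ h)//; apply: lime_le; first by apply/cvg_ex; eexists; exact: h.
apply: nearW => n; rewrite /F; set e := n.+2%:R^-1.
have e0 : 0 < e by rewrite invr_gt0.
have e1 : e < 1 by rewrite invf_lt1// ltr1n.
apply: (@le_trans _ _ (\int[mu]_(x in `[e, 1%R]) (x `^ (a - 1))%:E)%E).
  apply: ge0_subset_integral => //=.
  - exact: mp.
  - by move=> x _; rewrite lee_fin powR_ge0.
  - exact: subset_itv_oo_cc.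
have dp x : 0 < x -> derivable (fun x => a^-1 * x `^ a) x 1.
  by move=> x0; apply: derivableM => //; apply: derivable_powR; rewrite in_itv/= x0.
have cp x b : 0 < x -> {for x, continuous (fun x : R => x `^ b)}.
  move=> x0; apply/differentiable_continuous/derivable1_diffP.
  by apply: derivable_powR; rewrite in_itv/= x0.
have cp' x : 0 < x -> {for x, continuous (fun x : R => a^-1 * x `^ a)}.
  by move=> x0; exact/differentiable_continuous/derivable1_diffP/dp.
rewrite (@continuous_FTC2 _ _ (fun x => a^-1 * x `^ a))//.
- rewrite -EFinB lee_fin powR1 mulr1 lerBlDr lerDl mulr_ge0 ?powR_ge0//.
- apply: continuous_in_subspaceT => x; rewrite inE/= in_itv/= => /andP[ex _].
  by apply: cp; exact: lt_le_trans ex.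
- split.
  + by move=> x; rewrite in_itv/= => /andP[ex _]; apply: dp; exact: lt_trans ex.
  + by apply: cvg_at_right_filter; exact: cp'.
  + by apply: cvg_at_left_filter; exact: cp'.
- move=> x; rewrite in_itv/= => /andP[ex _].
  have x0 : 0 < x by exact: lt_trans ex.
  rewrite derive1E.
  have := @is_derive1_powR _ a x x0 => dpx.
  have : is_derive x 1 (fun x => a^-1 * x `^ a) (x `^ (a - 1)).
    apply: is_derive_eq; rewrite /GRing.scale /=; field; exact: lt0r_neq0.
  by move=> [].
Qed.

Section GammaFun.
Variable a : R.
Hypothesis a01 : 0 < a < 1.

Lemma measurable_gamma_integrand (rho : R) (D : set R) :
  measurable_fun D (fun u : R => (u `^ (a - 1) * expR (- (rho * u)))%:E).
Proof.
apply/measurable_EFinP/measurable_funTS/measurable_funM.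
  exact: measurable_powR.
apply: measurableT_comp => //; apply: measurable_funN.
exact: measurable_funM.
Qed.

Lemma gamma_integral_ltry :
  (\int[mu]_(u in `]0%R, +oo[) (u `^ (a - 1) * expR (- u))%:E < +oo)%E.
Proof.
case/andP: a01 => a0 a1.
have mg D := measurable_gamma_integrand 1 (D := D).
under eq_integral do rewrite -[u in expR (- u)]mul1r.
rewrite (@itv_bndbnd_setU _ _ _ (BLeft 1%R)) ?bnd_simp//.
rewrite ge0_integral_setU//=; last 3 first.
- exact: mg.
- by move=> x _; rewrite lee_fin mulr_ge0 ?powR_ge0 ?expR_ge0.
- apply/disj_setPRL => x /=; rewrite !in_itv/= andbT => x1.
  by apply/negP; rewrite negb_and -[X in _ || X]leNgt x1 orbT.
apply: lte_add_pinfty.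
  apply: le_lt_trans (integral_powR01 a0); apply: ge0_le_integral => //=.
  - by move=> x _; rewrite lee_fin mulr_ge0 ?powR_ge0 ?expR_ge0.
  - exact: mg.
  - by apply/measurable_EFinP/measurable_funTS; exact: measurable_powR.
  - move=> x; rewrite in_itv/= => /andP[x0 _].
    rewrite lee_fin ler_piMr ?powR_ge0// mul1r expRN invf_le1 ?expR_gt0//.
    by rewrite -[leLHS]expR0 ler_expR ltW.
apply: (@le_lt_trans _ _
  (\int[mu]_(x in `]0%R, +oo[) (expR (- (1 * x)))%:E)%E); last first.
  by rewrite integral_expR// ltry.
have me (D : set R) : measurable_fun D (fun x : R => (expR (- (1 * x)))%:E).
  apply/measurable_EFinP/measurable_funTS; apply: measurableT_comp => //.
  by apply: measurable_funN; exact: measurable_funM.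
apply: (@le_trans _ _ (\int[mu]_(x in `[1%R, +oo[) (expR (- (1 * x)))%:E)%E).
  apply: ge0_le_integral => //=.
  - by move=> x _; rewrite lee_fin mulr_ge0 ?powR_ge0 ?expR_ge0.
  - exact: mg.
  - exact: me.
  - move=> x; rewrite in_itv/= andbT => x1.
    rewrite lee_fin ler_piMl ?expR_ge0// -(opprB 1 a) powRN invf_le1; last first.
      by rewrite powR_gt0// (lt_le_trans _ x1).
    by rewrite -[leLHS](powRr0 x) ler_powR// subr_ge0 ltW.
apply: ge0_subset_integral => //=.
- exact: me.
- by apply: subset_itvr; rewrite bnd_simp.
Qed.

Lemma integral_gammaE :
  (\int[mu]_(u in `]0%R, +oo[) (u `^ (a - 1) * expR (- u))%:E = (Gamma a)%:E)%E.
Proof.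
rewrite /Gamma /Rintegral fineK// ge0_fin_numE; last first.
  by apply: integral_ge0 => x _; rewrite lee_fin mulr_ge0 ?powR_ge0 ?expR_ge0.
exact: gamma_integral_ltry.
Qed.

(** This scaling law serves twice: it gives the Laplace transform of [omega],
    hence estimates in exponentially weighted norms, and read backwards it writes
    [omega] itself as a superposition of exponentials. *)
Lemma integral_gamma_scaled (rho : R) : 0 < rho ->
  (\int[mu]_(u in `]0%R, +oo[) (u `^ (a - 1) * expR (- (rho * u)))%:E =
   (Gamma a * rho `^ (- a))%:E)%E.
Proof.
move=> rho0; case/andP: (a01) => a0 a1.
pose f (u : R) : \bar R :=
  if u \in `]0%R, +oo[ then (u `^ (a - 1) * expR (- (1 * u)))%:E else 0%E.
have f0 u : (0 <= f u)%E.
  by rewrite /f; case: ifP => // _; rewrite lee_fin mulr_ge0 ?powR_ge0 ?expR_ge0.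
have mf : measurable_fun [set: R] f.
  have := measurable_gamma_integrand 1 (D := `]0%R, +oo[).
  move/(measurable_restrictT _ (measurable_itv _)); apply: eq_measurable_fun => u _.
  by rewrite /f patchE mem_setE.
have -> : (\int[mu]_(u in `]0%R, +oo[) (u `^ (a - 1) * expR (- (rho * u)))%:E =
    (rho `^ (1 - a))%:E * \int[mu]_u f (rho * u)%R)%E.
  rewrite integral_mkcond -ge0_integralZl//; first last.
  - by rewrite lee_fin powR_ge0.
  - by apply: measurableT_comp => //; exact: measurable_funM.
  apply: eq_integral => u _; rewrite patchE mem_setE /f !in_itv/= !andbT.
  rewrite pmulr_rgt0//; case: ifPn => u0; last by rewrite mule0.
  rewrite -EFinM; congr EFin; rewrite mul1r powRM ?ltW// !mulrA -powRD.
    by rewrite addrA subrK subrr powRr0 mul1r.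
  by rewrite (gt_eqF rho0) implybT.
rewrite integral_scale// muleA -EFinM.
have -> : (\int[mu]_u f u = (Gamma a)%:E)%E.
  rewrite -integral_gammaE [RHS]integral_mkcond; apply: eq_integral => u _.
  by rewrite patchE mem_setE /f mul1r.
rewrite -EFinM mulrC -(powR_inv1 (ltW rho0)) -powRD.
  by rewrite addrAC subrr add0r.
by rewrite (gt_eqF rho0) implybT.
Qed.

Lemma Gamma_gt0 : 0 < Gamma a.
Proof.
case/andP: (a01) => a0 a1; rewrite -lte_fin -integral_gammaE.
apply: (@lt_le_trans _ _ (\int[mu]_(u in `]0%R, 1%R[) (expR (-1))%:E)%E).
  by rewrite integral_cst//= lebesgue_measure_itv/= lte_fin ltr01 -EFinB subr0
    mule1 lte_fin expR_gt0.
have mg D := measurable_gamma_integrand 1 (D := D).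
apply: (@le_trans _ _ (\int[mu]_(u in `]0%R, 1%R[) (u `^ (a - 1) * expR (- (1 * u)))%:E)%E).
  apply: ge0_le_integral => //=.
  - exact: mg.
  - move=> x; rewrite in_itv/= => /andP[x0 x1].
    rewrite lee_fin mul1r -[leLHS]mul1r ler_pM ?expR_ge0//; last first.
      by rewrite ler_expR lerN2 ltW.
    by rewrite -[leLHS](powRr0 x) ger_powR ?x0 ?ltW// ltrBlDr add0r.
under [leRHS]eq_integral do rewrite -[u in expR (- u)]mul1r.
apply: ge0_subset_integral => //=.
- exact: mg.
- by move=> x _; rewrite lee_fin mulr_ge0 ?powR_ge0 ?expR_ge0.
- exact: subset_itvl.
Qed.

End GammaFun.

End GammaKernel.

(** * The memory kernel and its Volterra equation *)

Section Kernel.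
Variable R : realType.
Local Notation mu := (@lebesgue_measure R).
Variables (gamma alpha : R).
Hypothesis gamma_gt0 : 0 < gamma.
Hypothesis alpha01 : 0 < alpha < 1.

Let alphaC : 0 < 1 - alpha < 1.
Proof. by case/andP: alpha01 => a0 a1; rewrite subr_gt0 a1 ltrBlDr ltrDl. Qed.

Lemma omega_ge0 (t : R) : 0 <= omega (1 - alpha) t.
Proof. by rewrite /omega divr_ge0 ?powR_ge0// ltW// Gamma_gt0. Qed.

Lemma measurable_omega (D : set R) : measurable_fun D (omega (1 - alpha)).
Proof.
apply: measurable_funTS; apply: measurable_funM => //; exact: measurable_powR.
Qed.

Lemma powR_nincr (r p q : R) : r <= 0 -> 0 < p -> p <= q -> q `^ r <= p `^ r.
Proof.
move=> r0 p0 pq; have q0 := lt_le_trans p0 pq.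
rewrite -(opprK r) !(powRN _ (- r)) lef_pV2 ?posrE ?powR_gt0//.
by apply: ge0_ler_powR; rewrite ?nnegrE ?oppr_ge0// ltW.
Qed.

Lemma omega_nincr (p q : R) : 0 < p -> p <= q ->
  omega (1 - alpha) q <= omega (1 - alpha) p.
Proof.
move=> p0 pq; rewrite /omega ler_pM2r ?invr_gt0 ?Gamma_gt0//.
apply: powR_nincr => //; case/andP: alpha01 => a0 _.
by rewrite addrAC subrr add0r oppr_le0 ltW.
Qed.

(** Density of the positive measure of which [omega (1 - alpha)] is the Laplace
    transform, that is, the witness of its complete monotonicity. *)
Definition omega_density (s : R) : R :=
  s `^ (alpha - 1) / (Gamma alpha * Gamma (1 - alpha)).

Lemma omega_density_ge0 s : 0 <= omega_density s.
Proof. by rewrite divr_ge0 ?powR_ge0// mulr_ge0// ltW// Gamma_gt0. Qed.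

Lemma measurable_omega_density (D : set R) : measurable_fun D omega_density.
Proof.
apply: measurable_funTS; apply: measurable_funM => //; exact: measurable_powR.
Qed.

Lemma omega_laplace (p : R) : 0 < p ->
  (\int[mu]_(s in `]0%R, +oo[) (omega_density s * expR (- (s * p)))%:E =
   (omega (1 - alpha) p)%:E)%E.
Proof.
move=> p0.
have G0 : 0 < (Gamma alpha * Gamma (1 - alpha)) by rewrite mulr_gt0 ?Gamma_gt0.
under eq_integral do rewrite /omega_density mulrAC mulrC EFinM mulrC (mulrC _ p).
rewrite ge0_integralZl//=; last 3 first.
- apply: measurable_gamma_integrand.
- by move=> x _; rewrite lee_fin mulr_ge0 ?powR_ge0 ?expR_ge0.
- by rewrite lee_fin invr_ge0 mulrC ltW.
rewrite integral_gamma_scaled// -EFinM; congr EFin.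
rewrite /omega addrAC subrr add0r.
have := lt0r_neq0 (Gamma_gt0 alpha01); have := lt0r_neq0 (Gamma_gt0 alphaC).
by move: (Gamma _) (Gamma _) (p `^ _) => x y z x0 y0; field; rewrite x0 y0.
Qed.

Lemma integral_omega_expR (rho : R) : 0 < rho ->
  (\int[mu]_(p in `]0%R, +oo[) (omega (1 - alpha) p * expR (- (rho * p)))%:E =
   (rho `^ (alpha - 1))%:E)%E.
Proof.
move=> rho0.
under eq_integral do rewrite /omega mulrAC mulrC EFinM.
rewrite ge0_integralZl//=; last 3 first.
- exact: measurable_gamma_integrand.
- by move=> x _; rewrite lee_fin mulr_ge0 ?powR_ge0 ?expR_ge0.
- by rewrite lee_fin invr_ge0 ltW// Gamma_gt0.
rewrite integral_gamma_scaled// -EFinM mulrA mulVf ?mul1r ?opprB//.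
by rewrite lt0r_neq0// Gamma_gt0.
Qed.

(** Integrated once, the scalar Cauchy problem (of Rayleigh-Stokes type) becomes
    the Volterra equation u + l (rs_kernel * u) = u 0: the 1 comes from the term
    l u, the other term from the fractional derivative. *)
Definition rs_kernel (p : R) : R := 1 + gamma * omega (1 - alpha) p.
Local Notation g := rs_kernel.

Lemma rs_kernel_ge1 p : 1 <= g p.
Proof. by rewrite lerDl mulr_ge0 ?omega_ge0// ltW. Qed.

Lemma rs_kernel_ge0 p : 0 <= g p.
Proof. exact: le_trans (rs_kernel_ge1 p). Qed.

Lemma measurable_rs_kernel (D : set R) : measurable_fun D g.
Proof.
apply: measurable_funD => //; apply: measurable_funM => //.
exact: measurable_omega.
Qed.

Lemma measurable_rs_kernel_reflect (t : R) (D : set R) :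
  measurable_fun D (fun s => g (t - s)).
Proof.
apply: measurable_funTS; apply: measurableT_comp.
  exact: measurable_rs_kernel.
exact: measurable_funB.
Qed.

Lemma rs_kernel_nincr (p q : R) : 0 < p -> p <= q -> g q <= g p.
Proof.
by move=> p0 pq; rewrite lerD2l ler_pM2l// omega_nincr.
Qed.

Lemma measurable_expRM (rho : R) (D : set R) :
  measurable_fun D (fun x : R => expR (- (rho * x))).
Proof.
apply/measurable_funTS; apply: measurableT_comp => //.
by apply: measurable_funN; exact: measurable_funM.
Qed.

Lemma integral_rs_kernel_expR (rho : R) : 0 < rho ->
  (\int[mu]_(p in `]0%R, +oo[) (g p * expR (- (rho * p)))%:E =
   (rho^-1 + gamma * rho `^ (alpha - 1))%:E)%E.
Proof.
move=> rho0.
under eq_integral do rewrite /rs_kernel mulrDl mul1r -mulrA EFinD EFinM.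
have mk : measurable_fun (`]0%R, +oo[ : set R)
    (fun p : R => (omega (1 - alpha) p * expR (- (rho * p)))%:E).
  apply/measurable_EFinP/measurable_funM; first exact: measurable_omega.
  exact: measurable_expRM.
rewrite ge0_integralD//=.
- rewrite integral_expR// ge0_integralZl//=; last 2 first.
  + by move=> x _; rewrite lee_fin mulr_ge0 ?omega_ge0 ?expR_ge0.
  + by rewrite lee_fin ltW.
  by rewrite integral_omega_expR// -EFinM.
- by apply/measurable_EFinP; exact: measurable_expRM.
- move=> x _; rewrite -EFinM lee_fin.
  by apply: mulr_ge0; [exact: ltW|rewrite mulr_ge0 ?omega_ge0 ?expR_ge0].
- exact: measurable_funeM.
Qed.

(** A strong exponential weight makes the norm of the convolution with the kernel
    small. *)
Lemma rs_kernel_weight_small (eps : R) : 0 < eps ->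
  exists2 rho : R, 0 < rho & rho^-1 + gamma * rho `^ (alpha - 1) <= eps.
Proof.
move=> eps0; case/andP: alphaC => a0 a1.
have h : (rho : R) + gamma * rho `^ (1 - alpha) @[rho --> 0^'+] --> (0 : R).
  rewrite -[X in _ --> X](addr0 0) -[X in _ --> _ + X](mulr0 gamma).
  apply: cvgD; first by apply: cvg_at_right_filter; exact: cvg_id.
  by apply: cvgM; [exact: cvg_cst|exact: powR_cvg0].
near (0 : R)^'+ => d.
have d0 : 0 < d by near: d; exact: nbhs_right_gt.
exists d^-1; first by rewrite invr_gt0.
rewrite invrK -(powR_inv1 (ltW d0)) -powRrM mulN1r opprB.
apply: le_trans (ler_norm _) _; near: d.
move/cvgr0Pnorm_le : h; exact.
Unshelve. all: by end_near. Qed.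

(** On ]0, t[ the weight e^(- rho p) is at least e^(- rho t). *)
Lemma integral_rs_kernel_le (rho t : R) : 0 < rho -> 0 < t ->
  (\int[mu]_(p in `]0%R, t[) (g p)%:E <=
   (expR (rho * t) * (rho^-1 + gamma * rho `^ (alpha - 1)))%:E)%E.
Proof.
move=> rho0 t0; rewrite EFinM -integral_rs_kernel_expR//.
have mge (D : set R) : measurable_fun D (fun p => (g p * expR (- (rho * p)))%:E).
  apply/measurable_EFinP/measurable_funM; first exact: measurable_rs_kernel.
  exact: measurable_expRM.
rewrite -ge0_integralZl//=; last 2 first.
- exact: mge.
- by move=> x _; rewrite lee_fin mulr_ge0 ?rs_kernel_ge0 ?expR_ge0.
apply: (@le_trans _ _ (\int[mu]_(p in `]0%R, t[)
    ((expR (rho * t))%:E * (g p * expR (- (rho * p)))%:E))%E).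
  apply: ge0_le_integral => //=.
  - by move=> x _; rewrite lee_fin rs_kernel_ge0.
  - by apply/measurable_EFinP; exact: measurable_rs_kernel.
  - by apply: measurable_funeM; exact: mge.
  - move=> x; rewrite in_itv/= => /andP[x0 xt].
    rewrite -EFinM lee_fin mulrCA ler_peMr ?rs_kernel_ge0//.
    by rewrite -expRD -[leLHS]expR0 ler_expR subr_ge0 ler_pM2l// ltW.
apply: ge0_subset_integral => //=.
- by apply: measurable_funeM; exact: mge.
- by move=> x _; rewrite -EFinM lee_fin !mulr_ge0 ?rs_kernel_ge0 ?expR_ge0.
- exact: subset_itvl.
Qed.

Lemma integral_reflect_oo (a t : R) (f : R -> \bar R) :
  measurable_fun [set: R] f -> (forall x, (0 <= f x)%E) ->
  (\int[mu]_(s in `]a, t[) f (t - s)%R = \int[mu]_(s in `]0%R, (t - a)%R[) f s)%E.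
Proof.
move=> mf f0; rewrite [RHS]integral_mkcond -(integral_reflect t)//; last 2 first.
- by apply/(measurable_restrictT f) => //; exact: measurable_funS mf.
- by move=> x; exact: erestrict_ge0.
rewrite integral_mkcond; apply: eq_integral => x _; rewrite !patchE !mem_setE.
by rewrite !in_itv/= subr_gt0 ltrD2l ltrN2 andbC.
Qed.

Lemma integral_reflect_itv (t : R) (f : R -> \bar R) :
  measurable_fun [set: R] f -> (forall x, (0 <= f x)%E) ->
  (\int[mu]_(s in `]0%R, t[) f (t - s)%R = \int[mu]_(s in `]0%R, t[) f s)%E.
Proof. by move=> mf f0; rewrite integral_reflect_oo// subr0. Qed.

Lemma integral_rs_kernel_reflect (a t : R) :
  (\int[mu]_(s in `]a, t[) (g (t - s)%R)%:E = \int[mu]_(s in `]0%R, (t - a)%R[) (g s)%:E)%E.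
Proof.
rewrite (@integral_reflect_oo a t (EFin \o g))//.
  by apply/measurable_EFinP; exact: measurable_rs_kernel.
by move=> x; rewrite lee_fin rs_kernel_ge0.
Qed.

(** Once the weight e^(rho t) makes the norm of the convolution with l g at most
    1/2, each use of the inequality halves the bound on [N]. *)
Lemma volterra_gronwall (l T M : R) (N : R -> R) : 0 <= l ->
  measurable_fun `]0%R, T[ N -> (forall t : R, 0 < t < T -> 0 <= N t <= M) ->
  (forall t : R, 0 < t < T ->
    ((N t)%:E <= l%:E * \int[mu]_(s in `]0%R, t[) (g (t - s)%R * N s)%:E)%E) ->
  forall t : R, 0 < t < T -> N t = 0.
Proof.
move=> l0 mN NM hN.
have e0 : 0 < (2 * (l + 1))^-1 by rewrite invr_gt0 mulr_gt0// ltr_wpDl.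
have [rho rho0 hrho] := rs_kernel_weight_small e0.
have mge (D : set R) : measurable_fun D (fun p => (g p * expR (- (rho * p)))%:E).
  apply/measurable_EFinP/measurable_funM; first exact: measurable_rs_kernel.
  exact: measurable_expRM.
have key n t : 0 < t < T -> N t <= M * 2^-1 ^+ n * expR (rho * t).
  elim: n t => [|n IH] t tT; case/andP: (tT) => t0 tT'.
    rewrite expr0 mulr1 (le_trans (proj2 (andP (NM t tT))))//.
    rewrite ler_peMr//; last first.
      by rewrite -[leLHS]expR0 ler_expR mulr_ge0 ?ltW.
    by case/andP: (NM t tT) => /le_trans h /h.
  have Mn0 : 0 <= M * 2^-1 ^+ n.
    by rewrite mulr_ge0 ?exprn_ge0//; case/andP: (NM t tT) => /le_trans h /h.
  rewrite -lee_fin (le_trans (hN t tT))//.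
  have mNt : measurable_fun `]0%R, t[ N.
    by apply: measurable_funS mN => //; apply: subset_itvl; rewrite bnd_simp ltW.
  have mg' := measurable_rs_kernel_reflect t (D := `]0%R, t[).
  apply: (@le_trans _ _ (l%:E * \int[mu]_(s in `]0%R, t[)
     ((M * 2^-1 ^+ n * expR (rho * t))%:E *
       (g (t - s)%R * expR (- (rho * (t - s))))%:E))%E).
    apply: lee_wpmul2l; rewrite ?lee_fin//.
    apply: ge0_le_integral => //=.
    - move=> s; rewrite in_itv/= => /andP[s0 st].
      rewrite lee_fin mulr_ge0 ?rs_kernel_ge0//.
      by have /andP[] : 0 <= N s <= M by apply: NM; rewrite s0 (lt_trans st).
    - by apply/measurable_EFinP; exact: measurable_funM.
    - apply: measurable_funeM; apply: (measurableT_comp (mge _)).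
      exact: measurable_funB.
    - move=> s; rewrite in_itv/= => /andP[s0 st].
      rewrite -EFinM lee_fin mulrCA ler_wpM2l ?rs_kernel_ge0//.
      rewrite -(mulrA (M * _)) -expRD mulrBr opprB addrCA subrr addr0.
      by apply: IH; rewrite s0 (lt_trans st).
  rewrite ge0_integralZl//=; last 3 first.
  - by apply: (measurableT_comp (mge _)); exact: measurable_funB.
  - by move=> s _; rewrite lee_fin mulr_ge0 ?rs_kernel_ge0 ?expR_ge0.
  - by rewrite lee_fin mulr_ge0 ?expR_ge0.
  rewrite (integral_reflect_itv t (mge _)); last first.
    by move=> s; rewrite lee_fin mulr_ge0 ?rs_kernel_ge0 ?expR_ge0.
  apply: (@le_trans _ _ (l%:E * ((M * 2^-1 ^+ n * expR (rho * t))%:E *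
    \int[mu]_(p in `]0%R, +oo[) (g p * expR (- (rho * p)))%:E))%E).
    apply: lee_wpmul2l; rewrite ?lee_fin//.
    apply: lee_wpmul2l; first by rewrite lee_fin; apply: mulr_ge0 => //; exact: expR_ge0.
    apply: ge0_subset_integral => //=.
    - exact: mge.
    - by move=> s _; rewrite lee_fin mulr_ge0 ?rs_kernel_ge0 ?expR_ge0.
    - exact: subset_itvl.
  rewrite integral_rs_kernel_expR// -!EFinM lee_fin.
  have -> : M * 2^-1 ^+ n.+1 * expR (rho * t) =
    (M * 2^-1 ^+ n * expR (rho * t)) * 2^-1 by rewrite exprSr; ring.
  rewrite mulrCA ler_wpM2l//; first by apply: mulr_ge0 => //; exact: expR_ge0.
  apply: (le_trans (ler_wpM2l l0 hrho)); rewrite invfM mulrCA -[leRHS]mulr1.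
  rewrite ler_pM2l ?invr_gt0// ler_pdivrMr ?mul1r ?lerDl//.
  by rewrite ltr_wpDl.
move=> t tT; apply/eqP; rewrite eq_le; have /andP[-> _] := NM t tT.
rewrite andbT.
have h : M * 2^-1 ^+ n * expR (rho * t) @[n --> \oo] --> M * 0 * expR (rho * t).
  apply: cvgM; last exact: cvg_cst.
  apply: cvgM; first exact: cvg_cst.
  by apply: cvg_expr; rewrite ger0_norm// invf_lt1// ltr1n.
rewrite mulr0 mul0r in h; rewrite -(cvg_lim _ h)//.
by apply: limr_ge; [apply/cvg_ex; exists 0|apply: nearW => n; exact: key].
Qed.

Lemma integrable_omega_conv (u : R -> R) (t M : R) : 0 < t ->
  measurable_fun `]0%R, t[ u -> (forall s : R, 0 < s < t -> `|u s| <= M) ->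
  mu.-integrable `]0%R, t[
    (EFin \o (fun s => omega (1 - alpha) (t - s) * u s)).
Proof.
move=> t0 mu' uM.
have M0 : 0 <= M.
  by apply: le_trans (uM (t / 2) _) => //; rewrite divr_gt0// ltr_pdivrMr// ltr_pMr// ltr1n.
have mk : measurable_fun `]0%R, t[ (fun s => omega (1 - alpha) (t - s)).
  apply: measurable_funTS; apply: measurableT_comp; first exact: measurable_omega.
  exact: measurable_funB.
apply/integrableP; split.
  by apply/measurable_EFinP; exact: measurable_funM.
have t1 : 0 < t^-1 by rewrite invr_gt0.
have := integral_rs_kernel_le t1 t0.
move=> hle; apply: (@le_lt_trans _ _ ((M / gamma)%:E *
   \int[mu]_(s in `]0%R, t[) (g (t - s)%R)%:E)%E); last first.
  rewrite integral_rs_kernel_reflect subr0.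
  apply: (@le_lt_trans _ _ (((M / gamma)%:E * (expR (t^-1 * t) *
    (t^-1^-1 + gamma * t^-1 `^ (alpha - 1)))%:E))%E); last by rewrite -EFinM ltry.
  by apply: lee_wpmul2l => //; rewrite lee_fin divr_ge0 // ltW.
rewrite -ge0_integralZl//=; last 3 first.
- by apply/measurable_EFinP; exact: measurable_rs_kernel_reflect.
- by move=> x _; rewrite lee_fin rs_kernel_ge0.
- by rewrite lee_fin divr_ge0// ltW.
apply: ge0_le_integral => //=.
- by apply/measurable_EFinP; apply: measurableT_comp => //; exact: measurable_funM.
- by apply: measurable_funeM; apply/measurable_EFinP; exact: measurable_rs_kernel_reflect.
- move=> s; rewrite in_itv/= => st; rewrite -EFinM lee_fin normrM.
  rewrite (ger0_norm (omega_ge0 _)) mulrC mulrAC -mulrA.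
  apply: (ler_pM _ _ (uM _ st)); rewrite ?omega_ge0//.
  by rewrite ler_pdivlMr// mulrC lerDr.
Qed.

Lemma rs_kernel_convE (u : R -> R) (t M : R) : 0 < t ->
  measurable_fun `]0%R, t[ u -> (forall s : R, 0 < s < t -> `|u s| <= M) ->
  mu.-integrable `]0%R, t[ (EFin \o (fun s => g (t - s) * u s)) /\
  \int[mu]_(s in `]0%R, t[) (g (t - s) * u s) =
  \int[mu]_(s in `]0%R, t[) u s + gamma * scalar_frac_primitive alpha u t.
Proof.
move=> t0 mu' uM.
have iu : mu.-integrable `]0%R, t[ (EFin \o u).
  apply: (@measurable_bounded_integrable _ _ _ mu) => //.
    by rewrite /= lebesgue_measure_itv/= lte_fin t0 -EFinB ltry.
  exists M; split; first by rewrite num_real.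
  by move=> x Mx s /=; rewrite in_itv/= => st; rewrite (le_trans (uM s st))// ltW.
have ik := integrable_omega_conv t0 mu' uM.
have ik' : mu.-integrable `]0%R, t[
    (EFin \o (fun s => gamma * (omega (1 - alpha) (t - s) * u s))).
  have := integrableZl _ gamma ik.
  by apply; exact: measurable_itv.
have E : (fun s => g (t - s) * u s) =
    (fun s => u s + gamma * (omega (1 - alpha) (t - s) * u s)).
  by apply/funext => s; rewrite /rs_kernel mulrDl mul1r mulrA.
rewrite E; split; first by have := integrableD _ iu ik'; apply; exact: measurable_itv.
rewrite RintegralD//; congr (_ + _); rewrite RintegralZl//.
Qed.

Lemma continuous_itv_bounded (T : R) (u : R -> R) :
  {within `[0, T], continuous u} -> exists M : R, forall t : R, 0 <= t <= T -> `|u t| <= M.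
Proof.
move=> uc; have [T0|T0] := leP 0 T; last first.
  by exists 0 => t /andP[t0 tT]; have := lt_le_trans T0 (le_trans t0 tT); rewrite ltxx.
have uc' : {within `[0, T], continuous (fun t => `|u t|)}.
  by move=> t; apply: continuous_comp; [exact: uc|exact: norm_continuous].
have [c _ hc] := EVT_max T0 uc'; exists `|u c| => t tT.
by apply: hc; rewrite in_itv.
Qed.

(** The left-hand side has derivative 0 on ]0, T[ by the differential equation,
    and it tends to [u 0] at 0 because [u] is bounded and the kernel integrable. *)
Lemma volterra_of_cauchy (l T : R) (u : R -> R) : 0 < T ->
  {within `[0, T], continuous u} ->
  (forall t : R, 0 < t < T -> derivable u t 1) ->
  (forall t : R, 0 < t < T -> derivable (scalar_frac_primitive alpha u) t 1) ->
  (forall t : R, 0 < t < T -> derive1 u t +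
    l * (u t + gamma * derive1 (scalar_frac_primitive alpha u) t) = 0) ->
  forall t : R, 0 < t < T ->
    mu.-integrable `]0%R, t[ (EFin \o (fun s => g (t - s) * u s)) /\
    u t + l * \int[mu]_(s in `]0%R, t[) (g (t - s) * u s) = u 0.
Proof.
move=> T0 cu du dk eq.
have [M uM] := continuous_itv_bounded cu.
have iuT : mu.-integrable `[0%R, T] (EFin \o u).
  by apply: continuous_compact_integrable => //; exact: segment_compact.
have cuo s : 0 < s < T -> {for s, continuous u}.
  by move=> sT; exact/differentiable_continuous/derivable1_diffP/du.
have muT (t : R) : t <= T -> measurable_fun `]0%R, t[ u.
  move=> tT; have /measurable_EFinP := measurable_int mu iuT.
  apply: measurable_funS => //.
  by move=> x /=; rewrite !in_itv/= => /andP[/ltW -> /ltW/le_trans->].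
have M0 : 0 <= M by apply: le_trans (uM 0 _) => //; rewrite lexx ltW.
pose U t := \int[mu]_(s in `[0, t]) u s.
have UE t : t <= T -> \int[mu]_(s in `]0%R, t[) u s = U t.
  move=> tT; rewrite /U -(@Rintegral_itv_obnd_cbnd R) ?(@Rintegral_itv_bndo_bndc R)//.
    apply: integrableS iuT => //.
    by move=> x /=; rewrite !in_itv/= => /andP[/ltW -> /ltW/le_trans->].
  apply: integrableS iuT => //.
  by move=> x /=; rewrite !in_itv/= => /andP[/ltW -> /le_trans->].
have conv t : 0 < t < T ->
    mu.-integrable `]0%R, t[ (EFin \o (fun s => g (t - s) * u s)) /\
    \int[mu]_(s in `]0%R, t[) (g (t - s) * u s) =
    U t + gamma * scalar_frac_primitive alpha u t.
  move=> /andP[t0 tT]; rewrite -UE ?ltW//.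
  apply: (@rs_kernel_convE u t M) => //; first by apply: muT; exact: ltW.
  by move=> s /andP[s0 st]; apply: uM; rewrite ltW//= ltW// (lt_trans st).
pose F t := u t + l * (U t + gamma * scalar_frac_primitive alpha u t).
have dF t : 0 < t < T -> is_derive t (1 : R) F 0.
  move=> tT; case/andP: (tT) => t0 tT'.
  have [dU U'] : derivable U t 1 /\ derive1 U t = u t.
    exact: (continuous_FTC1_closed tT' iuT t0 (cuo _ tT)).
  have dk' := dk _ tT; have du' := du _ tT.
  have := eq _ tT; rewrite -U' !derive1E => {}eq.
  have gen (a b c : R -> R) (a' b' c' : R) : is_derive t (1 : R) a a' ->
      is_derive t (1 : R) b b' -> is_derive t (1 : R) c c' ->
      is_derive t (1 : R) (fun x => a x + l * (b x + gamma * c x))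
        (a' + l * (b' + gamma * c')).
    by move=> *; apply: is_derive_eq; rewrite /GRing.scale/=; ring.
  have := gen _ _ _ _ _ _ (derivableP du') (derivableP dU) (derivableP dk').
  by rewrite eq.
have cF t : 0 < t < T -> {for t, continuous F}.
  move=> tT; apply/differentiable_continuous/derivable1_diffP.
  by have [] := dF _ tT.
have Fcst s t : 0 < s -> s < t -> t < T -> F t = F s.
  move=> s0 st tT.
  have [] := @MVT _ F (fun=> 0) s t st.
  - move=> x; rewrite in_itv/= => /andP[sx xt]; apply: dF.
    by rewrite (lt_trans s0 sx) (lt_trans xt).
  - apply: continuous_in_subspaceT => x; rewrite inE/= in_itv/= => /andP[sx xt].
    by apply: cF; rewrite (lt_le_trans s0 sx) (le_lt_trans xt).
  - by move=> c _; rewrite mul0r => /eqP; rewrite subr_eq0 => /eqP.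
move=> t tT; case/andP: (tT) => t0 tT'; have [ic cE] := conv _ tT; split => //.
rewrite cE -/(F t).
pose h (s : R) := `|u s - u 0| + `|l| * (M * (expR 1 * (s + gamma * s `^ (1 - alpha)))).
have hF s : 0 < s < t -> `|F t - u 0| <= h s.
  case/andP => s0 st; have sT : 0 < s < T by rewrite s0 (lt_trans st).
  rewrite (Fcst s)// /F addrAC (le_trans (ler_normD _ _))// lerD2l.
  have [ics csE] := conv _ sT; rewrite -csE normrM ler_wpM2l//.
  rewrite -lee_fin EFin_normr_Rintegral//.
  apply: (le_trans (le_abse_integral _ _ _)) => //; first exact: measurable_int ics.
  have mgs := measurable_rs_kernel_reflect s (D := `]0%R, s[).
  apply: (@le_trans _ _ (\int[mu]_(r in `]0%R, s[) (M%:E * (g (s - r)%R)%:E))%E).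
    apply: ge0_le_integral => //=.
    - apply/measurable_EFinP; apply: measurableT_comp => //.
      by apply: measurable_funM => //; apply: muT; case/andP: sT => _ /ltW.
    - by apply: measurable_funeM; apply/measurable_EFinP.
    - move=> r; rewrite in_itv/= => /andP[r0 rs].
      rewrite -EFinM lee_fin normrM (ger0_norm (rs_kernel_ge0 _)) mulrC.
      rewrite ler_wpM2r ?rs_kernel_ge0// uM// ltW//= ltW// (lt_trans rs)//.
      by case/andP: sT.
  rewrite ge0_integralZl//=; last 2 first.
  - by apply/measurable_EFinP.
  - by move=> r _; rewrite lee_fin rs_kernel_ge0.
  rewrite EFinM; apply: lee_wpmul2l; first by rewrite lee_fin.
  rewrite integral_rs_kernel_reflect subr0.
  have si0 : 0 < s^-1 by rewrite invr_gt0.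
  have sE : s^-1 `^ (alpha - 1) = s `^ (1 - alpha).
    by rewrite -(powR_inv1 (ltW s0)) -powRrM mulN1r opprB.
  by have := integral_rs_kernel_le si0 s0; rewrite mulVf ?lt0r_neq0// invrK sE.
have ch : h s @[s --> 0^'+] --> (0 : R).
  rewrite [X in _ --> X](_ : _ =
    `|u 0 - u 0| + `|l| * (M * (expR 1 * (0 + gamma * 0)))); last first.
    by rewrite subrr normr0 !mulr0 addr0 !mulr0 addr0.
  apply: cvgD.
    apply: cvg_norm; apply: cvgB; last exact: cvg_cst.
    by have /(continuous_within_itvP _ T0)[] := cu.
  do 3 (apply: cvgM; first exact: cvg_cst).
  apply: cvgD; first by apply: cvg_at_right_filter; exact: cvg_id.
  apply: cvgM; [exact: cvg_cst|apply: powR_cvg0].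
  by case/andP: alphaC.
apply/eqP; rewrite -subr_eq0 -normr_le0 -[leRHS](cvg_lim _ ch)//.
apply: limr_ge; first by apply/cvg_ex; exists 0.
near=> s; apply: hF; apply/andP; split.
  by near: s; exact: nbhs_right_gt.
by near: s; exact: nbhs_right_lt.
Unshelve. all: by end_near. Qed.

(** The distance of two solutions satisfies the hypothesis of
    [volterra_gronwall]. *)
Lemma volterra_unique (l T M : R) (u1 u2 : R -> R) :
  measurable_fun `]0%R, T[ u1 -> measurable_fun `]0%R, T[ u2 ->
  (forall t : R, 0 < t < T -> `|u1 t| <= M) ->
  (forall t : R, 0 < t < T -> `|u2 t| <= M) ->
  (forall t : R, 0 < t < T ->
    u1 t + l * \int[mu]_(s in `]0%R, t[) (g (t - s) * u1 s) =
    u2 t + l * \int[mu]_(s in `]0%R, t[) (g (t - s) * u2 s)) ->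
  forall t : R, 0 < t < T -> u1 t = u2 t.
Proof.
move=> m1 m2 b1 b2 h t tT; apply/eqP; rewrite -subr_eq0 -normr_eq0; apply/eqP.
have mN : measurable_fun `]0%R, T[ (fun t => `|u1 t - u2 t|).
  by apply: measurableT_comp => //; exact: measurable_funB.
move: t tT; apply: (@volterra_gronwall `|l| T (M + M) (fun t => `|u1 t - u2 t|)) => //.
  move=> t tT; rewrite normr_ge0/= (le_trans (ler_normB _ _))//.
  by rewrite lerD ?b1 ?b2.
move=> t tT; case/andP: (tT) => t0 tT'.
have sub : `]0, t[%classic `<=` (`]0, T[%classic : set R).
  by apply: subset_itvl; rewrite bnd_simp ltW.
have st s : 0 < s < t -> 0 < s < T.
  by move=> /andP[-> st]; rewrite (lt_trans st).
have [i1 _] := @rs_kernel_convE u1 t M t0 (measurable_funS (measurable_itv _) sub m1)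
  (fun s h => b1 s (st s h)).
have [i2 _] := @rs_kernel_convE u2 t M t0 (measurable_funS (measurable_itv _) sub m2)
  (fun s h => b2 s (st s h)).
have -> : u1 t - u2 t = l * (\int[mu]_(s in `]0%R, t[) (g (t - s) * u2 s) -
    \int[mu]_(s in `]0%R, t[) (g (t - s) * u1 s)).
  by have := h _ tT; move: (Rintegral _ _ _) (Rintegral _ _ _) => a b; lra.
rewrite -RintegralB// normrM EFinM; apply: lee_wpmul2l; first by rewrite lee_fin.
have ib : mu.-integrable `]0%R, t[
    (EFin \o (fun s => g (t - s) * u2 s - g (t - s) * u1 s)).
  by have := integrableB _ i2 i1; apply; exact: measurable_itv.
rewrite EFin_normr_Rintegral//.
apply: (le_trans (le_abse_integral _ _ _)) => //; first exact: measurable_int ib.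
apply: ge0_le_integral => //=.
- apply/measurable_EFinP; apply: measurableT_comp => //.
  by have /measurable_EFinP := measurable_int mu ib.
- apply/measurable_EFinP; apply: measurable_funM.
    exact: measurable_rs_kernel_reflect.
  exact: measurable_funS mN.
- move=> s _; rewrite lee_fin -mulrBr normrM (ger0_norm (rs_kernel_ge0 _)).
  by rewrite distrC.
Qed.

End Kernel.

(** * The scalar solution lies between 0 and 1 *)

Section ScalarSolution.
Variable R : realType.
Local Notation mu := (@lebesgue_measure R).
Variables (gamma alpha : R).
Hypothesis gamma_gt0 : 0 < gamma.
Hypothesis alpha01 : 0 < alpha < 1.
Local Notation g := (rs_kernel gamma alpha).
Variables (l : R) (y : R -> R).
Hypothesis l_gt0 : 0 < l.
Hypothesis Hy : scalar_cauchy gamma alpha l y.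

Lemma sc_continuous_on (T : R) : {within `[0, T], continuous y}.
Proof.
apply: continuous_subspaceW (sc_continuous Hy) => x /=.
by rewrite !in_itv/= => /andP[->].
Qed.

Lemma sc_continuous_at (t : R) : 0 < t -> {for t, continuous y}.
Proof.
by move=> t0; exact/differentiable_continuous/derivable1_diffP/(sc_derivable Hy).
Qed.

Lemma measurable_sc (T : R) : measurable_fun `]0%R, T[ y.
Proof.
have : mu.-integrable `[0%R, T] (EFin \o y).
  by apply: continuous_compact_integrable;
    [exact: segment_compact|exact: sc_continuous_on].
move/(measurable_int mu)/measurable_EFinP; apply: measurable_funS => //.
exact: subset_itv_oo_cc.
Qed.

Lemma sc_volterra (t : R) : 0 < t ->
  mu.-integrable `]0%R, t[ (EFin \o (fun s => g (t - s) * y s)) /\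
  y t + l * \int[mu]_(s in `]0%R, t[) (g (t - s) * y s) = 1.
Proof.
move=> t0; rewrite -(sc_initial Hy).
apply: (@volterra_of_cauchy _ _ _ gamma_gt0 alpha01 l (t + 1) y).
- by rewrite addr_gt0.
- exact: sc_continuous_on.
- by move=> s /andP[s0 _]; exact: (sc_derivable Hy).
- by move=> s /andP[s0 _]; exact: (sc_frac_derivable Hy).
- by move=> s /andP[s0 _]; exact: (sc_equation Hy).
- by rewrite t0 ltrDl ltr01.
Qed.

Lemma sc_volterraE (t : R) : 0 < t ->
  (\int[mu]_(s in `]0%R, t[) (g (t - s) * y s)%:E = ((1 - y t) / l)%:E)%E.
Proof.
move=> t0; have [ik <-] := sc_volterra t0.
rewrite addrAC subrr add0r mulrC mulrA mulVf ?lt0r_neq0// mul1r /Rintegral fineK//.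
exact: integrable_fin_num ik.
Qed.

(** Compare the Volterra equation at a first zero [t1] with the one at a maximum
    point [c] of [y] over a short interval that ends at [t1]. The integral in it
    would have to grow by at least y c / l from [c] to [t1]; but the memory of
    ]0, c[ only fades, the kernel being nonincreasing, and ]c, t1[ contributes at
    most half of that, the kernel having a small mass near 0. *)
Lemma sc_gt0 (t : R) : 0 <= t -> 0 < y t.
Proof.
move=> t_ge0; rewrite ltNge; apply/negP => yt0.
pose A := [set s : R | 0 <= s /\ forall r : R, 0 <= r <= s -> 0 < y r].
have A0 : A 0.
  split => // r /andP[r0 r0']; have /eqP -> : r == 0 by rewrite eq_le r0' r0.
  by rewrite (sc_initial Hy).
have At s : A s -> s <= t.
  move=> [s0 hs]; rewrite leNgt; apply/negP => ts.
  by have := hs t; rewrite t_ge0 (ltW ts) ltNge yt0 => /(_ isT).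
have supA : has_sup A by split; [exists 0|exists t; exact: At].
pose t1 := sup A.
have ypos s : 0 <= s < t1 -> 0 < y s.
  move=> /andP[s0 st1].
  have d0 : 0 < t1 - s by rewrite subr_gt0.
  have [a [a0 ha]] := sup_adherent d0 supA.
  by rewrite opprB addrCA subrr addr0 => sa; apply: ha; rewrite s0 ltW.
have t1_ge0 : 0 <= t1 by apply: sup_upper_bound.
have yt1 : y t1 <= 0.
  rewrite leNgt; apply/negP => yt1.
  have : \forall s \near t1^'+, 0 < y s.
    have yt1c : y s @[s --> t1^'+] --> y t1.
      move: t1_ge0; rewrite le_eqVlt => /predU1P[<-|t10].
        have /(continuous_within_itvP _ ltr01)[_ + _] := sc_continuous_on (T := 1).
        exact.
      exact: (cvg_at_right_filter (sc_continuous_at t10)).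
    by apply: (cvgr_gt (y t1)).
  rewrite /at_right near_withinE => -[/= d d0 hd].
  have : A (t1 + d / 2).
    split; first by rewrite addr_ge0// divr_ge0// ltW.
    move=> r /andP[r0 rd]; have [rt1|t1r|->//] := ltgtP r t1.
      by apply: ypos; rewrite r0.
    apply: hd => //=; rewrite /ball_/= distrC gtr0_norm ?subr_gt0//.
    by rewrite ltrBlDl (le_lt_trans rd)// ltrD2l ltr_pdivrMr// ltr_pMr// ltr1n.
  move/(sup_upper_bound supA); rewrite -/t1 gerDl leNgt divr_gt0//.
have t10 : 0 < t1.
  rewrite lt_neqAle t1_ge0 andbT; apply/eqP => t10.
  by move: yt1; rewrite -t10 (sc_initial Hy) ler10.
have e0 : 0 < (2 * (l * expR 1))^-1 by rewrite invr_gt0 !mulr_gt0 ?expR_gt0.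
have [rho rho0 hrho] := rs_kernel_weight_small gamma alpha01 e0.
have hsmall s : 0 < s -> s <= rho^-1 ->
    (\int[mu]_(p in `]0%R, s[) (g p)%:E <= ((2 * l)^-1)%:E)%E.
  move=> s0 srho; apply: (le_trans (integral_rs_kernel_le gamma_gt0 alpha01 rho0 s0)).
  rewrite lee_fin (@le_trans _ _ (expR 1 * (2 * (l * expR 1))^-1))//.
    apply: ler_pM; rewrite ?expR_ge0//.
      by rewrite addr_ge0 ?invr_ge0 ?mulr_ge0 ?powR_ge0// ltW.
    by rewrite ler_expR mulrC -ler_pdivlMr// mul1r.
  have := expR_gt0 (1 : R) => e1; rewrite le_eqVlt; apply/orP; left; apply/eqP.
  by field; rewrite !lt0r_neq0.
pose h := Num.min (t1 / 2) rho^-1.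
have h0 : 0 < h by rewrite lt_min divr_gt0//= invr_gt0.
have ht1 : h < t1.
  by rewrite gt_min ltr_pdivrMr// ltr_pMr// ltr1n.
have [c cI hc] : exists2 c, c \in `[t1 - h, t1] &
    forall s, s \in `[t1 - h, t1] -> y s <= y c.
  apply: EVT_max; first by rewrite lerBlDr lerDl ltW.
  apply: continuous_subspaceW (sc_continuous_on (T := t1)) => x /=.
  by rewrite !in_itv/= => /andP[a ->]; rewrite andbT (le_trans _ a)// subr_ge0 ltW.
have yc0 : 0 < y c.
  apply: (@lt_le_trans _ _ (y (t1 - h))).
    by apply: ypos; rewrite subr_ge0 (ltW ht1)/= ltrBlDr ltrDl.
  by apply: hc; rewrite in_itv/= lexx/= lerBlDr lerDl ltW.
move: cI; rewrite in_itv/= => /andP[hc1 ct1].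
have {}ct1 : c < t1.
  rewrite lt_neqAle ct1 andbT; apply/eqP => cE.
  by move: yc0; rewrite cE ltNge yt1.
have c0 : 0 < c by rewrite (lt_le_trans _ hc1)// subr_gt0.
have mgy (D : set R) : measurable D -> D `<=` `]0, t1[ ->
    measurable_fun D (fun s => (g (t1 - s) * y s)%:E).
  move=> mD DI; apply/measurable_EFinP; apply: measurable_funM.
    exact: measurable_rs_kernel_reflect.
  by apply: measurable_funS (measurable_sc (T := t1)).
have yge0 s : 0 < s < t1 -> 0 <= y s.
  by move=> /andP[s0 st]; rewrite ltW// ypos// ltW.
have I1 := sc_volterraE t10; have Ic := sc_volterraE c0.
have : ((\int[mu]_(s in `]0%R, t1[) (g (t1 - s) * y s)%:E) <=
    ((1 - y c) / l)%:E + (y c * (2 * l)^-1)%:E)%E.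
  rewrite (@itv_bndbnd_setU _ _ _ (BRight c)) ?bnd_simp//; last exact: ltW.
  have s1 : `]0, c] `<=` `]0, t1[.
    by apply: subset_itvl; rewrite bnd_simp.
  have s2 : `]c, t1[ `<=` `]0, t1[.
    by apply: subset_itvr; rewrite bnd_simp ltW.
  rewrite ge0_integral_setU//=; last 3 first.
  - by apply: mgy; [exact: measurableU|rewrite subUset].
  - move=> s /= [|] /[!in_itv]/= /andP[s0 sc]; rewrite lee_fin mulr_ge0 ?rs_kernel_ge0// yge0//.
      by rewrite s0 (le_lt_trans sc).
    by rewrite (lt_trans c0 s0) sc.
  - apply/disj_setPRL => x /=; rewrite !in_itv/= => /andP[cx _].
    by apply/negP; rewrite negb_and -[X in _ || X]ltNge cx orbT.
  apply: leeD.
    rewrite -Ic -integral_itv_bndo_bndc; last first.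
      by apply: mgy => //; apply: subset_trans s1; apply: subset_itvl; rewrite bnd_simp.
    apply: ge0_le_integral => //=.
    - move=> s; rewrite in_itv/= => /andP[s0 sc].
      by rewrite lee_fin mulr_ge0 ?rs_kernel_ge0// yge0// s0 (lt_trans sc).
    - by apply: mgy => //; apply: subset_itvl; rewrite bnd_simp ltW.
    - apply/measurable_EFinP; apply: measurable_funM.
        exact: measurable_rs_kernel_reflect.
      exact: measurable_sc.
    - move=> s; rewrite in_itv/= => /andP[s0 sc]; rewrite lee_fin ler_wpM2r//.
        by rewrite yge0// s0 (lt_trans sc).
      apply: rs_kernel_nincr; rewrite ?subr_gt0// lerD2r.
      exact: ltW.
  apply: (@le_trans _ _ (\int[mu]_(s in `]c, t1[) ((y c)%:E * (g (t1 - s)%R)%:E))%E).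
    apply: ge0_le_integral => //=.
    - move=> s; rewrite in_itv/= => /andP[cs st].
      by rewrite lee_fin mulr_ge0 ?rs_kernel_ge0// yge0// st (lt_trans c0).
    - exact: mgy.
    - by apply: measurable_funeM; apply/measurable_EFinP; exact: measurable_rs_kernel_reflect.
    - move=> s; rewrite in_itv/= => /andP[cs st].
      rewrite -EFinM lee_fin mulrC ler_wpM2r ?rs_kernel_ge0//.
      by apply: hc; rewrite in_itv/= (ltW st) (le_trans hc1) ?ltW.
  rewrite ge0_integralZl//=; last 3 first.
  - by apply/measurable_EFinP; exact: measurable_rs_kernel_reflect.
  - by move=> s _; rewrite lee_fin rs_kernel_ge0.
  - by rewrite lee_fin ltW.
  rewrite EFinM; apply: lee_wpmul2l; first by rewrite lee_fin ltW.
  rewrite integral_rs_kernel_reflect//.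
  apply: hsmall; first by rewrite subr_gt0.
  rewrite lerBlDr -lerBlDl (le_trans _ hc1)// lerD2l lerN2.
  by rewrite /h ge_min lexx orbT.
rewrite I1 -EFinD lee_fin invfM mulrA -mulrDl ler_pM2r ?invr_gt0//.
by apply/negP; rewrite -ltNge; lra.
Qed.

Lemma sc_int_ge0 (t s : R) : 0 <= s -> (0 <= (g (t - s) * y s)%:E)%E.
Proof. by move=> s0; rewrite lee_fin mulr_ge0 ?rs_kernel_ge0// ltW// sc_gt0. Qed.

(** On [0, t] the function [y] has a positive minimum, so the memory term of the
    Volterra equation is positive. *)
Lemma sc_lt1 (t : R) : 0 < t -> y t < 1.
Proof.
move=> t0.
have [c cI hc] : exists2 c, c \in `[0, t] & forall s, s \in `[0, t] -> y c <= y s.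
  by apply: EVT_min; [exact: ltW|exact: sc_continuous_on].
have yc0 : 0 < y c by apply: sc_gt0; move: cI; rewrite in_itv/= => /andP[].
have : ((y c * t)%:E <= ((1 - y t) / l)%:E)%E.
  rewrite -(sc_volterraE t0).
  apply: (@le_trans _ _ (\int[mu]_(s in `]0%R, t[) (y c)%:E)%E).
    by rewrite integral_cst//= lebesgue_measure_itv/= lte_fin t0 -EFinB subr0 EFinM.
  apply: ge0_le_integral => //=.
  - by move=> s _; rewrite lee_fin ltW.
  - apply/measurable_EFinP; apply: measurable_funM; last exact: measurable_sc.
    exact: measurable_rs_kernel_reflect.
  - move=> s; rewrite in_itv/= => /andP[s0 st]; rewrite lee_fin.
    rewrite -[leLHS]mul1r ler_pM ?rs_kernel_ge1//; first exact: ltW.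
    by apply: hc; rewrite in_itv/= !ltW.
rewrite lee_fin ler_pdivlMr// => h.
by rewrite -subr_gt0 (lt_le_trans _ h)// !mulr_gt0.
Qed.

Lemma sc_le1 (t : R) : 0 <= t -> y t <= 1.
Proof.
rewrite le_eqVlt => /predU1P[<-|t0]; last by rewrite ltW// sc_lt1.
by rewrite (sc_initial Hy).
Qed.

End ScalarSolution.

(** * Convolutions of nonnegative functions *)

Section Convolution.
Variable R : realType.
Local Notation mu := (@lebesgue_measure R).
Local Notation rR := (measurableTypeR R).
Local Open Scope ereal_scope.

Definition convol (F G : R -> \bar R) (t : R) : \bar R :=
  \int[mu]_s (F (t - s)%R * G s).

Implicit Types F G H : R -> \bar R.

Lemma convol_ge0 F G t : (forall x, 0 <= F x) -> (forall x, 0 <= G x) ->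
  0 <= convol F G t.
Proof. by move=> F0 G0; apply: integral_ge0 => s _; exact: mule_ge0. Qed.

Lemma measurable_shifted F (t : R) : measurable_fun [set: R] F ->
  measurable_fun [set: R] (fun s : R => F (t - s)%R).
Proof. by move=> mF; apply: measurableT_comp => //; exact: measurable_funB. Qed.

Lemma convolC F G t : measurable_fun [set: R] F -> measurable_fun [set: R] G ->
  (forall x, 0 <= F x) -> (forall x, 0 <= G x) -> convol F G t = convol G F t.
Proof.
move=> mF mG F0 G0; rewrite /convol -(integral_reflect t); last 2 first.
- by apply: emeasurable_funM => //; exact: measurable_shifted.
- by move=> x; exact: mule_ge0.
by apply: eq_integral => s _; rewrite opprB addrCA subrr addr0 muleC.
Qed.

Lemma measurable_convol_kernel F G :
  measurable_fun [set: R] F -> measurable_fun [set: R] G ->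
  measurable_fun [set: rR * rR] (fun z => F (z.1 - z.2)%R * G z.2).
Proof.
move=> mF mG; apply: emeasurable_funM; apply: measurableT_comp => //.
by apply: measurable_funB; [exact: measurable_fst|exact: measurable_snd].
Qed.

Lemma measurable_convol F G : measurable_fun [set: R] F ->
  measurable_fun [set: R] G ->
  (forall x, 0 <= F x) -> (forall x, 0 <= G x) ->
  measurable_fun [set: R] (convol F G).
Proof.
move=> mF mG F0 G0.
have := @measurable_fun_fubini_tonelli_F _ _ rR rR R mu
  (fun z => F (z.1 - z.2)%R * G z.2).
apply; first exact: measurable_convol_kernel.
by move=> z; exact: mule_ge0.
Qed.

Lemma convolA F G H t : measurable_fun [set: R] F ->
  measurable_fun [set: R] G -> measurable_fun [set: R] H ->
  (forall x, 0 <= F x) -> (forall x, 0 <= G x) -> (forall x, 0 <= H x) ->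
  convol F (convol G H) t = convol (convol F G) H t.
Proof.
move=> mF mG mH F0 G0 H0.
transitivity (\int[mu]_s \int[mu]_r (F (t - s)%R * (G (s - r)%R * H r))).
  apply: eq_integral => s _; rewrite /convol ge0_integralZl//.
    by apply: emeasurable_funM => //; exact: measurable_shifted.
  by move=> x _; exact: mule_ge0.
rewrite (fubini_tonelli (fun z : rR * rR => F (t - z.1)%R * (G (z.1 - z.2)%R * H z.2)))/=; last 2 first.
- apply: emeasurable_funM; last exact: measurable_convol_kernel.
  by apply: (measurableT_comp (measurable_shifted t mF)); exact: measurable_fst.
- by move=> z; rewrite !mule_ge0.
apply: eq_integral => r _.
transitivity (\int[mu]_s (F (t - s)%R * G (s - r)%R) * H r).
  rewrite -ge0_integralZr//.
  - by apply: eq_integral => s _; rewrite muleA.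
  - apply: emeasurable_funM; first exact: measurable_shifted.
    by apply: measurableT_comp => //; exact: measurable_funB.
  - by move=> s _; exact: mule_ge0.
congr (_ * _); rewrite -(integral_shift r); last 2 first.
- apply: emeasurable_funM; first exact: measurable_shifted.
  by apply: measurableT_comp => //; exact: measurable_funB.
- by move=> s; exact: mule_ge0.
by apply: eq_integral => s _; rewrite opprD addrA addrAC addrK.
Qed.

Lemma convol_addr F G H t : measurable_fun [set: R] F ->
  measurable_fun [set: R] G -> measurable_fun [set: R] H ->
  (forall x, 0 <= F x) -> (forall x, 0 <= G x) -> (forall x, 0 <= H x) ->
  convol F (fun s => G s + H s) t = convol F G t + convol F H t.
Proof.
move=> mF mG mH F0 G0 H0; rewrite /convol -ge0_integralD//.
- by apply: eq_integral => s _; rewrite ge0_muleDr.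
- by move=> s _; exact: mule_ge0.
- by apply: emeasurable_funM => //; exact: measurable_shifted.
- by move=> s _; exact: mule_ge0.
- by apply: emeasurable_funM => //; exact: measurable_shifted.
Qed.

Lemma convol_scaler (k : \bar R) F G t : measurable_fun [set: R] F ->
  measurable_fun [set: R] G ->
  (forall x, 0 <= F x) -> (forall x, 0 <= G x) -> 0 <= k ->
  convol F (fun s => k * G s) t = k * convol F G t.
Proof.
move=> mF mG F0 G0 k0; rewrite /convol -ge0_integralZl//.
- by apply: eq_integral => s _; rewrite muleCA.
- by apply: emeasurable_funM => //; exact: measurable_shifted.
- by move=> s _; exact: mule_ge0.
Qed.

Lemma convol_addl F G H t : measurable_fun [set: R] F ->
  measurable_fun [set: R] G -> measurable_fun [set: R] H ->
  (forall x, 0 <= F x) -> (forall x, 0 <= G x) -> (forall x, 0 <= H x) ->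
  convol (fun s => F s + G s) H t = convol F H t + convol G H t.
Proof.
move=> mF mG mH F0 G0 H0; rewrite /convol -ge0_integralD//.
- by apply: eq_integral => s _; rewrite ge0_muleDl.
- by move=> s _; exact: mule_ge0.
- by apply: emeasurable_funM => //; exact: measurable_shifted.
- by move=> s _; exact: mule_ge0.
- by apply: emeasurable_funM => //; exact: measurable_shifted.
Qed.

(** Convolution with [E] commutes with convolution with [G], so that a Volterra
    equation for [Y] passes to one for the convolution of [E] and [Y]. *)
Lemma convol_volterra (k : \bar R) E G Y O : measurable_fun [set: R] E ->
  measurable_fun [set: R] G -> measurable_fun [set: R] Y ->
  (forall x, 0 <= E x) -> (forall x, 0 <= G x) -> (forall x, 0 <= Y x) ->
  0 <= k -> (forall t, Y t + k * convol G Y t = O t) ->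
  forall t, convol E Y t + k * convol G (convol E Y) t = convol E O t.
Proof.
move=> mE mG mY E0 G0 Y0 k0 eqO t.
have -> : O = (fun r => Y r + k * convol G Y r) by apply/funext => r; rewrite eqO.
have mGY := measurable_convol mG mY G0 Y0.
have GY0 r := convol_ge0 r G0 Y0.
have kGY0 r : 0 <= k * convol G Y r by exact: mule_ge0.
rewrite (convol_addr t mE mY (measurable_funeM _ mGY) E0 Y0 kGY0).
rewrite (convol_scaler t mE mGY E0 GY0 k0).
rewrite (convolA t mG mE mY G0 E0 Y0) (convolA t mE mG mY E0 G0 Y0).
have -> // : convol G E = convol E G.
by apply/funext => r; exact: convolC.
Qed.

Lemma measurable_curry d (T : measurableType d) (K : R -> R -> \bar R)
    (f h : T -> R) :
  measurable_fun [set: rR * rR] (fun z => K z.1 z.2) ->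
  measurable_fun [set: T] f -> measurable_fun [set: T] h ->
  measurable_fun [set: T] (fun x => K (f x) (h x)).
Proof.
by move=> mK mf mh; exact: (measurableT_comp mK (measurable_fun_pair mf mh)).
Qed.

Section WeightedParameter.
Variables (a : R -> \bar R) (K : R -> R -> \bar R).
Hypothesis ma : measurable_fun [set: R] a.
Hypothesis mK : measurable_fun [set: rR * rR] (fun z => K z.1 z.2).
Hypothesis a0 : forall s, 0 <= a s.
Hypothesis K0 : forall s t, 0 <= K s t.

Lemma measurable_param1 (t : R) : measurable_fun [set: R] (fun s => K s t).
Proof. by apply: (measurable_curry mK). Qed.

Lemma measurable_param2 (s : R) : measurable_fun [set: R] (K s).
Proof. by apply: (measurable_curry mK). Qed.

Lemma measurable_integral_param :
  measurable_fun [set: R] (fun t => \int[mu]_s (a s * K s t)).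
Proof.
apply: (@measurable_fun_fubini_tonelli_F _ _ rR rR R mu
  (fun z => a z.2 * K z.2 z.1)); last by move=> z; exact: mule_ge0.
apply: emeasurable_funM; first by apply: measurableT_comp => //; exact: measurable_snd.
by apply: (measurable_curry mK); [exact: measurable_snd|exact: measurable_fst].
Qed.

Lemma measurable_convol_param G : measurable_fun [set: R] G ->
  (forall x, 0 <= G x) ->
  measurable_fun [set: rR * rR] (fun z => convol G (K z.1) z.2).
Proof.
move=> mG G0; have := @measurable_fun_fubini_tonelli_F _ _ (rR * rR)%type rR R mu
  (fun z => G (z.1.2 - z.2)%R * K z.1.1 z.2).
apply; last by move=> z; exact: mule_ge0.
have m1 : measurable_fun [set: (rR * rR) * rR] (fun z => z.1.1).
  by apply: measurableT_comp; [exact: measurable_fst|exact: measurable_fst].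
have m2 : measurable_fun [set: (rR * rR) * rR] (fun z => z.1.2).
  by apply: measurableT_comp; [exact: measurable_snd|exact: measurable_fst].
have m3 : measurable_fun [set: (rR * rR) * rR] (fun z => z.2).
  exact: measurable_snd.
apply: emeasurable_funM; last exact: (measurable_curry mK m1 m3).
by apply: (measurableT_comp mG); exact: measurable_funB.
Qed.

Lemma convol_integral_param G t : measurable_fun [set: R] G ->
  (forall x, 0 <= G x) ->
  convol G (fun r => \int[mu]_s (a s * K s r)) t =
  \int[mu]_s (a s * convol G (K s) t).
Proof.
move=> mG G0.
transitivity (\int[mu]_r \int[mu]_s (G (t - r)%R * (a s * K s r))).
  apply: eq_integral => r _; rewrite ge0_integralZl//.
    by apply: emeasurable_funM => //; exact: measurable_param1.
  by move=> s _; exact: mule_ge0.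
rewrite (fubini_tonelli (fun z : rR * rR => G (t - z.1)%R * (a z.2 * K z.2 z.1)))/=; last 2 first.
- apply: emeasurable_funM.
    by apply: (measurableT_comp (measurable_shifted t mG)); exact: measurable_fst.
  apply: emeasurable_funM; first by apply: measurableT_comp => //; exact: measurable_snd.
  by apply: (measurable_curry mK); [exact: measurable_snd|exact: measurable_fst].
- by move=> z; rewrite !mule_ge0.
apply: eq_integral => s _; rewrite /convol -ge0_integralZl//.
- by apply: eq_integral => r _; rewrite muleCA.
- apply: emeasurable_funM; first exact: measurable_shifted.
  exact: measurable_param2.
- by move=> r _; exact: mule_ge0.
Qed.

End WeightedParameter.

Lemma ge0_integral_combination (k : \bar R) F G H : measurable_fun [set: R] F ->
  measurable_fun [set: R] G -> measurable_fun [set: R] H ->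
  (forall x, 0 <= F x) -> (forall x, 0 <= G x) -> (forall x, 0 <= H x) ->
  0 <= k ->
  \int[mu]_s F s + k * \int[mu]_s G s + \int[mu]_s H s =
  \int[mu]_s (F s + k * G s + H s).
Proof.
move=> mF mG mH F0 G0 H0 k0.
have mkG : measurable_fun [set: R] (fun s => k * G s) by exact: measurable_funeM.
have kG0 s : 0 <= k * G s by exact: mule_ge0.
rewrite -ge0_integralZl// -ge0_integralD//= -ge0_integralD//=.
- by move=> s _; exact: adde_ge0.
- exact: emeasurable_funD.
Qed.

(** Purely additive rearrangement, needed because [\bar R] is not a ring:
    distributivity holds for nonnegative terms only. *)
Lemma ge0_combination (k u v c p q x1 x2 : \bar R) : 0 <= k -> 0 <= u ->
  0 <= v -> 0 <= c -> 0 <= p -> 0 <= q -> 0 <= x1 -> 0 <= x2 ->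
  u * v + k * x1 + k * (u * c + k * x2) + k * (p + q) =
  u * (v + k * c) + k * (p + (x1 + k * x2 + q)).
Proof.
move=> k0 u0 v0 c0 p0 q0 x10 x20.
rewrite !ge0_muleDr ?adde_ge0 ?mule_ge0// (muleCA k u).
rewrite -!addeA; congr (_ + _).
rewrite addeCA; congr (_ + _); rewrite [RHS]addeCA; congr (_ + _).
exact: addeCA.
Qed.

Lemma weighted_am_gm (w p q : \bar R) : 0 <= w -> w \is a fin_num ->
  p \is a fin_num -> q \is a fin_num ->
  w * q * p + w * q * p <= w * p * p + w * q * q.
Proof.
case: w p q => [w| |]// [p| |]// [q| |]// w0 _ _ _.
rewrite -!EFinM -!EFinD lee_fin -subr_ge0.
rewrite (_ : _ - _ = w * (p - q) ^+ 2)%R; last by ring.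
by rewrite mulr_ge0// sqr_ge0.
Qed.

Lemma ge0_le_integralD F G H : measurable_fun [set: R] F ->
  measurable_fun [set: R] G -> measurable_fun [set: R] H ->
  (forall x, 0 <= F x) -> (forall x, 0 <= G x) -> (forall x, 0 <= H x) ->
  (forall x, F x + F x <= G x + H x) ->
  \int[mu]_s F s + \int[mu]_s F s <= \int[mu]_s G s + \int[mu]_s H s.
Proof.
move=> mF mG mH F0 G0 H0 FGH; rewrite -!ge0_integralD//.
apply: ge0_le_integral => //.
- by move=> s _; exact: adde_ge0.
- exact: emeasurable_funD.
- exact: emeasurable_funD.
Qed.

(** Functions on the half-line are extended by 0, so that the convolution over
    the whole line is the causal one. *)
Definition causal (f : R -> R) (t : R) : \bar R :=
  if (0 < t)%R then (f t)%:E else 0.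

Lemma causalE (f : R -> R) t : (0 < t)%R -> causal f t = (f t)%:E.
Proof. by rewrite /causal => ->. Qed.

Lemma causal_le0 (f : R -> R) t : (t <= 0)%R -> causal f t = 0.
Proof. by rewrite /causal ltNge => ->. Qed.

Lemma causal_ge0 (f : R -> R) : (forall t, 0 < t -> 0 <= f t)%R ->
  forall t, 0 <= causal f t.
Proof. by move=> f0 t; rewrite /causal; case: ifPn => // /f0; rewrite lee_fin. Qed.

Lemma measurable_causal (f : R -> R) : measurable_fun (`]0%R, +oo[ : set R) f ->
  measurable_fun [set: R] (causal f).
Proof.
move=> /measurable_EFinP/(measurable_restrictT _ (measurable_itv _)).
apply: eq_measurable_fun => t _.
by rewrite /causal patchE mem_setE in_itv/= andbT.
Qed.

Lemma convol_le0 F G t : (t <= 0)%R -> (forall x, x <= 0 -> F x = 0)%R ->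
  (forall x, x <= 0 -> G x = 0)%R -> convol F G t = 0.
Proof.
move=> t0 F0 G0; apply: integral0_eq => s _.
have [s0|s0] := leP s 0%R; first by rewrite G0 ?mule0.
by rewrite F0 ?mul0e// subr_le0 (le_trans t0)// ltW.
Qed.

Lemma convol_itv F G t : (forall x, x <= 0 -> F x = 0)%R ->
  (forall x, x <= 0 -> G x = 0)%R ->
  convol F G t = \int[mu]_(s in `]0%R, t[) (F (t - s)%R * G s).
Proof.
move=> F0 G0; rewrite [RHS]integral_mkcond; apply: eq_integral => s _.
rewrite patchE mem_setE in_itv/=; case: ifPn => //.
rewrite negb_and -!leNgt => /orP[s0|ts]; first by rewrite G0 ?mule0.
by rewrite F0 ?mul0e// subr_le0.
Qed.

Lemma convol_causal (f h : R -> R) t :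
  convol (causal f) (causal h) t = \int[mu]_(s in `]0%R, t[) (f (t - s)%R * h s)%:E.
Proof.
rewrite convol_itv; [|by move=> x; exact: causal_le0..].
apply: eq_integral => s; rewrite inE/= in_itv/= => /andP[s0 st].
by rewrite !causalE ?subr_gt0.
Qed.

Lemma convol_expR_one (s t : R) : (0 < s)%R -> (0 < t)%R ->
  convol (causal (fun p => expR (- (s * p)))) (causal (fun=> 1%R)) t =
  ((1 - expR (- (s * t))) / s)%:E.
Proof.
move=> s0 t0; rewrite convol_causal.
under eq_integral do rewrite mulr1.
have cE : continuous (fun x : R => expR (- (s * x))).
  move=> x; apply: continuous_comp; last exact: continuous_expR.
  by apply: continuousN; apply: continuousM; [exact: cvg_cst|exact: cvg_id].
have mE : measurable_fun [set: R] (fun p : R => (expR (- (s * p)))%:E).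
  by apply/measurable_EFinP; exact: continuous_measurable_fun.
rewrite (@integral_reflect_itv _ t (fun p => (expR (- (s * p)))%:E))//.
have mEI i : measurable_fun [set` i] (fun p : R => (expR (- (s * p)))%:E).
  exact: measurable_funS mE.
rewrite integral_itv_obnd_cbnd ?integral_itv_bndo_bndc//.
rewrite (@continuous_FTC2 _ _ (fun x : R => - (s^-1 * expR (- (s * x))))%R)//.
- rewrite -EFinB; congr EFin; rewrite mulr0 oppr0 expR0 mulr1 opprK mulrBl mul1r.
  by rewrite addrC mulrC.
- exact: continuous_subspaceT.
- split.
  + by move=> x _; exact: ex_derive.
  + apply: cvg_at_right_filter; apply: cvgN; apply: cvgM; first exact: cvg_cst.
    exact: cE.
  + apply: cvg_at_left_filter; apply: cvgN; apply: cvgM; first exact: cvg_cst.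
    exact: cE.
- move=> x _; rewrite derive1E.
  have : is_derive x 1%R (fun x => - (s^-1 * expR (- (s * x))))%R (expR (- (s * x))).
    apply: is_derive_eq; rewrite /GRing.scale /=; field; exact: lt0r_neq0.
  by move=> [].
Qed.

End Convolution.

(** * The semigroup identity and midpoint convexity *)

Section SemigroupIdentity.
Variable R : realType.
Local Notation mu := (@lebesgue_measure R).
Local Notation rR := (measurableTypeR R).
Variables (gamma alpha : R).
Hypothesis gamma_gt0 : 0 < gamma.
Hypothesis alpha01 : 0 < alpha < 1.
Local Notation g := (rs_kernel gamma alpha).
Variables (l : R) (y : R -> R).
Hypothesis l_gt0 : 0 < l.
Hypothesis Hy : scalar_cauchy gamma alpha l y.
Local Open Scope ereal_scope.

Let ye := causal y.
Let ge := causal g.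
Let ee (s : R) := causal (fun p => expR (- (s * p))).
Let one := causal (fun=> 1%R : R).
(** The kernel minus 1 is the Laplace transform of the measure of density [dm]. *)
Let dm := causal (fun s => gamma * omega_density alpha s)%R.

Let y_gt0 := sc_gt0 gamma_gt0 alpha01 l_gt0 Hy.

Let ye_ge0 t : 0 <= ye t.
Proof. by apply: causal_ge0 => {}t t0; exact/ltW/y_gt0/ltW. Qed.

Let ge_ge0 t : 0 <= ge t.
Proof. by apply: causal_ge0 => {}t t0; exact: rs_kernel_ge0. Qed.

Let ee_ge0 s t : 0 <= ee s t.
Proof. by apply: causal_ge0 => {}t t0; exact: expR_ge0. Qed.

Let one_ge0 t : 0 <= one t.
Proof. by apply: causal_ge0. Qed.

Let dm_ge0 s : 0 <= dm s.
Proof.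
by apply: causal_ge0 => {}s s0; rewrite mulr_ge0 ?omega_density_ge0 ?ltW.
Qed.

Let mye : measurable_fun [set: R] ye.
Proof.
apply: measurable_causal; apply: open_continuous_measurable_fun.
  exact: interval_open.
by move=> x; rewrite inE/= in_itv/= andbT; exact: (sc_continuous_at Hy).
Qed.

Let mge : measurable_fun [set: R] ge.
Proof. by apply: measurable_causal; exact: measurable_rs_kernel. Qed.

Let mee s : measurable_fun [set: R] (ee s).
Proof.
apply: measurable_causal; exact: measurable_expRM.
Qed.

Let mone : measurable_fun [set: R] one.
Proof. exact: measurable_causal. Qed.

Let mdm : measurable_fun [set: R] dm.
Proof.
apply: measurable_causal; apply: measurable_funM => //.
exact: measurable_omega_density.
Qed.

Let volterra t : ye t + l%:E * convol ge ye t = one t.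
Proof.
have [t0|t0] := ltP 0%R t; last first.
  rewrite /ye /one !causal_le0// convol_le0// ?mule0 ?adde0//;
    by move=> x; exact: causal_le0.
rewrite convol_causal (sc_volterraE gamma_gt0 alpha01 l_gt0 Hy t0) /ye /one !causalE//.
by rewrite -EFinM mulrCA mulfV ?lt0r_neq0// mulr1 -EFinD addrC subrK.
Qed.

(** State of the memory attached to the exponential of rate [s]: of the past of
    [y] it keeps what later times need. *)
Let Z (s : R) := convol (ee s) ye.

Let Z_ge0 s t : 0 <= Z s t.
Proof. exact: convol_ge0. Qed.

Let mee2 : measurable_fun [set: rR * rR] (fun z => ee z.1 z.2).
Proof.
rewrite /ee /causal; apply: measurable_fun_ifT => //.
  by apply: measurable_fun_ltr => //; exact: measurable_snd.
apply/measurable_EFinP; apply: measurableT_comp => //; apply: measurable_funN.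
by apply: measurable_funM; [exact: measurable_fst|exact: measurable_snd].
Qed.

Let mZ2 : measurable_fun [set: rR * rR] (fun z => Z z.1 z.2).
Proof.
have -> : (fun z : rR * rR => Z z.1 z.2) = (fun z => convol ye (ee z.1) z.2).
  by apply/funext => z; exact: convolC.
exact: (measurable_convol_param mee2 ee_ge0 mye ye_ge0).
Qed.

Let l_ge0 : 0 <= l%:E. Proof. by rewrite lee_fin ltW. Qed.

Let mZ s : measurable_fun [set: R] (Z s) := measurable_param2 mZ2 s.
Let mZ1 t := measurable_param1 mZ2 t.

Let Z_volterra s t : Z s t + l%:E * convol ge (Z s) t = convol (ee s) one t.
Proof.
exact: (convol_volterra (mee s) mge mye (ee_ge0 s) ge_ge0 ye_ge0 l_ge0 volterra).
Qed.

Let Z_fin s t : (0 < s)%R -> (0 < t)%R -> Z s t \is a fin_num.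
Proof.
move=> s0 t0; rewrite ge0_fin_numE//.
apply: (@le_lt_trans _ _ (convol (ee s) one t)).
  rewrite -Z_volterra leeDl//; apply: mule_ge0 => //; exact: convol_ge0.
by rewrite convol_expR_one// ltry.
Qed.

Let ge_laplace p : (0 < p)%R -> ge p = 1 + \int[mu]_s (dm s * ee s p).
Proof.
move=> p0; rewrite /ge causalE// /rs_kernel EFinD; congr (_ + _).
rewrite EFinM -(omega_laplace alpha01 p0) -ge0_integralZl//=; last 3 first.
- apply/measurable_EFinP/measurable_funM; first exact: measurable_omega_density.
  by have := measurable_expRM p; under eq_fun do rewrite mulrC; exact.
- by move=> s _; rewrite lee_fin mulr_ge0 ?omega_density_ge0 ?expR_ge0.
- by rewrite lee_fin ltW.
rewrite integral_mkcond; apply: eq_integral => s _.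
rewrite patchE mem_setE in_itv/= andbT /dm /ee /causal p0.
by case: ifPn => s0; rewrite ?mul0e// -!EFinM mulrA.
Qed.

Let dms_ge0 s : 0 <= dm s * s%:E.
Proof.
have [s0|s0] := ltP 0%R s; first by rewrite mule_ge0// lee_fin ltW.
by rewrite /dm causal_le0// mul0e.
Qed.

Let mdms : measurable_fun [set: R] (fun s => dm s * s%:E).
Proof. by apply: emeasurable_funM => //; exact/measurable_EFinP. Qed.

Section FixedShift.
Variable tau : R.
Hypothesis tau0 : (0 < tau)%R.

Let a (s : R) := dm s * s%:E * Z s tau.

Let a0 s : 0 <= a s. Proof. exact: mule_ge0. Qed.

Let ma : measurable_fun [set: R] a.
Proof. exact: emeasurable_funM. Qed.

(** Candidate for y (t + tau). *)
Let W (t : R) := ye tau * ye t + l%:E * \int[mu]_s (a s * Z s t).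

Let mI := measurable_integral_param ma mZ2 a0 Z_ge0.

Let I0 t : 0 <= \int[mu]_s (a s * Z s t).
Proof. by apply: integral_ge0 => s _; exact: mule_ge0. Qed.

Let yy0 t : 0 <= ye tau * ye t. Proof. exact: mule_ge0. Qed.

Let lI0 t : 0 <= l%:E * \int[mu]_s (a s * Z s t). Proof. exact: mule_ge0. Qed.

Let W_ge0 t : 0 <= W t. Proof. exact: adde_ge0. Qed.

Let mW : measurable_fun [set: R] W.
Proof.
apply: emeasurable_funD; first exact: measurable_funeM.
by apply: measurable_funeM; exact: mI.
Qed.

Let W_convol t : convol ge W t = ye tau * convol ge ye t +
  l%:E * \int[mu]_s (a s * convol ge (Z s) t).
Proof.
rewrite (convol_addr t mge (measurable_funeM _ mye) (measurable_funeM _ mI)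
  ge_ge0 yy0 lI0).
rewrite (convol_scaler t mge mye ge_ge0 ye_ge0 (ye_ge0 tau)).
rewrite (convol_scaler t mge mI ge_ge0 I0 l_ge0).
by rewrite (convol_integral_param ma mZ2 a0 Z_ge0 t mge ge_ge0).
Qed.

(** The memory of the past ]0, tau[ as seen at time t + tau. *)
Let past t := \int[mu]_(b in `]0%R, tau[) (g (t + tau - b) * y b)%:E.

Let b (t s : R) := dm s * (expR (- (s * t)))%:E.

Let b0 t s : 0 <= b t s.
Proof. by apply: mule_ge0 => //; rewrite lee_fin expR_ge0. Qed.

Let mb t : measurable_fun [set: R] (b t).
Proof.
apply: emeasurable_funM => //; apply/measurable_EFinP.
by have := measurable_expRM t (D := setT); under eq_fun do rewrite mulrC; exact.
Qed.

Let past_split t : (0 <= t)%R ->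
  past t = convol one ye tau + \int[mu]_s (b t s * Z s tau).
Proof.
move=> t0.
have mJ := measurable_integral_param (mb t) mee2 (b0 t) ee_ge0.
have J0 p : 0 <= \int[mu]_s (b t s * ee s p).
  by apply: integral_ge0 => s _; exact: mule_ge0.
have -> : \int[mu]_s (b t s * Z s tau) =
    convol (fun p => \int[mu]_s (b t s * ee s p)) ye tau.
  rewrite (convolC tau mJ mye J0 ye_ge0).
  rewrite (convol_integral_param (mb t) mee2 (b0 t) ee_ge0 tau mye ye_ge0).
  by apply: eq_integral => s _; congr (_ * _); exact: convolC.
rewrite -(convol_addl tau mone mJ mye one_ge0 J0 ye_ge0).
rewrite convol_itv; last 2 first.
- move=> x x0; rewrite /one causal_le0// add0e integral0_eq// => s _.
  by rewrite /ee causal_le0// mule0.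
- by move=> x x0; exact: causal_le0.
apply: eq_integral => r; rewrite inE/= in_itv/= => /andP[r0 rtau].
have p0 : (0 < tau - r)%R by rewrite subr_gt0.
rewrite /ye /one !causalE// EFinM; congr (_ * _).
have tp0 : (0 < t + tau - r)%R by rewrite -addrA ltr_wpDl.
transitivity (ge (t + tau - r)%R); first by rewrite /ge causalE.
rewrite (ge_laplace tp0); congr (_ + _); apply: eq_integral => s _.
rewrite /b -muleA; congr (_ * _); rewrite /ee !causalE//.
by rewrite -EFinM -expRD -opprD -mulrDr addrA.
Qed.

Let W_volterra t : (0 < t)%R -> W t + l%:E * convol ge W t + l%:E * past t = 1.
Proof.
move=> t0; rewrite (past_split (ltW t0)) W_convol.
have -> : 1 = ye tau + l%:E * past 0.
  have -> : past 0 = convol ge ye tau.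
    rewrite /past /ge /ye convol_causal.
    by apply: eq_integral => r _; rewrite add0r.
  by apply: esym; apply: etrans (volterra tau) _; rewrite /one causalE.
rewrite (past_split (lexx 0%R)).
have b_split : \int[mu]_s (b 0 s * Z s tau) = \int[mu]_s (a s * Z s t) +
    l%:E * \int[mu]_s (a s * convol ge (Z s) t) + \int[mu]_s (b t s * Z s tau).
  have mcZ := @measurable_param1 R (fun s => convol ge (Z s))
    (measurable_convol_param mZ2 Z_ge0 mge ge_ge0) t.
  have cZ0 s : 0 <= convol ge (Z s) t by exact: convol_ge0.
  have e1 : measurable_fun [set: R] (fun s => a s * convol ge (Z s) t).
    exact: emeasurable_funM.
  have e2 : measurable_fun [set: R] (fun s => a s * Z s t).
    exact: emeasurable_funM.
  have e3 : measurable_fun [set: R] (fun s => b t s * Z s tau).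
    exact: emeasurable_funM.
  have p1 s : 0 <= a s * convol ge (Z s) t by exact: mule_ge0.
  have p2 s : 0 <= a s * Z s t by exact: mule_ge0.
  have p3 s : 0 <= b t s * Z s tau by exact: mule_ge0.
  apply/esym; rewrite (ge0_integral_combination e2 e1 e3 p2 p1 p3 l_ge0); apply/esym.
  apply: eq_integral => s _.
  have [s0|s0] := ltP 0%R s; last first.
    by rewrite /a /b /dm causal_le0// !mul0e mule0 !adde0.
  rewrite muleCA -ge0_muleDr//; last by rewrite mule_ge0.
  rewrite Z_volterra /one /ee convol_expR_one// /a /b mulr0 oppr0 expR0 mule1.
  have /fineK <- := Z_fin s0 tau0; rewrite /dm causalE// -!EFinM -EFinD.
  by congr EFin; field; rewrite lt0r_neq0.
rewrite b_split.
have yetau : ye tau = ye tau * (ye t + l%:E * convol ge ye t).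
  have -> : ye t + l%:E * convol ge ye t = 1.
    by apply: etrans (volterra t) _; rewrite /one causalE.
  by rewrite mule1.
rewrite [X in _ = X + _]yetau.
apply: (ge0_combination l_ge0 (ye_ge0 tau) (ye_ge0 t)).
- exact: (convol_ge0 t ge_ge0 ye_ge0).
- exact: (convol_ge0 tau one_ge0 ye_ge0).
- by apply: integral_ge0 => s _; exact: (mule_ge0 (b0 t s) (Z_ge0 s tau)).
- exact: I0.
- apply: integral_ge0 => s _.
  exact: (mule_ge0 (a0 s) (convol_ge0 t ge_ge0 (Z_ge0 s))).
Qed.

Let shift_volterra t : (0 < t)%R -> (y (t + tau)%R)%:E +
  l%:E * \int[mu]_(r in `]0%R, t[) (g (t - r) * y (r + tau))%:E +
  l%:E * past t = 1.
Proof.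
move=> t0; have tt0 : (0 < t + tau)%R by rewrite addr_gt0.
have mgy (D : set R) : measurable D -> D `<=` (`]0%R, (t + tau)%R[ : set R) ->
    measurable_fun D (fun s => (g (t + tau - s) * y s)%:E).
  move=> mD DI; apply/measurable_EFinP; apply: measurable_funM.
    exact: measurable_rs_kernel_reflect.
  by apply: measurable_funS (measurable_sc Hy (T := (t + tau)%R)).
have := sc_volterraE gamma_gt0 alpha01 l_gt0 Hy tt0.
have tle : (tau <= t + tau)%R by rewrite lerDr ltW.
rewrite (@itv_bndbnd_setU _ _ _ (BLeft tau)) ?bnd_simp//.
have s1 : (`]0%R, tau[ : set R) `<=` `]0%R, (t + tau)%R[.
  by apply: subset_itvl; rewrite bnd_simp.
have s2 : (`[tau, (t + tau)%R[ : set R) `<=` `]0%R, (t + tau)%R[.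
  by apply: subset_itvr; rewrite bnd_simp.
have g0 s : (0 < s)%R -> 0 <= (g (t + tau - s) * y s)%:E.
  by move=> s0; apply: (sc_int_ge0 gamma_gt0 alpha01 l_gt0 Hy); exact: ltW.
rewrite ge0_integral_setU//=; last 3 first.
- by apply: mgy; [exact: measurableU|rewrite subUset].
- move=> s /= [|] /[!in_itv]/= /andP[s0 _]; apply: g0 => //.
  exact: lt_le_trans s0.
- apply/disj_setPRL => x /=; rewrite !in_itv/= => /andP[cx _].
  by apply/negP; rewrite negb_and -[X in _ || X]leNgt cx orbT.
rewrite -/(past t); move=> eqv.
have -> : \int[mu]_(r in `]0%R, t[) (g (t - r) * y (r + tau))%:E =
    \int[mu]_(x in `[tau, (t + tau)%R[) (g (t + tau - x) * y x)%:E.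
  rewrite -integral_itv_obnd_cbnd; last first.
    apply: mgy => //; apply: subset_trans s2; exact: subset_itv_oo_co.
  rewrite [RHS]integral_mkcond -(integral_shift tau); last 2 first.
  - apply/(measurable_restrictT _ _).1 => //; apply: mgy => //.
    apply: subset_trans s2; exact: subset_itv_oo_co.
  - move=> x; rewrite patchE; case: ifPn => //; rewrite inE/= in_itv/= => /andP[taux _].
    by apply: g0; exact: lt_trans taux.
  rewrite integral_mkcond; apply: eq_integral => x _.
  rewrite !patchE !mem_setE !in_itv/= ltrD2r -[X in (X < x + _)%R]add0r ltrD2r.
  by case: ifPn => // _; rewrite opprD addrACA subrr addr0.
move: eqv; move: (past t) (\int[mu]_(x in _) _) => p q pq.
have pq0 : p + q \is a fin_num by rewrite pq.
move: pq; have /andP[] : (p \is a fin_num) && (q \is a fin_num) by rewrite -fin_numD.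
move=> /fineK <- /fineK <-; rewrite -EFinD => -[h].
rewrite -!EFinM -!EFinD; congr EFin; rewrite -addrA -mulrDr (addrC (fine q)) h.
by rewrite mulrCA mulfV ?lt0r_neq0// mulr1 addrC subrK.
Qed.

Let W_le1 t : (0 < t)%R -> W t <= 1.
Proof.
move=> t0; rewrite -(W_volterra t0) -addeA leeDl// adde_ge0// mule_ge0//.
  exact: convol_ge0.
apply: integral_ge0 => s; rewrite /= in_itv/= => /andP[s0 _].
by apply: (sc_int_ge0 gamma_gt0 alpha01 l_gt0 Hy); exact: ltW.
Qed.

Let W_fin t : (0 < t)%R -> W t \is a fin_num.
Proof. by move=> t0; rewrite ge0_fin_numE// (le_lt_trans (W_le1 t0))// ltry. Qed.

Let W_causal t : (t <= 0)%R -> W t = 0.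
Proof.
move=> t0; rewrite /W /ye (causal_le0 _ t0) mule0 add0e integral0_eq ?mule0// => s _.
by rewrite /Z convol_le0 ?mule0// => x; exact: causal_le0.
Qed.

(** The past up to time [tau] acts on the future through [ye tau] and the states
    [Z s tau] only, and the dependence is linear; each exponential splits as
    e^(- s (t + tau)) = e^(- s t) e^(- s tau). Hence both sides solve the same
    Volterra equation in [t], whose right-hand side is 1 minus [l] times the
    memory of ]0, tau[, and uniqueness applies. *)
Lemma sc_semigroup t : (0 < t)%R -> (y (t + tau)%R)%:E = W t.
Proof.
move=> t0; rewrite -(fineK (W_fin t0)); congr EFin; apply/esym.
have tT : (0 < t < t + 1)%R by rewrite t0 ltrDl ltr01.
move: (tT); apply: (@volterra_unique _ _ _ gamma_gt0 alpha01 l (t + 1)%R 1%R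
  (fine \o W) (fun r => y (r + tau)%R)) => //.
- apply: measurable_funTS; apply: measurableT_comp => //; exact: mW.
- apply: open_continuous_measurable_fun; first exact: interval_open.
  move=> r; rewrite inE/= in_itv/= => /andP[r0 _].
  apply: (@continuous_comp _ _ _ (fun r => r + tau)%R y).
    by apply: cvgD; [exact: cvg_id|exact: cvg_cst].
  by apply: (sc_continuous_at Hy); rewrite addr_gt0.
- move=> r /andP[r0 _] /=; rewrite ger0_norm ?fine_ge0//.
  by rewrite -lee_fin fineK; [exact: W_le1|exact: W_fin].
- move=> r /andP[r0 _] /=; have rt0 : (0 <= r + tau)%R by rewrite ltW// addr_gt0.
  rewrite ger0_norm; first exact: (sc_le1 gamma_gt0 alpha01 l_gt0 Hy).
  exact/ltW/y_gt0.
- move=> r /andP[r0 _].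
  have h1 := W_volterra r0; have h2 := shift_volterra r0.
  rewrite /Rintegral /=.
  have -> : \int[mu]_(s in `]0%R, r[) (g (r - s) * fine (W s))%:E = convol ge W r.
    rewrite convol_itv; [|by move=> x; exact: causal_le0|exact: W_causal].
    apply: eq_integral => s; rewrite inE/= in_itv/= => /andP[s0 sr].
    by rewrite EFinM (fineK (W_fin s0)) /ge causalE// subr_gt0.
  have aux (u c p : \bar R) : u \is a fin_num -> 0 <= c -> 0 <= p ->
      u + l%:E * c + l%:E * p = 1 -> (fine u + l * fine c + l * fine p = 1)%R.
    case: u => // u _; case: c => [c _| _|//]; case: p => [p _|_|//] /=.
    - by rewrite -!EFinM -!EFinD => -[].
    - by rewrite gt0_muley ?lte_fin// addey.
    - by rewrite gt0_muley ?lte_fin// addey// addye// -EFinM.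
    - by rewrite gt0_muley ?lte_fin// addey.
  have p0 : 0 <= past r.
    apply: integral_ge0 => s; rewrite /= in_itv/= => /andP[s0 _].
    by apply: (sc_int_ge0 gamma_gt0 alpha01 l_gt0 Hy); exact: ltW.
  have c10 : 0 <= convol ge W r by exact: convol_ge0.
  have c20 : 0 <= \int[mu]_(s in `]0%R, r[) (g (r - s) * y (s + tau))%:E.
    apply: integral_ge0 => s; rewrite /= in_itv/= => /andP[s0 _].
    rewrite lee_fin mulr_ge0 ?rs_kernel_ge0// ltW//.
    by apply: y_gt0; rewrite ltW// addr_gt0.
  have e1 := aux _ _ _ (W_fin r0) c10 p0 h1.
  have e2 := aux (y (r + tau)%R)%:E _ _ isT c20 p0 h2.
  apply: (@addIr _ (l * fine (past r))%R); rewrite e1; exact: esym.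
Qed.

End FixedShift.

(** By the semigroup identity y (a + b) is the inner product of the states at
    times [a] and [b], for a positive weight; midpoint convexity is the
    inequality of arithmetic and geometric means for it. *)
Lemma sc_midpoint (a b : R) : (0 < a)%R -> (0 < b)%R ->
  (2 * y (a + b) <= y (a + a) + y (b + b))%R.
Proof.
move=> a0 b0.
pose f u v s := dm s * s%:E * Z s u * Z s v.
have f0 u v s : 0 <= f u v s by rewrite /f mule_ge0// mule_ge0.
have mf u v : measurable_fun [set: R] (f u v).
  by apply: emeasurable_funM => //; exact: emeasurable_funM.
have E u v : (0 < u)%R -> (0 < v)%R ->
    \int[mu]_s f u v s = ((y (v + u) - y u * y v) / l)%:E.
  move=> u0 v0; have := sc_semigroup u0 v0; rewrite /ye !causalE// -/(f u v).
  have : 0 <= \int[mu]_s f u v s by apply: integral_ge0 => s _; exact: f0.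
  rewrite /f; case: (\int[mu]_s _) => [r _|_|//].
    rewrite -!EFinM -EFinD => -[->]; congr EFin; field; exact: lt0r_neq0.
  by rewrite gt0_muley ?lte_fin// addey// -EFinM.
have real (x1 x2 x3 : \bar R) (c1 c2 c3 : R) : x1 = c1%:E -> x2 = c2%:E ->
    x3 = c3%:E -> x1 + x1 <= x2 + x3 -> (c1 + c1 <= c2 + c3)%R.
  by move=> -> -> ->; rewrite -!EFinD lee_fin.
have := real _ _ _ _ _ _ (E b a b0 a0) (E a a a0 a0) (E b b b0 b0).
have le : \int[mu]_s f b a s + \int[mu]_s f b a s <=
    \int[mu]_s f a a s + \int[mu]_s f b b s.
  apply: (ge0_le_integralD (mf b a) (mf a a) (mf b b) (f0 b a) (f0 a a) (f0 b b)).
  move=> s; have [s0|s0] := ltP 0%R s; last first.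
    have dm0 : dm s = 0 by exact: causal_le0.
    have fs u v : f u v s = 0 by rewrite /f dm0 mul0e mul0e mul0e.
    by rewrite !fs.
  have wfin : dm s * s%:E \is a fin_num.
    by have -> : dm s = (gamma * omega_density alpha s)%R%:E by exact: causalE.
  exact: (weighted_am_gm (dms_ge0 s) wfin (Z_fin s0 a0) (Z_fin s0 b0)).
move=> /(_ le); rewrite -!mulrDl ler_pM2r ?invr_gt0//.
by have := sqr_ge0 (y a - y b)%R; rewrite (mulrC (y b)) => h1 h2; nra.
Qed.

End SemigroupIdentity.

(** * Decay and regularity of the scalar solution *)

Lemma derive1_quotient (R : realType) (f : R -> R) (t : R) : derivable f t 1 ->
  h^-1 * (f (h + t) - f t) @[h --> 0^'] --> derive1 f t.
Proof.
move=> /cvg_ex[/= z cz].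
have E : (fun h : R => h^-1 *: (f (h *: (1 : R) + t) - f t)) =
    (fun h => h^-1 * (f (h + t) - f t)).
  by apply/funext => h; rewrite /GRing.scale/= mulr1.
rewrite E in cz; suff -> : derive1 f t = z by [].
by rewrite /derive1; exact: cvg_lim.
Qed.

Section ScalarRegularity.
Variable R : realType.
Local Notation mu := (@lebesgue_measure R).
Variables (gamma alpha : R).
Hypothesis gamma_gt0 : 0 < gamma.
Hypothesis alpha01 : 0 < alpha < 1.
Local Notation g := (rs_kernel gamma alpha).
Variables (l : R) (y : R -> R).
Hypothesis l_gt0 : 0 < l.
Hypothesis Hy : scalar_cauchy gamma alpha l y.

Let y_gt0 := sc_gt0 gamma_gt0 alpha01 l_gt0 Hy.
Let y_le1 := sc_le1 gamma_gt0 alpha01 l_gt0 Hy.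
Let midpoint := sc_midpoint gamma_gt0 alpha01 l_gt0 Hy.

(** A midpoint convex function that increases once grows without bound along a
    geometric progression, whereas [y] stays below 1. *)
Lemma sc_nincr (s t : R) : 0 <= s -> s <= t -> y t <= y s.
Proof.
rewrite le_eqVlt => /predU1P[<- t0|s0].
  by rewrite (sc_initial Hy); exact: y_le1.
rewrite le_eqVlt => /predU1P[->//|st]; rewrite leNgt; apply/negP => yst.
pose d := y t - y s; have d0 : 0 < d by rewrite subr_gt0.
have grow n : 2 ^+ n * d <= y (s + 2 ^+ n * (t - s)) - y s.
  elim: n => [|n IH]; first by rewrite !expr0 !mul1r [s + _]addrC subrK.
  have h0 : 0 < s + 2 ^+ n.+1 * (t - s).
    by rewrite addr_gt0// mulr_gt0 ?exprn_gt0// subr_gt0.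
  have := midpoint (divr_gt0 s0 (ltr0n _ 2)) (divr_gt0 h0 (ltr0n _ 2)).
  rewrite -!splitr (_ : s / 2 + _ = s + 2 ^+ n * (t - s)); last first.
    by rewrite exprS; field.
  by rewrite exprS -mulrA; lra.
have [n hn] : exists n, 1 < 2 ^+ n * d.
  exists (Num.truncn d^-1).+1; rewrite -ltr_pdivrMr// mul1r.
  apply: (lt_le_trans (truncnS_gt _)); rewrite -natrX ler_nat.
  by rewrite ltnW// ltn_expl.
have := le_trans (ltW hn) (grow n); have := lt_le_trans hn (grow n).
have h0 : 0 <= s + 2 ^+ n * (t - s).
  by rewrite addr_ge0 ?ltW// mulr_gt0 ?exprn_gt0// subr_gt0.
have := y_le1 h0; have := y_gt0 (ltW s0); lra.
Qed.

(** Both [y] and the kernel are nonincreasing, so the integral in the Volterra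
    equation at time [t] is at least g t * y t * t. *)
Lemma sc_kernel_bound (t : R) : 0 < t -> l * y t * g t * t <= 1.
Proof.
move=> t0.
have : ((g t * y t * t)%:E <= ((1 - y t) / l)%:E)%E.
  rewrite -(sc_volterraE gamma_gt0 alpha01 l_gt0 Hy t0).
  apply: (@le_trans _ _ (\int[mu]_(s in `]0%R, t[) (g t * y t)%:E)%E).
    by rewrite integral_cst//= lebesgue_measure_itv/= lte_fin t0 -EFinB subr0 EFinM.
  apply: ge0_le_integral => //=.
  - by move=> s _; rewrite lee_fin mulr_ge0 ?rs_kernel_ge0// ltW// y_gt0// ltW.
  - apply/measurable_EFinP; apply: measurable_funM; last exact: (measurable_sc Hy).
    exact: measurable_rs_kernel_reflect.
  - move=> s; rewrite in_itv/= => /andP[s0 st]; rewrite lee_fin.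
    apply: ler_pM; rewrite ?rs_kernel_ge0//; first by rewrite ltW// y_gt0// ltW.
      by apply: rs_kernel_nincr; rewrite ?subr_gt0// gerBl ltW.
    by apply: sc_nincr; rewrite ltW.
rewrite lee_fin ler_pdivlMr// => h; have := y_gt0 (ltW t0) => yt0.
by rewrite (_ : l * _ * _ * _ = g t * y t * t * l); [lra|ring].
Qed.

Lemma sc_le_inv (t : R) : 0 < t -> l * y t <= t^-1.
Proof.
move=> t0; rewrite -[leRHS]mul1r ler_pdivlMr//.
apply: le_trans (sc_kernel_bound t0); rewrite ler_pM2r//.
rewrite ler_peMr ?rs_kernel_ge1// mulr_ge0//; first exact: ltW.
by rewrite ltW// y_gt0// ltW.
Qed.

Lemma sc_le_powR (t : R) : 0 < t ->
  l * y t <= Gamma (1 - alpha) / gamma * t `^ (alpha - 1).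
Proof.
move=> t0; have a01 : 0 < 1 - alpha < 1.
  by case/andP: alpha01 => a0 a1; rewrite subr_gt0 a1 ltrBlDr ltrDl.
have G0 := Gamma_gt0 a01; have p0 : 0 < t `^ (1 - alpha) by rewrite powR_gt0.
have -> : t `^ (alpha - 1) = (t `^ (1 - alpha))^-1 by rewrite -powRN opprB.
rewrite ler_pdivlMr// ler_pdivlMr//.
have := sc_kernel_bound t0 => h.
have ly0 : 0 <= l * y t by rewrite mulr_ge0 ?ltW// y_gt0// ltW.
have : l * y t * (gamma * omega (1 - alpha) t) * t <= 1.
  apply: le_trans h; rewrite ler_pM2r// ler_wpM2l//.
  by rewrite /rs_kernel lerDr.
rewrite /omega addrAC subrr add0r => {}h.
have : (l * y t * (gamma * (t `^ (- alpha) / Gamma (1 - alpha))) * t) *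
    Gamma (1 - alpha) <= 1 * Gamma (1 - alpha) by rewrite ler_pM2r.
rewrite mul1r; apply: le_trans; rewrite le_eqVlt; apply/orP; left; apply/eqP.
have -> : t `^ (1 - alpha) = t * t `^ (- alpha).
  by rewrite powRD ?powRr1 ?ltW// (gt_eqF t0) implybT.
by field; exact: lt0r_neq0.
Qed.

(** By midpoint convexity an increment over a step h does not decrease when it is
    translated by h; n + 1 translations by h = (t - s) / (n + 1) lead from [s] to
    [t]. *)
Lemma sc_derive_nondecreasing (s t : R) : 0 < s -> s < t ->
  derive1 y s <= derive1 y t.
Proof.
move=> s0 st; pose h n : R := (t - s) / n.+1%:R.
have h_gt0 n : 0 < h n by rewrite divr_gt0// subr_gt0.
have ch : h n @[n --> \oo] --> (0 : R).
  rewrite -(mulr0 (t - s)); apply: cvgM; first exact: cvg_cst.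
  exact: cvg_harmonic.
have quot (r : R) : 0 < r ->
    (h n)^-1 * (y (h n + r) - y r) @[n --> \oo] --> derive1 y r.
  move=> r0; have /cvgr_dnbhsP := derive1_quotient (sc_derivable Hy r0).
  by apply; split => // n; rewrite gt_eqF.
have step n r : 0 < r -> y (h n + r) - y r <= y (h n + (h n + r)) - y (h n + r).
  move=> r0; have r20 : 0 < r / 2 by rewrite divr_gt0.
  have q0 : 0 < (h n + (h n + r)) / 2 by rewrite divr_gt0// !addr_gt0.
  have := midpoint r20 q0; rewrite -!splitr (_ : r / 2 + _ = h n + r); last by field.
  lra.
have chain n m : y (h n + s) - y s <= y (h n + (m%:R * h n + s)) - y (m%:R * h n + s).
  elim: m => [|m IH]; first by rewrite mul0r add0r.
  apply: (le_trans IH); rewrite -natr1 mulrDl mul1r (addrC (m%:R * h n) (h n)) -addrA.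
  by apply: step; rewrite ltr_wpDl// mulr_ge0// ltW.
rewrite -(cvg_lim _ (quot s s0))// -(cvg_lim _ (quot t (lt_trans s0 st)))//.
apply: ler_lim; first by apply/cvg_ex; eexists; exact: quot.
  by apply/cvg_ex; eexists; apply: quot; exact: lt_trans st.
apply: nearW => n; rewrite ler_pM2l ?invr_gt0//.
have := chain n n.+1; rewrite /h mulrCA mulfV// mulr1 subrK; exact.
Qed.

Lemma sc_MVT (s t : R) : 0 < s -> s < t ->
  exists2 c, s < c < t & y t - y s = derive1 y c * (t - s).
Proof.
move=> s0 st; have [x xst|x|c] := @MVT _ y (derive1 y) s t st.
- move: xst; rewrite in_itv/= => /andP[sx _]; rewrite derive1E.
  by apply/derivableP; apply: (sc_derivable Hy); exact: lt_trans sx.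
- apply: continuous_in_subspaceT => {}x; rewrite inE/= in_itv/= => /andP[sx _].
  by apply: (sc_continuous_at Hy); exact: lt_le_trans sx.
- by rewrite in_itv/= => cst; exists c.
Qed.

Lemma sc_derive_le0 (t : R) : 0 < t -> derive1 y t <= 0.
Proof.
move=> t0; have t1 : t < t + 1 by rewrite ltrDl.
have [c /andP[tc ct] h] := sc_MVT t0 t1.
apply: (le_trans (sc_derive_nondecreasing t0 tc)).
have := sc_nincr (ltW t0) (ltW t1); rewrite -subr_le0 h addrAC subrr add0r mulr1//.
Qed.

(** As [y] takes its values in [0, 1], its slope over ]t / 2, t[ is at least
    - 2 / t, and the derivative only increases afterwards. *)
Lemma sc_derive_ge (t : R) : 0 < t -> - (2 / t) <= derive1 y t.
Proof.
move=> t0; have t2 : t / 2 < t by rewrite ltr_pdivrMr// ltr_pMr// ltr1n.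
have t20 : 0 < t / 2 by rewrite divr_gt0.
have [c /andP[tc ct] h] := sc_MVT t20 t2.
apply: le_trans (sc_derive_nondecreasing (lt_trans t20 tc) ct).
have hh : t - t / 2 = t / 2 by rewrite {1}(splitr t) addrK.
rewrite hh in h; rewrite -(ler_pM2r t20) -h mulNr.
rewrite (_ : 2 / t * (t / 2) = 1); last by field; exact: lt0r_neq0.
have := y_gt0 (ltW t0); have := y_le1 (ltW t20); lra.
Qed.

Lemma sc_derive_norm (t : R) : 0 < t -> `|derive1 y t| <= 2 / t.
Proof.
move=> t0; rewrite ler_norml sc_derive_ge//=.
by rewrite (le_trans (sc_derive_le0 t0))// divr_ge0// ltW.
Qed.

(** A monotone derivative cannot jump: by the mean value theorem the difference
    quotients on either side of [t] are values of the derivative near [t]. *)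
Lemma sc_derive_continuous (t : R) : 0 < t -> {for t, continuous (derive1 y)}.
Proof.
move=> t0; apply/cvgrPdist_le => /= e e0.
have /cvgrPdist_lt/(_ _ e0) := derive1_quotient (sc_derivable Hy t0).
rewrite /dnbhs near_withinE => -[/= d d0 hd].
pose k := Num.min d t / 2.
have k0 : 0 < k by rewrite divr_gt0// lt_min d0.
have kd : k < d.
  by rewrite ltr_pdivrMr// (@le_lt_trans _ _ d)// ?ge_min ?lexx// ltr_pMr// ltr1n.
have kt : k < t.
  by rewrite ltr_pdivrMr// (@le_lt_trans _ _ t)// ?ge_min ?lexx ?orbT// ltr_pMr// ltr1n.
have tk0 : 0 < t - k by rewrite subr_gt0.
have [c1 /andP[tc1 ct1] h1] := sc_MVT tk0 (ltac:(by rewrite ltrBlDr ltrDl) : t - k < t).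
have [c2 /andP[tc2 ct2] h2] := sc_MVT t0 (ltac:(by rewrite ltrDl) : t < t + k).
have d1 : `|derive1 y t - derive1 y c1| < e.
  have := hd (- k); rewrite /= sub0r opprK gtr0_norm// oppr_eq0 gt_eqF// => /(_ kd isT).
  rewrite (_ : - k + t = t - k); last by rewrite addrC.
  have -> : y (t - k) - y t = - (y t - y (t - k)) by rewrite opprB.
  rewrite h1 opprB addrCA subrr addr0 (_ : (- k)^-1 * _ = derive1 y c1)//.
  by field; exact: lt0r_neq0.
have d2 : `|derive1 y t - derive1 y c2| < e.
  have := hd k; rewrite /= sub0r normrN gtr0_norm// gt_eqF// => /(_ kd isT).
  rewrite (addrC k).
  rewrite h2 addrAC subrr add0r (_ : k^-1 * _ = derive1 y c2)//.
  by field; exact: lt0r_neq0.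
near=> s.
have s1 : c1 < s by near: s; exact: lt_nbhsr.
have s2 : s < c2 by near: s; exact: lt_nbhsl.
have c10 : 0 < c1 by exact: lt_trans tc1.
have m1 := sc_derive_nondecreasing c10 s1.
have m2 := sc_derive_nondecreasing (lt_trans c10 s1) s2.
move: d1 d2; rewrite !ltr_distlC => /andP[a1 a2] /andP[b1 b2].
by rewrite ler_distlC; apply/andP; split; lra.
Unshelve. all: by end_near. Qed.

Lemma sc_frac_primitiveE (t : R) : 0 < t ->
  y t + l * (\int[mu]_(s in `]0%R, t[) y s + gamma * scalar_frac_primitive alpha y t) = 1.
Proof.
move=> t0; have [_ <-] := sc_volterra gamma_gt0 alpha01 Hy t0.
have bd s : 0 < s < t -> `|y s| <= 1.
  by move=> /andP[/ltW s0 _]; rewrite ger0_norm ?y_le1// ltW// y_gt0.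
by have [_ ->] := rs_kernel_convE gamma_gt0 alpha01 t0 (measurable_sc Hy (T := t)) bd.
Qed.

Lemma sc_frac_primitive_bound (t : R) : 0 < t ->
  0 <= l * scalar_frac_primitive alpha y t <= gamma^-1.
Proof.
move=> t0; have h := sc_frac_primitiveE t0.
have i1 : 0 <= \int[mu]_(s in `]0%R, t[) y s.
  apply: Rintegral_ge0 => s; rewrite /= in_itv/= => /andP[/ltW s0 _].
  by rewrite ltW// y_gt0.
have i2 : 0 <= scalar_frac_primitive alpha y t.
  apply: Rintegral_ge0 => s; rewrite /= in_itv/= => /andP[/ltW s0 _].
  by rewrite mulr_ge0 ?omega_ge0// ltW// y_gt0.
have ls0 : 0 <= l * scalar_frac_primitive alpha y t.
  by apply: mulr_ge0 => //; exact: ltW.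
rewrite ls0/= -[leRHS]mul1r ler_pdivlMr//.
have := y_gt0 (ltW t0); have := mulr_ge0 (ltW l_gt0) i1.
clear i1 i2 ls0; move: h; move: (Rintegral _ _ _) (scalar_frac_primitive _ _ _) (y t) => a b c; nra.
Qed.

Lemma sc_frac_deriveE (t : R) : 0 < t ->
  l * derive1 (scalar_frac_primitive alpha y) t = - ((derive1 y t + l * y t) / gamma).
Proof.
move=> t0; have := sc_equation Hy t0; set D := derive1 _ _; set D' := derive1 _ t.
move=> h; apply: (@mulIf _ gamma); first exact: lt0r_neq0.
rewrite mulNr mulfVK ?lt0r_neq0//; move: h; rewrite mulrDr; lra.
Qed.

Lemma sc_frac_derive_norm (t : R) : 0 < t ->
  `|l * derive1 (scalar_frac_primitive alpha y) t| <= 3 / (gamma * t).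
Proof.
move=> t0; rewrite sc_frac_deriveE// normrN normrM (gtr0_norm (_ : 0 < gamma^-1)) ?invr_gt0//.
rewrite invfM mulrA mulrAC ler_pM2r ?invr_gt0//.
apply: (le_trans (ler_normD _ _)); rewrite (ger0_norm (_ : 0 <= l * y t)); last first.
  by rewrite mulr_ge0 ?ltW// y_gt0// ltW.
have := sc_derive_norm t0; have := sc_le_inv t0; lra.
Qed.

Lemma sc_frac_derive_continuous (t : R) : 0 < t ->
  {for t, continuous (fun s => l * derive1 (scalar_frac_primitive alpha y) s)}.
Proof.
move=> t0.
have c : {for t, continuous (fun s => - ((derive1 y s + l * y s) / gamma))}.
  apply: continuousN; apply: continuousM; last exact: cvg_cst.
  apply: continuousD; first exact: sc_derive_continuous.
  by apply: continuousM; [exact: cvg_cst|exact: (sc_continuous_at Hy)].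
have : (fun s => l * derive1 (scalar_frac_primitive alpha y) s) @ t -->
    - ((derive1 y t + l * y t) / gamma).
  apply: cvg_trans c; apply: near_eq_cvg; near=> s; apply/esym/sc_frac_deriveE.
  by near: s; exact: lt_nbhsr.
by rewrite -(sc_frac_deriveE t0).
Unshelve. all: by end_near. Qed.

End ScalarRegularity.

(** * Uniqueness for the scalar problem on a bounded interval *)

Section ScalarUniqueness.
Variables (R : realType) (gamma alpha : R).
Hypotheses (gamma_gt0 : 0 < gamma) (alpha01 : 0 < alpha < 1).
Local Notation mu := (@lebesgue_measure R).

(** A solution on a bounded interval only is already determined by its initial
    value, because the Volterra equation never looks beyond the current time. *)
Lemma sc_unique (l T : R) (y u : R -> R) : 0 < l -> scalar_cauchy gamma alpha l y ->
  0 < T -> {within `[0, T], continuous u} ->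
  (forall t : R, 0 < t < T -> derivable u t 1) ->
  (forall t : R, 0 < t < T -> derivable (scalar_frac_primitive alpha u) t 1) ->
  (forall t : R, 0 < t < T ->
    derive1 u t + l * (u t + gamma * derive1 (scalar_frac_primitive alpha u) t) = 0) ->
  forall t : R, 0 <= t <= T -> u t = u 0 * y t.
Proof.
move=> l0 Hy T0 uc ud ufd ue.
have [M uM] := continuous_itv_bounded uc.
have mitv : measurable (`]0, T[ : set R) by exact: measurable_itv.
have uc0 : {within `]0, T[, continuous u}.
  by apply: continuous_subspaceW uc; exact: subset_itv_oo_cc.
have mu_ : measurable_fun `]0, T[ u.
  by apply: subspace_continuous_measurable_fun => //.
have my := @measurable_sc _ _ _ _ _ Hy T.
have mcy : measurable_fun `]0, T[ (fun t => u 0 * y t).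
  by apply: measurable_funM => //; exact: measurable_cst.
have E (t : R) : 0 < t < T -> u t = u 0 * y t.
  apply: (@volterra_unique _ _ _ gamma_gt0 alpha01 l T M u (fun t => u 0 * y t) mu_ mcy).
  - by move=> s /andP[s0 sT]; apply: uM; rewrite !ltW.
  - move=> s /andP[s0 sT]; rewrite normrM.
    have y0 := sc_gt0 gamma_gt0 alpha01 l0 Hy (ltW s0).
    rewrite (ger0_norm (ltW y0)) -[leRHS]mulr1 ler_pM ?normr_ge0 ?(ltW y0)//.
      by apply: uM; rewrite lexx ltW.
    by rewrite (sc_le1 gamma_gt0 alpha01 l0 Hy)// ltW.
  - move=> s /andP[s0 sT].
    have s0T : 0 < s < T by rewrite s0.
    have [_ ->] := volterra_of_cauchy gamma_gt0 alpha01 T0 uc ud ufd ue s0T.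
    have [iy hy] := sc_volterra gamma_gt0 alpha01 Hy s0.
    have -> : \int[mu]_(s0 in `]0, s[) (rs_kernel gamma alpha (s - s0) * (u 0 * y s0)) =
        u 0 * \int[mu]_(s0 in `]0, s[) (rs_kernel gamma alpha (s - s0) * y s0).
      rewrite -RintegralZl//.
      by apply: eq_Rintegral => x _; rewrite mulrCA.
    by rewrite mulrCA -mulrDr hy mulr1.
move=> t /andP[]; rewrite le_eqVlt => /predU1P[<- _|t0].
  by rewrite (sc_initial Hy) mulr1.
rewrite le_eqVlt => /predU1P[tT|tT]; last by apply: E; rewrite t0.
rewrite {t t0}tT.
have [_ _ uT] := (continuous_within_itvP u T0).1 uc.
have yT : y x @[x --> T^'-] --> y T.
  by have h : y x @[x --> T] --> y T := sc_continuous_at Hy T0; exact: cvg_at_left_filter h.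
have cyT : u 0 * y x @[x --> T^'-] --> u 0 * y T by apply: cvgM => //; exact: cvg_cst.
apply/esym; apply: (cvg_unique _ cyT _) => //.
apply: cvg_trans uT; apply: near_eq_cvg; near=> x.
apply: E; apply/andP; split; near: x; [exact: nbhs_left_gt|exact: nbhs_left_lt].
Unshelve. all: by end_near. Qed.

End ScalarUniqueness.

(** * Integrability of the product of two singular kernels *)

Section BetaKernel.
Variables (R : realType) (alpha : R).
Hypothesis alpha01 : 0 < alpha < 1.
Local Notation mu := (@lebesgue_measure R).

(** Up to a constant factor, s^(alpha - 1) is the memory kernel of order
    1 - alpha, reflected in ]0, t[. *)
Lemma integrable_powR (t : R) : 0 < t ->
  mu.-integrable `]0, t[ (EFin \o (fun s => s `^ (alpha - 1))).
Proof.
move=> t0; have /andP[a0 a1] := alpha01.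
have a01 : 0 < 1 - alpha < 1 by rewrite subr_gt0 a1/= ltrBlDr ltrDl.
have mo : measurable_fun [set: R] (EFin \o omega (1 - (1 - alpha))).
  by apply/measurable_EFinP; exact: measurable_omega.
have o0 (s : R) : (0 <= (omega (1 - (1 - alpha)) s)%:E)%E.
  by rewrite lee_fin (omega_ge0 a01).
have i1 : mu.-integrable `]0, t[ (EFin \o omega (1 - (1 - alpha))).
  apply/integrableP; split; first exact: measurable_funTS.
  under eq_integral => s _ do rewrite /= ger0_norm ?(omega_ge0 a01)//.
  rewrite -(integral_reflect_itv t mo o0).
  have /integrableP[_] := @integrable_omega_conv R 1 (1 - alpha) ltr01 a01 (fun=> 1) t 1 t0
    (measurable_cst _) (fun s _ => eq_ind_r (fun x => x <= 1) (lexx 1) (normr1 R)).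
  apply: le_lt_trans; rewrite le_eqVlt; apply/orP; left; apply/eqP.
  by apply: eq_integral => s _; rewrite /= mulr1 ger0_norm ?(omega_ge0 a01).
have mitv : measurable (`]0, t[ : set (measurableTypeR R)) by exact: measurable_itv.
have := integrableZl mitv (Gamma alpha) i1.
apply: eq_integrable => // s _; rewrite /= -EFinM subKr /omega mulrC divfK//.
by rewrite gt_eqF// Gamma_gt0.
Qed.

(** The product of the two kernels is singular at both ends of the interval, and
    at each end only one of the factors is unbounded. *)
Lemma integrable_omega_powR (t : R) : 0 < t ->
  mu.-integrable `]0, t[ (EFin \o (fun s => omega (1 - alpha) (t - s) * s `^ (alpha - 1))).
Proof.
move=> t0; have /andP[a0 a1] := alpha01.
have t20 : 0 < t / 2 by rewrite divr_gt0.
have mitv : measurable (`]0, t[ : set (measurableTypeR R)) by exact: measurable_itv.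
have i1 := integrableZl mitv (omega (1 - alpha) (t / 2)) (integrable_powR t0).
have i2 : mu.-integrable `]0, t[ (EFin \o (fun s => omega (1 - alpha) (t - s) * 1)).
  apply: (@integrable_omega_conv R 1 alpha ltr01 alpha01 (fun=> 1) t 1) => //.
  by move=> s _; rewrite normr1.
have i3 := integrableZl mitv ((t / 2) `^ (alpha - 1)) i2.
apply: (le_integrable mitv _ _ (integrableD mitv i1 i3)).
  apply/measurable_EFinP; apply: measurable_funM; last first.
    by apply: measurable_funTS; exact: measurable_powR.
  apply: measurable_funTS; apply: measurableT_comp; first exact: measurable_omega.
  exact: measurable_funB.
move=> s; rewrite /= in_itv/= => /andP[s0 st].
have o1 := omega_ge0 alpha01 (t - s); have o2 := omega_ge0 alpha01 (t / 2).
have p1 := powR_ge0 s (alpha - 1); have p2 := powR_ge0 (t / 2) (alpha - 1).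
have q1 := mulr_ge0 o2 p1; have q2 := mulr_ge0 p2 o1.
rewrite mulr1 lee_fin (ger0_norm (mulr_ge0 o1 p1)) (ger0_norm (addr_ge0 q1 q2)).
have [s2|s2] := leP s (t / 2).
  apply: (@le_trans _ _ (omega (1 - alpha) (t / 2) * s `^ (alpha - 1))).
    by apply: ler_wpM2r => //; apply: (omega_nincr alpha01) => //; lra.
  by rewrite lerDl.
apply: (@le_trans _ _ ((t / 2) `^ (alpha - 1) * omega (1 - alpha) (t - s))).
  by rewrite mulrC; apply: ler_wpM2r => //; apply: powR_nincr => //; [lra|exact: ltW].
by rewrite lerDr.
Qed.

End BetaKernel.

(** * Difference quotients and integrals of real functions *)

Section RealQuotients.
Variable R : realType.

Lemma dnbhs_shift (V : topologicalType) (f : R -> V) (t : R) (l : V) :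
  f s @[s --> t^'] --> l <-> f (h + t) @[h --> 0^'] --> l.
Proof.
have E (P : set R) : (\forall s \near t^', P s) <-> (\forall h \near 0^', P (h + t)).
  have S := near_shift 0 t (fun s : R => s != t -> P s).
  split=> [Pt|P0].
    have : \forall s \near t, s != t -> P s by exact: Pt.
    rewrite S; apply: filterS => h /= hP h0; have := hP; rewrite subr0; apply.
    by rewrite -[X in _ != X]add0r (inj_eq (addIr t)).
  suff : \forall s \near t, s != t -> P s by [].
  have {P0} : \forall h \near (0 : R), h != 0 -> P (h + t) by exact: P0.
  rewrite S; apply: filterS => h /= hP; rewrite subr0 => h0; apply: hP.
  by move: h0; rewrite -[X in _ != X]add0r (inj_eq (addIr t)).
by split=> fl A lA; have := fl _ lA; move: (E (f @^-1` A)) => [E1 E2]; [exact: E1|exact: E2].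
Qed.

Lemma cvg_quotient (f : R -> R) (t : R) : derivable f t 1 ->
  (s - t)^-1 * (f s - f t) @[s --> t^'] --> derive1 f t.
Proof.
move=> /derive1_quotient h; apply/dnbhs_shift; apply: cvg_trans h.
by apply: near_eq_cvg; apply: nearW => h /=; rewrite addrK.
Qed.

Lemma derivable_of_quotient (f : R -> R) (t l : R) :
  (s - t)^-1 * (f s - f t) @[s --> t^'] --> l -> derivable f t 1 /\ derive1 f t = l.
Proof.
move=> /dnbhs_shift h.
have E : h^-1 *: (f (h *: (1 : R) + t) - f t) @[h --> 0^'] --> l.
  apply: cvg_trans h; apply: near_eq_cvg; apply: nearW => h /=.
  by rewrite addrK /GRing.scale/= mulr1.
have d : derivable f t 1 by apply/cvg_ex; exists l.
split=> //; have := derive1_quotient d; move=> h'.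
apply: (cvg_unique _ h') => //; apply: cvg_trans h; apply: near_eq_cvg.
by apply: nearW => h /=; rewrite addrK.
Qed.

Lemma quotient_bound (f : R -> R) (C s t : R) : 0 <= C ->
  (forall c, 0 < c -> derivable f c 1) -> (forall c, 0 < c -> `|derive1 f c| <= C / c) ->
  0 < t -> t / 2 <= s -> s != t -> `|(s - t)^-1 * (f s - f t)| <= 2 * C / t.
Proof.
move=> C0 fd fC t0.
have main a b : t / 2 <= a -> a < b -> `|(b - a)^-1 * (f b - f a)| <= 2 * C / t.
  move=> ta ab; have t20 : 0 < t / 2 by rewrite divr_gt0.
  have a0 : 0 < a by exact: lt_le_trans ta.
  have [x xab|x|c cab ->] := @MVT _ f (derive1 f) a b ab.
  - move: xab; rewrite in_itv/= => /andP[ax _]; rewrite derive1E.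
    by apply/derivableP; apply: fd; exact: lt_trans ax.
  - apply: continuous_in_subspaceT => {}x; rewrite inE/= in_itv/= => /andP[ax _].
    apply/differentiable_continuous/derivable1_diffP/fd; exact: lt_le_trans ax.
  - have ba : b - a != 0 by rewrite subr_eq0 gt_eqF.
    rewrite mulrCA mulVf// mulr1; move: cab; rewrite in_itv/= => /andP[ac _].
    have c0 := lt_trans a0 ac.
    apply: le_trans (fC _ c0) _; rewrite ler_pdivrMr// mulrAC ler_pdivlMr//.
    rewrite [leRHS](_ : _ = C * (2 * c)); last by ring.
    by rewrite ler_wpM2l//; lra.
move=> ts; rewrite neq_lt => /orP[st|st]; last by apply: main => //; lra.
rewrite -normrN -mulNr -invrN opprB -[f s - f t]opprB mulrN normrN.
exact: main.
Qed.

End RealQuotients.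

Section RealIntegrals.
Variable R : realType.
Local Notation mu := (@lebesgue_measure R).

(** The integral of a nonnegative function being a supremum over simple
    functions below it, it is monotone without any measurability. *)
Lemma ge0_le_integral_nonmeasurable (D : set R) (f g : R -> \bar R) :
  (forall x, D x -> (0 <= f x)%E) -> (forall x, D x -> (f x <= g x)%E) ->
  (\int[mu]_(x in D) f x <= \int[mu]_(x in D) g x)%E.
Proof.
move=> f0 fg; rewrite !ge0_integralE//; last first.
  by move=> x Dx; apply: le_trans (fg _ Dx); exact: f0.
apply: ereal_sup_le => _ [h hf <-]; exists h => // x.
apply: le_trans (hf x) _; rewrite !patchE; case: ifPn => // xD.
by apply: fg; move: xD; rewrite inE.
Qed.

End RealIntegrals.

(** * Real and complex scalars *)

Section Scalars.
Variables (R : realType) (cplx : bool).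
Local Notation K := (scalars R cplx).
Local Notation rc := (@of_real R cplx).
Local Notation re := (@real_part R cplx).
Local Notation cj := (@conj_scalar R cplx).

Lemma of_realD a b : rc (a + b) = rc a + rc b.
Proof. by rewrite /of_real; case: cplx => //=; rewrite rmorphD. Qed.

Lemma of_realN a : rc (- a) = - rc a.
Proof. by rewrite /of_real; case: cplx => //=; rewrite rmorphN. Qed.

Lemma of_realB a b : rc (a - b) = rc a - rc b.
Proof. by rewrite of_realD of_realN. Qed.

Lemma of_realM a b : rc (a * b) = rc a * rc b.
Proof. by rewrite /of_real; case: cplx => //=; rewrite rmorphM. Qed.

Lemma of_real0 : rc 0 = 0.
Proof. by rewrite /of_real; case: cplx => //=; rewrite rmorph0. Qed.

Lemma of_real1 : rc 1 = 1.
Proof. by rewrite /of_real; case: cplx => //=; rewrite rmorph1. Qed.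

Lemma of_realV a : rc a^-1 = (rc a)^-1.
Proof. by rewrite /of_real; case: cplx => //=; rewrite fmorphV. Qed.

Lemma of_realX a n : rc (a ^+ n) = rc a ^+ n.
Proof. by rewrite /of_real; case: cplx => //=; rewrite rmorphXn. Qed.

Lemma of_real_sum I (r : seq I) (P : pred I) (F : I -> R) :
  rc (\sum_(i <- r | P i) F i) = \sum_(i <- r | P i) rc (F i).
Proof. exact: (big_morph _ of_realD of_real0). Qed.

Lemma of_real_le a b : (rc a <= rc b) = (a <= b).
Proof. by rewrite /of_real; case: cplx => //=; rewrite lecR. Qed.

Lemma of_real_lt a b : (rc a < rc b) = (a < b).
Proof. by rewrite /of_real; case: cplx => //=; rewrite ltcR. Qed.

Lemma of_real_inj : injective rc.
Proof. by move=> a b /eqP; rewrite eq_le !of_real_le -eq_le => /eqP. Qed.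

Lemma of_real_norm a : `|rc a| = rc `|a|.
Proof.
rewrite /of_real; case: cplx => //=.
by rewrite normc_def /= expr0n /= addr0 sqrtr_sqr.
Qed.

Lemma of_realK a : re (rc a) = a.
Proof. by rewrite /of_real /real_part; case: cplx. Qed.

Lemma real_partD z w : re (z + w) = re z + re w.
Proof. by rewrite /real_part; move: z w; case: cplx => //= -[a b] [c d]. Qed.

Lemma real_partN z : re (- z) = - re z.
Proof. by rewrite /real_part; move: z; case: cplx => //= -[a b]. Qed.

Lemma real_part_ofM a z : re (rc a * z) = a * re z.
Proof.
rewrite /real_part /of_real; move: z; case: cplx => //= -[b c] /=.
by rewrite mul0r subr0.
Qed.

Lemma real_partK z : 0 <= z -> rc (re z) = z.
Proof.
rewrite /real_part /of_real; move: z; case: cplx => //= z z0.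
by apply: RRe_real; exact: ger0_real.
Qed.

Lemma conj_of_real a : cj (rc a) = rc a.
Proof. by rewrite /conj_scalar /of_real; case: cplx => //=; rewrite oppr0. Qed.

Lemma conj_scalarM z w : cj (z * w) = cj z * cj w :> K.
Proof. by rewrite /conj_scalar; move: z w; case: cplx => // z w; exact: (rmorphM conjc). Qed.

(** The norm is a scalar, possibly a complex one; estimates are made on its real
    value. *)
Definition nrm (V : normedZmodType K) (x : V) : R := re `|x|.

Lemma nrmE (V : normedZmodType K) (x : V) : `|x| = rc (nrm x).
Proof. by rewrite /nrm real_partK. Qed.

Lemma nrm_ge0 (V : normedZmodType K) (x : V) : 0 <= nrm x.
Proof. by rewrite -of_real_le of_real0 -nrmE. Qed.

Lemma nrmD (V : normedZmodType K) (x y : V) : nrm (x + y) <= nrm x + nrm y.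
Proof. by rewrite -of_real_le of_realD -!nrmE ler_normD. Qed.

Lemma nrmB (V : normedZmodType K) (x y : V) : nrm (x - y) <= nrm x + nrm y.
Proof. by rewrite -of_real_le of_realD -!nrmE ler_normB. Qed.

Lemma nrmN (V : normedZmodType K) (x : V) : nrm (- x) = nrm x.
Proof. by rewrite /nrm normrN. Qed.

Lemma nrm0 (V : normedZmodType K) : nrm (0 : V) = 0.
Proof. by rewrite /nrm normr0 -of_real0 of_realK. Qed.

Lemma nrm_distC (V : normedZmodType K) (x y : V) : nrm (x - y) = nrm (y - x).
Proof. by rewrite -nrmN opprB. Qed.

Lemma nrm0_eq0 (V : normedZmodType K) (x : V) : nrm x = 0 -> x = 0.
Proof. by move=> x0; apply/eqP; rewrite -normr_eq0 nrmE x0 of_real0. Qed.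

Lemma nrmM (z w : K) : nrm (z * w) = nrm z * nrm w.
Proof. by apply: of_real_inj; rewrite of_realM -!nrmE normrM. Qed.

Lemma nrm_of_real (a : R) : nrm (rc a) = `|a|.
Proof. by rewrite /nrm of_real_norm of_realK. Qed.

Lemma mul_conj_scalar (z : K) : z * cj z = rc (nrm z ^+ 2).
Proof.
rewrite of_realX -nrmE; move: z; rewrite /conj_scalar; case: cplx => /= z.
  by rewrite sqr_normc.
by rewrite /scalars /= real_normK ?num_real// expr2.
Qed.

Lemma normr_real_part (z : K) : `|re z| <= nrm z.
Proof.
rewrite -of_real_le -nrmE; rewrite /real_part /of_real; move: z; case: cplx => //= z.
exact: normc_ge_Re.
Qed.

Lemma nrmZ (V : normedModType K) (a : K) (x : V) : nrm (a *: x) = nrm a * nrm x.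
Proof. by apply: of_real_inj; rewrite of_realM -!nrmE normrZ. Qed.

Lemma cvg_nrmP (V : normedModType K) (T : Type) (F : set_system T)
    {FF : Filter F} (f : T -> V) (l : V) :
  f @ F --> l <-> (forall e : R, 0 < e -> \forall x \near F, nrm (l - f x) < e).
Proof.
split=> [/cvgrPdist_lt fl e e0|fl].
  have := fl (rc e); rewrite -of_real0 of_real_lt => /(_ e0).
  by apply: filterS => x; rewrite nrmE of_real_lt.
apply/cvgrPdist_lt => e e0; have e0' : 0 < re e.
  by rewrite -of_real_lt of_real0 real_partK// ltW.
have := fl _ e0'; apply: filterS => x.
by rewrite -of_real_lt -nrmE real_partK// ltW.
Qed.

Lemma cvg_nrm_dist (V : normedModType K) (T : Type) (F : set_system T)
    {FF : Filter F} (f : T -> V) (l : V) :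
  f @ F --> l <-> nrm (l - f x) @[x --> F] --> (0 : R).
Proof.
rewrite cvg_nrmP; split=> [h|/cvgr0Pnorm_lt h].
  by apply/cvgr0Pnorm_lt => e /h; apply: filterS => x; rewrite ger0_norm ?nrm_ge0.
by move=> e /h; apply: filterS => x; rewrite ger0_norm ?nrm_ge0.
Qed.

(** * Functionals and the Bochner integral *)

Variable H : completeNormedModType K.
Local Notation mu := (@lebesgue_measure R).

Section Functional.
Variable phi : H -> R.
Hypothesis phiD : forall x y, phi (x + y) = phi x + phi y.
Hypothesis phiZ : forall a x, phi (rc a *: x) = a * phi x.
Hypothesis phi_le : forall x, `|phi x| <= nrm x.

Lemma functional0 : phi 0 = 0.
Proof. by have := phiZ 0 0; rewrite scaler0 mul0r. Qed.

Lemma functionalB x y : phi (x - y) = phi x - phi y.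
Proof.
rewrite phiD; congr (_ + _).
by rewrite -scaleN1r -of_real1 -of_realN phiZ mulN1r.
Qed.

Lemma functional_cvg (T : Type) (F : set_system T) {FF : Filter F} (u : T -> H) (l : H) :
  u n @[n --> F] --> l ->
  phi (u n) @[n --> F] --> phi l.
Proof.
move=> /cvg_nrmP ul; apply/cvgrPdist_lt => /= e e0.
have := ul _ e0; apply: filterS => n; apply: le_lt_trans.
by rewrite -functionalB.
Qed.

Lemma functional_simple (D : set R) (s : seq (set R * H)) :
  measurable (D : set (measurableTypeR R)) -> simple_data s ->
  mu.-integrable D (EFin \o (fun x => phi (simple_eval s x))) /\
  \int[mu]_(x in D) phi (simple_eval s x) = phi (simple_integral D s).
Proof.
move=> mD; elim: s => [_|p s IH sd].
  rewrite /simple_integral big_nil functional0.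
  have -> : (fun x => phi (simple_eval [::] x)) = cst (0 : R).
    by apply/funext => x; rewrite /simple_eval big_nil functional0.
  split; first exact: integrable0.
  by rewrite Rintegral_cst// mul0r.
have [|i1 i2] := IH; first by move=> q qs; apply: sd; rewrite inE qs orbT.
have [mp fp] : measurable (p.1 : set (measurableTypeR R)) /\ (mu p.1 < +oo)%E.
  by apply: sd; rewrite inE eqxx.
have E : (fun x => phi (simple_eval (p :: s) x)) =
    (fun x => phi p.2 * \1_(p.1) x + phi (simple_eval s x)).
  by apply/funext => x; rewrite /simple_eval big_cons phiD phiZ mulrC.
have i0 : mu.-integrable D (EFin \o (\1_(p.1) : R -> R)).
  apply/integrableP; split.
    by apply/measurable_EFinP; exact: measurable_indic.
  under eq_integral do rewrite /= ger0_norm//.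
  rewrite integral_indic//; apply: le_lt_trans fp; apply: le_measure => //;
    by rewrite ?inE//; exact: measurableI.
have i0' : mu.-integrable D (EFin \o (fun x => phi p.2 * \1_(p.1) x)).
  by have := integrableZl mD (phi p.2) i0; apply: eq_integrable => // x _; rewrite /= EFinM.
rewrite E; split.
  by have := integrableD mD i0' i1; apply: eq_integrable => // x _; rewrite /= EFinD.
rewrite RintegralD// RintegralZl// i2 /simple_integral big_cons phiD phiZ mulrC.
by rewrite {1}/Rintegral integral_indic.
Qed.

(** The functional commutes with the integrals of the simple functions, and it
    does not increase the distance of the integrand to them. *)
Lemma bochner_functional (D : set R) (f : R -> H) (I : H) :
  measurable (D : set (measurableTypeR R)) ->
  mu.-integrable D (EFin \o (fun x => phi (f x))) ->
  is_bochner_integral D f I -> phi I = \int[mu]_(x in D) phi (f x).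
Proof.
move=> mD fi [s [sd _ sL sI]].
have c1 : phi (simple_integral D (s n)) @[n --> \oo] --> phi I by exact: functional_cvg.
apply: (cvg_unique _ c1) => //.
have c3 : (`|\int[mu]_(x in D) phi (f x) - phi (simple_integral D (s n))|)%:E
    @[n --> \oo] --> 0%E.
  apply: (squeeze_cvge _ (cvg_cst 0%E) sL); apply: nearW => n.
  rewrite lee_fin normr_ge0/=.
  have [i1 i2] := functional_simple mD (sd n).
  rewrite -i2 -RintegralB//.
  have i3 : mu.-integrable D (EFin \o (fun x => phi (f x) - phi (simple_eval (s n) x))).
    by have := integrableB mD fi i1; apply: eq_integrable => // x _; rewrite /= EFinB.
  apply: (@le_trans _ _ (\int[mu]_(x in D) `|phi (f x) - phi (simple_eval (s n) x)|)%:E%E).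
    by rewrite lee_fin; exact: le_normr_Rintegral.
  have i4 : mu.-integrable D (EFin \o (fun x => `|phi (f x) - phi (simple_eval (s n) x)|)).
    by have := integrable_abse i3; exact: eq_integrable.
  rewrite /Rintegral fineK ?integrable_fin_num//.
  apply: ge0_le_integral_nonmeasurable => x Dx; rewrite lee_fin//.
  by rewrite -functionalB.
apply/cvgrPdist_lt => /= e e0.
move/fine_cvgP : c3 => [_] /cvgr0Pnorm_lt/(_ _ e0); apply: filterS => n /=.
by rewrite normr_id.
Qed.

End Functional.

Lemma is_bochner_integral_eq (D : set R) (f g : R -> H) (I : H) :
  (forall x, D x -> f x = g x) -> is_bochner_integral D f I -> is_bochner_integral D g I.
Proof.
move=> fg [s [sd sf sL sI]]; exists s; split=> //.
  have [N [mN N0 hN]] := sf; exists N; split=> // x /= hx; apply: hN => /= h.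
  by apply: hx => Dx; rewrite -fg//; exact: h.
have -> : (fun n => \int[mu]_(x in D) (re `|g x - simple_eval (s n) x|)%:E)%E =
    (fun n => \int[mu]_(x in D) (re `|f x - simple_eval (s n) x|)%:E)%E => //.
by apply/funext => n; apply: eq_integral => x /[!inE] Dx; rewrite fg.
Qed.

(** * Fourier coefficients and multipliers *)

Variable ip : {dot H for conj_scalar cplx}.
Hypothesis hip : inner_product_of_norm ip.

Lemma ipDl x y z : ip (x + y) z = ip x z + ip y z.
Proof. exact: linearDl. Qed.

Lemma ipZl a x z : ip (a *: x) z = a * ip x z.
Proof. exact: linearZl_LR. Qed.

Lemma ipC x y : ip x y = cj (ip y x).
Proof. by rewrite (@hermitian_subproof _ _ _ _ ip) expr0 mul1r. Qed.

Lemma ipDr x y z : ip z (x + y) = ip z x + ip z y.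
Proof. exact: linearDr. Qed.

Lemma ipZr a x z : ip z (a *: x) = cj a * ip z x.
Proof. by rewrite ipC ipZl conj_scalarM -ipC. Qed.

Lemma ipNl x z : ip (- x) z = - ip x z.
Proof. exact: linearNl. Qed.

Lemma ipNr x z : ip z (- x) = - ip z x.
Proof. exact: linearNr. Qed.

Lemma ipBl x y z : ip (x - y) z = ip x z - ip y z.
Proof. by rewrite ipDl ipNl. Qed.

Lemma ipBr x y z : ip z (x - y) = ip z x - ip z y.
Proof. by rewrite ipDr ipNr. Qed.

Lemma ip0l z : ip 0 z = 0.
Proof. exact: linear0l. Qed.

Lemma ip0r z : ip z 0 = 0.
Proof. exact: linear0r. Qed.

Lemma ip_suml I (r : seq I) (P : pred I) (F : I -> H) z :
  ip (\sum_(i <- r | P i) F i) z = \sum_(i <- r | P i) ip (F i) z.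
Proof. by apply: (big_morph (fun x => ip x z)) => [x y|]; [exact: ipDl|exact: ip0l]. Qed.

Lemma ip_sumr I (r : seq I) (P : pred I) (F : I -> H) z :
  ip z (\sum_(i <- r | P i) F i) = \sum_(i <- r | P i) ip z (F i).
Proof. by apply: (big_morph (fun x => ip z x)) => [x y|]; [exact: ipDr|exact: ip0r]. Qed.

Lemma ip_nrm x : ip x x = rc (nrm x ^+ 2).
Proof. by rewrite hip of_realX -nrmE. Qed.

Lemma cauchy_schwarz x y : nrm (ip x y) <= nrm x * nrm y.
Proof.
have [->|y0] := eqVneq y 0; first by rewrite ip0r nrm0 mulr_ge0 ?nrm_ge0.
have ny0 : 0 < nrm y.
  rewrite lt_neqAle nrm_ge0 andbT eq_sym; apply: contra y0 => /eqP/nrm0_eq0 ->.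
  exact: eqxx.
pose a := ip x y; pose n := nrm y ^+ 2.
have n0 : 0 < n by rewrite exprn_gt0.
have : ip (rc n *: x - a *: y) (rc n *: x - a *: y) =
    rc (n * (n * nrm x ^+ 2 - nrm a ^+ 2)).
  rewrite !ipBl !ipBr !ipZl !ipZr conj_of_real (ipC y x) -/a !ip_nrm.
  rewrite [LHS](_ : _ = rc n * rc n * rc (nrm x ^+ 2) - rc n * (a * cj a)
    - a * cj a * rc n + a * cj a * rc n); last by rewrite -/n; ring.
  rewrite mul_conj_scalar -!of_realM -!of_realB -of_realD; congr rc; ring.
rewrite ip_nrm => /of_real_inj h.
have : 0 <= n * (n * nrm x ^+ 2 - nrm a ^+ 2) by rewrite -h sqr_ge0.
rewrite pmulr_rge0// subr_ge0 => le.
rewrite -(@ler_pXn2r _ 2)// ?nnegrE ?mulr_ge0 ?nrm_ge0//.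
by rewrite exprMn mulrC.
Qed.

Section Orthonormal.
Variable v : nat -> H.
Hypothesis hv : forall j k : nat, ip (v j) (v k) = (j == k)%:R.
Hypothesis vdense : dense [set x : H | exists (n : nat) (c : nat -> K),
    x = \sum_(0 <= k < n) c k *: v k].

Local Notation coef x k := (ip x (v k)).

Lemma nrm_basis k : nrm (v k) = 1.
Proof.
have := ip_nrm (v k); rewrite hv eqxx -of_real1.
move=> /of_real_inj/esym/eqP.
by rewrite sqrf_eq1 => /orP[/eqP//|/eqP h]; have := nrm_ge0 (v k); rewrite h; lra.
Qed.

Definition expansion (n : nat) (a : nat -> K) : H := \sum_(0 <= k < n) a k *: v k.

Lemma ip_expansion n a j : coef (expansion n a) j = if (j < n)%N then a j else 0.
Proof.
rewrite /expansion ip_suml; under eq_bigr do rewrite ipZl hv.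
case: ltnP => [jn|nj].
  rewrite (bigD1_seq j) ?mem_index_iota ?iota_uniq//= eqxx mulr1.
  by rewrite big1 ?addr0// => i /negbTE ij; rewrite ij mulr0.
rewrite big_nat big1// => i /andP[_ ilt].
by rewrite (_ : i == j = false) ?mulr0//; apply/negbTE; rewrite neq_ltn (leq_trans ilt nj).
Qed.

Lemma nrm_expansion n a :
  nrm (expansion n a) ^+ 2 = \sum_(0 <= k < n) nrm (a k) ^+ 2.
Proof.
apply: of_real_inj; rewrite -ip_nrm of_real_sum {2}/expansion ip_sumr.
apply: eq_big_nat => i /andP[_ ilt].
by rewrite ipZr ip_expansion ilt mulrC mul_conj_scalar.
Qed.

Lemma bessel n x : \sum_(0 <= k < n) nrm (coef x k) ^+ 2 <= nrm x ^+ 2.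
Proof.
pose e := expansion n (fun k => coef x k).
have -> : \sum_(0 <= k < n) nrm (coef x k) ^+ 2 = nrm e ^+ 2 by rewrite nrm_expansion.
have h : ip x e = rc (nrm e ^+ 2).
  rewrite nrm_expansion of_real_sum /e /expansion ip_sumr; apply: eq_bigr => i _.
  by rewrite ipZr mulrC mul_conj_scalar.
have := cauchy_schwarz x e; rewrite h nrm_of_real ger0_norm ?sqr_ge0//.
have e0 := nrm_ge0 e; have x0 := nrm_ge0 x.
move: e0; rewrite le_eqVlt => /predU1P[<- _|e0]; first by rewrite expr0n sqr_ge0.
move=> h2; have ex : nrm e <= nrm x by move: h2; rewrite expr2 ler_pM2r.
by rewrite ler_pXn2r ?nnegrE// ltW.
Qed.

Definition truncated (m : nat -> R) (x : H) (n : nat) : H :=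
  expansion n (fun k => rc (m k) * coef x k).

Lemma truncated_le (m : nat -> R) (M : R) x n : (forall k, `|m k| <= M) ->
  nrm (truncated m x n) <= M * nrm x.
Proof.
move=> mM; have M0 : 0 <= M by exact: le_trans (mM 0%N).
rewrite -(@ler_pXn2r _ 2)// ?nnegrE ?mulr_ge0 ?nrm_ge0// nrm_expansion exprMn.
apply: le_trans (ler_wpM2l (sqr_ge0 M) (bessel n x)).
rewrite mulr_sumr; apply: ler_sum => i _; rewrite nrmM nrm_of_real exprMn.
by rewrite ler_wpM2r ?sqr_ge0// ler_pXn2r ?nnegrE.
Qed.

Lemma truncatedB m x y n : truncated m (x - y) n = truncated m x n - truncated m y n.
Proof.
rewrite /truncated /expansion -sumrB; apply: eq_bigr => i _.
by rewrite ipBl mulrBr scalerBl.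
Qed.

Lemma truncated_expansion m n a p : (n <= p)%N ->
  truncated m (expansion n a) p = expansion n (fun k => rc (m k) * a k).
Proof.
move=> np; rewrite /truncated {1}/expansion (big_cat_nat (n := n))//=.
rewrite [X in _ + X]big_nat [X in _ + X]big1 ?addr0; last first.
  by move=> i /andP[ni _]; rewrite ip_expansion ltnNge ni/= mulr0 scale0r.
by apply: eq_big_nat => i /andP[_ ilt]; rewrite ip_expansion ilt.
Qed.

Lemma dense_approx x (e : R) : 0 < e ->
  exists n a, nrm (x - expansion n a) < e.
Proof.
move=> e0; have rce : 0 < rc e by rewrite -of_real0 of_real_lt.
have [||z [xz [n [a zE]]]] := vdense (O := ball x (rc e)).
- by exists x; exact: ballxx.
- exact: ball_open.
exists n, a; move: xz; rewrite -ball_normE /= zE nrmE of_real_lt //.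
Qed.

(** The truncations are uniformly bounded, and they are eventually constant on
    the dense set of finite expansions. *)
Lemma truncated_cvg (m : nat -> R) (M : R) x : (forall k, `|m k| <= M) ->
  cvg (truncated m x n @[n --> \oo]).
Proof.
move=> mM; have M0 : 0 <= M by exact: le_trans (mM 0%N).
apply: cauchy_cvg; apply: cauchy_exP => _/posnumP[e].
have e0 : 0 < re e%:num by rewrite -of_real_lt of_real0 real_partK.
pose d := re e%:num / (2 * (M + 1)).
have M1 : 0 < M + 1 by rewrite ltr_wpDl.
have d0 : 0 < d by rewrite divr_gt0// mulr_gt0.
have [N [a xa]] := dense_approx x d0.
exists (truncated m x N); exists N => // n /= Nn.
rewrite -ball_normE /= nrmE -(@real_partK e%:num)// of_real_lt.
have E p : (N <= p)%N -> truncated m x p =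
    truncated m (x - expansion N a) p + expansion N (fun k => rc (m k) * a k).
  by move=> Np; rewrite truncatedB truncated_expansion// subrK.
rewrite (E N)// (E n)// opprD addrACA subrr addr0.
apply: (le_lt_trans (nrmB _ _)).
apply: (@le_lt_trans _ _ (M * d + M * d)).
  by apply: lerD; apply: (le_trans (truncated_le _ _ mM)); rewrite ler_wpM2l// ltW.
have -> : re e%:num = (M + 1) * d + (M + 1) * d.
  by rewrite /d; field; exact: lt0r_neq0.
by rewrite ltrD// ltr_pM2r// ltrDl.
Qed.

(** A bounded function of the operator: it multiplies the k-th mode by [m k]. *)
Definition multiplier (m : nat -> R) (x : H) : H :=
  lim (truncated m x n @[n --> \oo]).

Lemma multiplier_cvg (m : nat -> R) (M : R) x : (forall k, `|m k| <= M) ->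
  truncated m x n @[n --> \oo] --> multiplier m x.
Proof. by move=> mM; exact: truncated_cvg mM. Qed.

Lemma cvg_nrm_le (u : nat -> H) (l : H) (C : R) : u n @[n --> \oo] --> l ->
  (\forall n \near \oo, nrm (u n) <= C) -> nrm l <= C.
Proof.
move=> ul uC; apply/ler_addgt0Pr => e e0.
have /cvg_nrmP/(_ _ e0) h := ul.
near \oo => n.
have h1 : nrm (l - u n) < e by near: n.
have h2 : nrm (u n) <= C by near: n.
by have := nrmD (l - u n) (u n); rewrite subrK; lra.
Unshelve. all: by end_near. Qed.

Lemma multiplier_le (m : nat -> R) (M : R) x : (forall k, `|m k| <= M) ->
  nrm (multiplier m x) <= M * nrm x.
Proof.
move=> mM; apply: (cvg_nrm_le (multiplier_cvg mM)).
by apply: nearW => n; exact: truncated_le.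
Qed.

Lemma ip_continuous (T : Type) (F : set_system T) {FF : ProperFilter F}
    (f : T -> H) (l y : H) (c : K) :
  f @ F --> l -> (\forall t \near F, ip (f t) y = c) -> ip l y = c.
Proof.
move=> /cvg_nrmP fl fc; apply/eqP; rewrite -subr_eq0; apply/eqP/nrm0_eq0/eqP.
rewrite eq_le nrm_ge0 andbT; apply/ler_addgt0Pr => e e0.
have y1 : 0 < nrm y + 1 by rewrite ltr_wpDl// nrm_ge0.
have h := fl _ (divr_gt0 e0 y1); near F => t.
have <- : ip (f t) y = c by near: t.
rewrite -ipBl add0r (le_trans (cauchy_schwarz _ _))//.
have ht : nrm (l - f t) < e / (nrm y + 1) by near: t.
apply: (@le_trans _ _ (e / (nrm y + 1) * (nrm y + 1))).
  by apply: ler_pM; rewrite ?nrm_ge0// ?lerDl// ltW.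
by rewrite divfK// lt0r_neq0.
Unshelve. all: by end_near. Qed.

Lemma ip_multiplier (m : nat -> R) (M : R) x k : (forall k, `|m k| <= M) ->
  coef (multiplier m x) k = rc (m k) * coef x k.
Proof.
move=> mM; apply: (ip_continuous (multiplier_cvg mM)).
by exists k.+1 => // n /= kn; rewrite ip_expansion kn.
Qed.

Lemma coef_inj x y : (forall k, coef x k = coef y k) -> x = y.
Proof.
move=> xy; apply/eqP; rewrite -subr_eq0; apply/eqP/nrm0_eq0/eqP.
rewrite eq_le nrm_ge0 andbT; apply/ler_addgt0Pr => e e0; rewrite add0r.
set z := x - y; have [n [a za]] := dense_approx z e0.
have z0 : ip z (expansion n a) = 0.
  rewrite ip_sumr big1// => i _; rewrite ipZr /z ipBl xy subrr mulr0//.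
have : ip z (z - expansion n a) = rc (nrm z ^+ 2) by rewrite ipBr z0 subr0 ip_nrm.
move=> h; have := cauchy_schwarz z (z - expansion n a); rewrite h nrm_of_real.
rewrite ger0_norm ?sqr_ge0//; have := nrm_ge0 z.
rewrite le_eqVlt => /predU1P[<- _|z1]; first exact: ltW.
by rewrite expr2 ler_pM2l// => /le_trans -> //; exact: ltW.
Qed.

(** Dominated convergence in the coordinates: finitely many modes carry [x] up to
    a small error, and the multipliers are uniformly bounded on the rest. *)
Lemma multiplier_continuous (T : Type) (F : set_system T) {FF : Filter F}
    (m : T -> nat -> R) (m0 : nat -> R) (M : R) (x : H) :
  (forall k, m t k @[t --> F] --> m0 k) ->
  (\forall t \near F, forall k, `|m t k| <= M) -> (forall k, `|m0 k| <= M) ->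
  multiplier (m t) x @[t --> F] --> multiplier m0 x.
Proof.
move=> mc mM m0M; have M0 : 0 <= M by exact: le_trans (m0M 0%N).
apply/cvg_nrmP => e e0.
have M1 : 0 < M + 1 by rewrite ltr_wpDl.
pose d := e / (4 * (M + 1)); have d0 : 0 < d by rewrite divr_gt0// mulr_gt0.
have [N [a xa]] := dense_approx x d0.
have mulE (p : nat -> R) : (forall k, `|p k| <= M) -> multiplier p x =
    multiplier p (x - expansion N a) + expansion N (fun k => rc (p k) * a k).
  move=> pM; apply: coef_inj => k; rewrite ipDl !(ip_multiplier _ _ pM) ipBl.
  by rewrite !ip_expansion; case: ifP => _; rewrite ?addr0 ?subr0// mulrBr subrK.
have fin : \forall t \near F,
    nrm (expansion N (fun k => rc (m0 k - m t k) * a k)) < e / 2.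
  have : (\sum_(0 <= k < N) (nrm (a k) * `|m0 k - m t k|)) @[t --> F] --> (0 : R).
    elim: (N) => [|n IH].
      by under eq_fun do rewrite big_geq//; exact: cvg_cst.
    have -> : (fun t => \sum_(0 <= k < n.+1) (nrm (a k) * `|m0 k - m t k|)) =
        (fun t => \sum_(0 <= k < n) (nrm (a k) * `|m0 k - m t k|) +
           nrm (a n) * `|m0 n - m t n|).
      by apply/funext => t; rewrite big_nat_recr.
    have h2 : nrm (a n) * `|m0 n - m t n| @[t --> F] --> nrm (a n) * `|m0 n - m0 n|.
      apply: cvgM; first exact: cvg_cst.
      by apply: cvg_norm; apply: cvgB; [exact: cvg_cst|exact: mc].
    rewrite subrr normr0 mulr0 in h2.
    by have := cvgD IH h2; rewrite addr0; exact.
  have e20 : 0 < e / 2 by rewrite divr_gt0.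
  move/cvgr0Pnorm_lt => /(_ _ e20); apply: filterS => t; apply: le_lt_trans.
  apply: le_trans (ler_norm _); rewrite /expansion.
  elim/big_ind2 : _ => [|u c u' c' h h'|i _]; first by rewrite nrm0.
    by apply: le_trans (nrmD _ _) _; exact: lerD.
  by rewrite nrmZ nrmM nrm_of_real nrm_basis mulr1 mulrC.
apply: filterS2 mM fin => t tM tfin.
rewrite (mulE _ m0M) (mulE _ tM) opprD addrACA.
have -> : expansion N (fun k => rc (m0 k) * a k) - expansion N (fun k => rc (m t k) * a k)
    = expansion N (fun k => rc (m0 k - m t k) * a k).
  rewrite /expansion -sumrB; apply: eq_bigr => i _.
  by rewrite of_realB mulrBl scalerBl.
apply: (le_lt_trans (nrmD _ _)).
have h1 : nrm (multiplier m0 (x - expansion N a) - multiplier (m t) (x - expansion N a))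
    <= M * d + M * d.
  apply: (le_trans (nrmB _ _)); apply: lerD.
    by apply: (le_trans (multiplier_le _ m0M)); rewrite ler_wpM2l// ltW.
  by apply: (le_trans (multiplier_le _ tM)); rewrite ler_wpM2l// ltW.
have h2 : M * d + M * d < e / 2.
  have -> : e / 2 = (M + 1) * d + (M + 1) * d by rewrite /d; field; exact: lt0r_neq0.
  by rewrite ltrD// ltr_pM2r// ltrDl.
lra.
Qed.


Local Notation mul := multiplier.

(** * Bochner integrals of families of multipliers *)

(** Real functionals, of norm at most 1 when [nrm c <= 1], that separate points.
    Being real valued, they turn Bochner integrals into Lebesgue integrals and
    the equation in [H] into the scalar one, whatever the field of scalars. *)
Definition pairing (c : K) (k : nat) (x : H) : R := re (ip x (c *: v k)).

Lemma pairingD c k x y : pairing c k (x + y) = pairing c k x + pairing c k y.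
Proof. by rewrite /pairing ipDl real_partD. Qed.

Lemma pairingZ c k a x : pairing c k (rc a *: x) = a * pairing c k x.
Proof. by rewrite /pairing ipZl real_part_ofM. Qed.

Lemma pairing_le c k x : nrm c <= 1 -> `|pairing c k x| <= nrm x.
Proof.
move=> c1; apply: le_trans (normr_real_part _) _.
apply: le_trans (cauchy_schwarz _ _) _.
by rewrite nrmZ nrm_basis mulr1 ler_piMr ?nrm_ge0.
Qed.

Lemma pairing_multiplier c k m M x : (forall k, `|m k| <= M) ->
  pairing c k (mul m x) = m k * pairing c k x.
Proof.
move=> mM; rewrite /pairing !ipZr (ip_multiplier _ _ mM).
by rewrite mulrCA real_part_ofM.
Qed.

Lemma pairing_inj x y :
  (forall c k, nrm c <= 1 -> pairing c k x = pairing c k y) -> x = y.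
Proof.
move=> h; apply: coef_inj => k; apply/eqP; rewrite -subr_eq0 -ipBl.
set z := coef (x - y) k; pose r := (nrm z + 1)^-1.
have z1 : 0 < nrm z + 1 by rewrite ltr_wpDl ?nrm_ge0.
have rz : nrm (rc r * z) <= 1.
  rewrite nrmM nrm_of_real ger0_norm ?invr_ge0 ?(ltW z1)// mulrC.
  by rewrite ler_pdivrMr// mul1r lerDl.
(* tested against its own k-th coefficient z, the difference gives |z|^2 / (|z| + 1) *)
have := h _ k rz; move/eqP; rewrite -subr_eq0 => /eqP.
rewrite /pairing -real_partN -real_partD -ipNl -ipDl ipZr conj_scalarM conj_of_real -/z.
rewrite -mulrA real_part_ofM mulrC (mulrC (cj z)) mul_conj_scalar of_realK => /eqP.
rewrite mulf_eq0 invr_eq0 (gt_eqF z1) orbF sqrf_eq0 => /eqP/nrm0_eq0 ->.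
exact: eqxx.
Qed.

Lemma multiplierB (m p : nat -> R) (M : R) x :
  (forall k, `|m k| <= M) -> (forall k, `|p k| <= M) ->
  mul (fun k => m k - p k) x = mul m x - mul p x.
Proof.
move=> mM pM; apply: coef_inj => k.
have mpM j : `|m j - p j| <= M + M.
  by apply: le_trans (ler_normB _ _) _; exact: lerD.
rewrite ipBl (ip_multiplier _ _ mpM) (ip_multiplier _ _ mM).
by rewrite (ip_multiplier _ _ pM) of_realB mulrBl.
Qed.

Definition cut (n : nat) (m : nat -> R) (k : nat) : R := if (k < n)%N then m k else 0.

Lemma cut_le n m M : (forall k, `|m k| <= M) -> forall k, `|cut n m k| <= M.
Proof.
move=> mM k; rewrite /cut; case: ifP => // _; rewrite normr0.
exact: le_trans (mM 0%N).
Qed.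

Lemma truncatedE n m M x : (forall k, `|m k| <= M) ->
  truncated m x n = mul (cut n m) x.
Proof.
move=> mM; apply: coef_inj => k.
rewrite (ip_multiplier _ _ (cut_le n mM)) ip_expansion /cut.
by case: ifP => // _; rewrite of_real0 mul0r.
Qed.

(** By Parseval the norm is a limit of square roots of finite sums. *)
Lemma measurable_nrm_multiplier (D : set R) (d : nat -> R -> R) (G : R -> R) x :
  measurable (D : set (measurableTypeR R)) ->
  (forall k, measurable_fun D (d k)) ->
  (forall k s, D s -> `|d k s| <= G s) ->
  measurable_fun D (fun s => nrm (mul (d^~ s) x)).
Proof.
move=> mD md dG.
apply: (@measurable_fun_cvg _ _ _ _
  (fun n s => Num.sqrt (\sum_(0 <= k < n) (d k s ^+ 2 * nrm (coef x k) ^+ 2)))).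
  move=> n; apply: measurableT_comp.
    by apply: continuous_measurable_fun; exact: sqrt_continuous.
  apply: measurable_sum => k; apply: measurable_funM => //.
  exact: measurable_funX.
move=> s Ds.
have -> : (fun n => Num.sqrt (\sum_(0 <= k < n) (d k s ^+ 2 * nrm (coef x k) ^+ 2)))
    = (fun n => nrm (truncated (d^~ s) x n)).
  apply/funext => n; rewrite -[RHS]ger0_norm ?nrm_ge0// -sqrtr_sqr; congr Num.sqrt.
  rewrite nrm_expansion; apply: eq_bigr => k _.
  by rewrite nrmM nrm_of_real exprMn real_normK ?num_real.
have /cvg_nrmP h := multiplier_cvg (x := x) (fun k => dG k s Ds).
apply/cvgrPdist_lt => /= e e0; have := h _ e0; apply: filterS => n; apply: le_lt_trans.
rewrite ler_norml; have h1 := nrmD (mul (d^~ s) x - truncated (d^~ s) x n)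
  (truncated (d^~ s) x n).
have h2 := nrmD (truncated (d^~ s) x n - mul (d^~ s) x) (mul (d^~ s) x).
by move: h1 h2; rewrite !subrK (nrm_distC (truncated _ _ _)); lra.
Qed.

(** Every functional [pairing c k] sees the k-th mode only, where the integral is
    a Lebesgue integral. *)
Lemma bochner_multiplier_unique (D : set R) (h : nat -> R -> R) (G : R -> R) (C : R) x I :
  measurable (D : set (measurableTypeR R)) ->
  (forall k, mu.-integrable D (EFin \o h k)) ->
  (forall k s, D s -> `|h k s| <= G s) ->
  (forall k, `|\int[mu]_(s in D) h k s| <= C) ->
  is_bochner_integral D (fun s => mul (h^~ s) x) I ->
  I = mul (fun k => \int[mu]_(s in D) h k s) x.
Proof.
move=> mD ih hG hC bI; apply: pairing_inj => c k c1.
have E s : D s -> pairing c k (mul (h^~ s) x) = h k s * pairing c k x.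
  by move=> Ds; rewrite (pairing_multiplier _ _ _ (fun k => hG k s Ds)).
rewrite (pairing_multiplier _ _ _ hC).
rewrite (bochner_functional (pairingD c k) (pairingZ c k) _ mD _ bI).
- rewrite -RintegralZr//; apply: eq_Rintegral => s /[!inE]; exact: E.
- by move=> y; exact: pairing_le.
- have := integrableZr mD (pairing c k x) (ih k); apply: eq_integrable => // s /[!inE] Ds.
  by rewrite /= E// EFinM.
Qed.

(** Represents the simple function s |-> a s z with values in [H]. *)
Definition level_data (D : set R) (a : R -> R) (z : H) : seq (set R * H) :=
  [seq (D `&` a @^-1` [set r], rc r *: z) | r <- finmap.enum_fset (fset_set (range a))].

Lemma level_data_simple (D : set R) (a : {nnsfun measurableTypeR R >-> R}) z :
  measurable (D : set (measurableTypeR R)) -> (mu D < +oo)%E ->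
  simple_data (level_data D a z).
Proof.
move=> mD fD p /mapP[r _ ->] /=.
have mI : measurable ((D `&` a @^-1` [set r]) : set (measurableTypeR R)).
  exact: measurableI.
split=> //; apply: le_lt_trans fD; apply: le_measure => //; rewrite ?inE//.
Qed.

Lemma level_data_eval (D : set R) (a : {nnsfun measurableTypeR R >-> R}) z s : D s ->
  simple_eval (level_data D a z) s = rc (a s) *: z.
Proof.
move=> Ds; rewrite /simple_eval big_map fimfunE fsbig_finite//= of_real_sum scaler_suml.
apply: eq_bigr => r _; rewrite scalerA -of_realM mulrC; congr (rc (_ * _) *: z).
by rewrite !indicE in_setI (mem_set Ds).
Qed.

(** The simple functions are built mode by mode: the n-th one takes the n-th
    approximations from below of the first n components. Dominated convergence
    is applied three times: in the coordinates for the pointwise limit, to the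
    norm of the remainder, and in each component for the integrals. *)
Lemma bochner_multiplier (D : set R) (h : nat -> R -> R) (G : R -> R) x :
  measurable (D : set (measurableTypeR R)) -> (mu D < +oo)%E ->
  (forall k, measurable_fun D (h k)) ->
  mu.-integrable D (EFin \o G) ->
  (forall k s, D s -> 0 <= h k s <= G s) ->
  is_bochner_integral D (fun s => mul (h^~ s) x)
    (mul (fun k => \int[mu]_(s in D) h k s) x).
Proof.
move=> mD fD mh iG hG.
have mh' k : measurable_fun D (EFin \o h k) by apply/measurable_EFinP; exact: mh.
have h0 k s : D s -> (0 <= (EFin \o h k) s)%E.
  by move=> Ds; rewrite lee_fin; case/andP : (hG k s Ds).
pose a (k n : nat) : R -> R := nnsfun_approx mD (mh' k) n.
have a0 k n s : 0 <= a k n s by exact: fun_ge0.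
have ah k s : D s -> a k n s @[n --> \oo] --> h k s.
  by move=> Ds; have /fine_cvg := cvg_nnsfun_approx mD (mh' k) (h0 k) Ds.
have ale k n s : D s -> a k n s <= h k s.
  move=> Ds; rewrite -(cvg_lim _ (ah k s Ds))//; apply: nondecreasing_cvgn_le.
    by move=> i j ij; have /lefP := nd_nnsfun_approx mD (mh' k) ij; exact.
  by apply/cvg_ex; exists (h k s); exact: ah.
have aG k n s : D s -> `|a k n s| <= G s.
  move=> Ds; rewrite ger0_norm//; apply: le_trans (ale k n s Ds) _.
  by case/andP : (hG k s Ds).
have hG' k s : D s -> `|h k s| <= G s.
  by move=> Ds; rewrite ger0_norm; case/andP : (hG k s Ds).
have ma k n : measurable_fun D (a k n).
  by apply: measurable_funTS; exact: (measurable_funPT (nnsfun_approx mD (mh' k) n)).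
have G0 s : D s -> 0 <= G s by move=> Ds; apply: le_trans (hG' 0%N s Ds).
pose c (n k : nat) (s : R) : R := cut n (fun k => a k n s) k.
have cG n k s : D s -> `|c n k s| <= G s.
  by move=> Ds; apply: cut_le => j; exact: aG.
have c0 n k s : 0 <= c n k s by rewrite /c /cut; case: ifP.
have ch k s : D s -> c n k s @[n --> \oo] --> h k s.
  move=> Ds; apply: cvg_trans (ah k s Ds); apply: near_eq_cvg.
  by exists k.+1 => // n /= kn; rewrite /c /cut kn.
have mc n k : measurable_fun D (c n k).
  by rewrite /c /cut; case: (k < n)%N => //; exact: measurable_cst.
have ic n k : mu.-integrable D (EFin \o c n k).
  apply: (le_integrable mD _ _ iG); first by apply/measurable_EFinP; exact: mc.
  by move=> s Ds; rewrite /= lee_fin (ger0_norm (G0 s Ds)); exact: cG.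
pose S n : seq (set R * H) :=
  flatten [seq level_data D (nnsfun_approx mD (mh' k) n) (coef x k *: v k) | k <- index_iota 0 n].
have SE n s : D s -> simple_eval (S n) s = mul ((c n)^~ s) x.
  move=> Ds; rewrite -(truncatedE n x (fun k => aG k n s Ds)).
  rewrite /simple_eval /S big_flatten big_map; apply: eq_bigr => k _.
  rewrite -/(simple_eval _ _) level_data_eval// scalerA//.
have Sd n : simple_data (S n).
  by move=> p /flattenP[l /mapP[k _ ->]]; exact: level_data_simple.
have bnd (u : R -> R) : mu.-integrable D (EFin \o u) ->
    (forall s, D s -> 0 <= u s <= G s) -> `|\int[mu]_(s in D) u s| <= \int[mu]_(s in D) G s.
  move=> iu uG; rewrite ger0_norm; last first.
    by apply: Rintegral_ge0 => s /uG/andP[].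
  by apply: le_Rintegral => // s /uG/andP[].
have SI n : simple_integral D (S n) = mul (fun k => \int[mu]_(s in D) c n k s) x.
  apply: pairing_inj => e k e1.
  have [_ <-] := functional_simple (pairingD e k) (pairingZ e k) mD (Sd n).
  rewrite (pairing_multiplier _ _ _ (M := \int[mu]_(s in D) G s)).
    rewrite -RintegralZr//; apply: eq_Rintegral => s /[!inE] Ds.
    by rewrite SE// (pairing_multiplier _ _ _ (fun k => cG n k s Ds)).
  move=> j; apply: bnd => // s Ds; rewrite c0 /=; apply: le_trans (cG n j s Ds).
  exact: ler_norm.
have ih k : mu.-integrable D (EFin \o h k).
  apply: (le_integrable mD (mh' k) _ iG).
  by move=> s Ds; rewrite /= lee_fin (ger0_norm (G0 s Ds)); exact: hG'.
exists S; split=> //.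
- apply: aeW => s Ds; under eq_fun do rewrite SE//.
  apply: (multiplier_continuous (M := G s)).
  + by move=> k; exact: ch.
  + by apply: nearW => n k; exact: cG.
  + by move=> k; exact: hG'.
- have dG n k s : D s -> `|h k s - c n k s| <= G s.
    move=> Ds; have := hG k s Ds; have := c0 n k s; have := cG n k s Ds.
    by rewrite !ler_norml; lra.
  have E n : (\int[mu]_(s in D) (re `|mul (h^~ s) x - simple_eval (S n) s|)%:E)%E =
      (\int[mu]_(s in D) (nrm (mul (fun k => h k s - c n k s) x))%:E)%E.
    apply: eq_integral => s /[!inE] Ds; rewrite SE// /nrm.
    by rewrite (multiplierB x (fun k => hG' k s Ds) (fun k => cG n k s Ds)).
  under eq_fun do rewrite E.
  have iG' : mu.-integrable D (fun s => (nrm x)%:E * (EFin \o G) s)%E.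
    exact: integrableZl.
  have [] := dominated_convergence mD (f_ := fun n s =>
    (nrm (mul (fun k => h k s - c n k s) x))%:E) (f := cst 0%E) _ _ _ iG'.
  + move=> n; apply/measurable_EFinP.
    apply: (measurable_nrm_multiplier (G := G)) => //; last by move=> k s; exact: dG.
    by move=> k; exact: measurable_funB.
  + exact: measurable_cst.
  + apply: aeW => s Ds; apply: cvg_EFin; first exact: nearW.
    have hc : mul ((c n)^~ s) x @[n --> \oo] --> mul (h^~ s) x.
      apply: (multiplier_continuous (M := G s)).
      - by move=> k; exact: ch.
      - by apply: nearW => n k; exact: cG.
      - by move=> k; exact: hG'.
    move/cvg_nrm_dist : hc; apply: cvg_trans; apply: near_eq_cvg; apply: nearW => n /=.
    by rewrite (multiplierB x (fun k => hG' k s Ds) (fun k => cG n k s Ds)).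
  + apply: aeW => s n Ds; rewrite /= ger0_norm ?nrm_ge0// -EFinM lee_fin mulrC.
    by apply: multiplier_le => k; exact: dG.
  by move=> _ _; rewrite integral0; exact.
- under eq_fun do rewrite SI.
  apply: (multiplier_continuous (M := \int[mu]_(s in D) G s)).
  + move=> k; have [] := dominated_convergence mD (f_ := fun n s => (c n k s)%:E)
      (f := EFin \o h k) _ _ _ iG.
    * by move=> n; apply/measurable_EFinP; exact: mc.
    * exact: mh'.
    * by apply: aeW => s Ds; apply: cvg_EFin; [exact: nearW|exact: ch].
    * by apply: aeW => s n Ds; rewrite /= lee_fin; exact: cG.
    move=> _ _ hc; apply: fine_cvg; rewrite fineK; first exact: hc.
    exact: (integrable_fin_num mD (ih k)).
  + apply: nearW => n k; apply: bnd => // s Ds; rewrite c0 /=.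
    by apply: le_trans (cG n k s Ds); exact: ler_norm.
  + by move=> k; apply: bnd => // s; exact: hG.
Qed.


(** * The domain of the operator and difference quotients *)

Lemma ip_cvg (T : Type) (F : set_system T) {FF : Filter F} (f : T -> H) (l y : H) :
  f @ F --> l -> ip (f t) y @[t --> F] --> ip l y.
Proof.
move=> /cvg_nrmP fl; apply/(@cvg_nrmP K^o) => e e0.
have y1 : 0 < nrm y + 1 by rewrite ltr_wpDl// nrm_ge0.
have := fl _ (divr_gt0 e0 y1); apply: filterS => t ht.
rewrite -ipBl (le_lt_trans (cauchy_schwarz _ _))//.
apply: (@le_lt_trans _ _ (nrm (l - f t) * (nrm y + 1))).
  by rewrite ler_wpM2l ?nrm_ge0// lerDl.
by rewrite -ltr_pdivlMr.
Qed.

Lemma multiplier1 x : mul (fun=> 1) x = x.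
Proof.
apply: coef_inj => k.
rewrite (ip_multiplier (M := 1)) ?of_real1 ?mul1r// => j.
by rewrite normr1.
Qed.

Lemma expansion_cvg x : expansion n (fun k => coef x k) @[n --> \oo] --> x.
Proof.
have h : truncated (fun=> 1) x n @[n --> \oo] --> mul (fun=> 1) x.
  by apply: (multiplier_cvg (M := 1)) => j; rewrite normr1.
rewrite -{2}[x]multiplier1; apply: cvg_trans h; apply: near_eq_cvg; apply: nearW => n.
by rewrite /truncated; apply: eq_bigr => k _; rewrite of_real1 mul1r.
Qed.

Section Domain.
Variables (domA : set H) (A : H -> H) (lam : nat -> R).
Hypothesis hA : unbounded_positive_selfadjoint ip domA A.
Hypothesis heig : forall k : nat, domA (v k) /\ A (v k) = rc (lam k) *: v k.

Lemma coef_operator x k : domA x -> coef (A x) k = rc (lam k) * coef x k.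
Proof.
move=> Dx; have [dk Ak] := heig k.
have := (upsa_selfadjoint hA x (A x)).1 (conj Dx erefl) (v k) dk.
rewrite Ak ipZl => h; rewrite (ipC (A x)) -h conj_scalarM conj_of_real.
by rewrite -ipC.
Qed.

(** Self-adjointness makes the domain maximal: testing against the partial sums
    of the expansions of [x] and [y] is enough to identify the graph of [A]. *)
Lemma domain_of_coef x y : (forall k, coef y k = rc (lam k) * coef x k) ->
  domA x /\ A x = y.
Proof.
move=> xy; apply/(upsa_selfadjoint hA) => z Dz.
rewrite ipC [RHS]ipC; congr cj.
have c1 : ip (expansion n (fun k => coef x k)) (A z) @[n --> \oo] --> ip x (A z).
  by apply: ip_cvg; exact: expansion_cvg.
have c2 : ip (expansion n (fun k => coef y k)) z @[n --> \oo] --> ip y z.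
  by apply: ip_cvg; exact: expansion_cvg.
apply: (cvg_unique _ c1) => //; apply: cvg_trans c2; apply: near_eq_cvg.
apply: nearW => n; rewrite /expansion !ip_suml; apply: eq_bigr => k _.
rewrite !ipZl xy (ipC _ (A z)) coef_operator// conj_scalarM conj_of_real -ipC.
by rewrite mulrA (mulrC (rc _)).
Qed.

End Domain.

(** The points of [0, T] on the left of [t] accumulate at [t], even for t = T. *)
Lemma proper_within (T t : R) : 0 < t <= T -> ProperFilter (within `[0, T] t^').
Proof.
move=> /andP[t0 tT]; split; last exact: within_filter.
rewrite /within/= => h.
have h' : \forall s \near t^'-, `[0, T]%classic s -> False.
  have : \forall s \near t^', `[0, T]%classic s -> False by exact: h.
  rewrite /at_left /dnbhs !near_withinE; apply: filterS => s hs st.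
  by apply: hs; rewrite lt_eqF.
near t^'- => s.
suff : False by [].
have : `[0, T]%classic s -> False by near: s.
apply; rewrite /= in_itv/=; apply/andP; split.
  by near: s; apply: filterS (nbhs_left_gt t0) => s /ltW.
by apply: le_trans tT; apply: ltW; near: s; exact: nbhs_left_lt.
Unshelve. all: by end_near. Qed.

Lemma near_within (T t : R) : 0 < t <= T ->
  \forall s \near within `[0, T] t^', [/\ t / 2 < s, 0 < s <= T & s != t].
Proof.
move=> /andP[t0 tT].
suff : \forall s \near t^', `[0, T]%classic s -> [/\ t / 2 < s, 0 < s <= T & s != t].
  by [].
have h2 : t / 2 < t by lra.
rewrite /dnbhs near_withinE; apply: filterS (lt_nbhsr h2) => s ts st.
rewrite /= in_itv/= => /andP[_ sT]; split=> //; rewrite sT andbT; lra.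
Qed.

(** The mean value theorem bounds the difference quotients of all modes at once,
    so that the limit can be taken mode by mode. *)
Lemma diff_quotient_multiplier (f : nat -> R -> R) (M : R -> R) (C T t : R) (x : H) (w : R -> H) :
  0 < t <= T -> 0 <= C -> (forall k c, 0 < c -> derivable (f k) c 1) ->
  (forall k c, 0 < c -> `|f k c| <= M c) ->
  (forall k c, 0 < c -> `|derive1 (f k) c| <= C / c) ->
  (forall s, 0 < s <= T -> w s = mul (f^~ s) x) ->
  diff_quotient w t s @[s --> within `[0, T] t^'] --> mul (fun k => derive1 (f k) t) x.
Proof.
move=> tT C0 fd fM dC wE; have /andP[t0 _] := tT.
have FF := proper_within tT.
have c : mul (fun k => (s - t)^-1 * (f k s - f k t)) x @[s --> within `[0, T] t^']
    --> mul (fun k => derive1 (f k) t) x.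
  apply: (multiplier_continuous (M := 2 * C / t)).
  - move=> k; have h := cvg_quotient (fd k t t0).
    by apply: cvg_within_filter; exact: h.
  - apply: filterS (near_within tT) => s [ts _ st] k.
    by apply: quotient_bound => //; [exact: fd|exact: dC|exact: ltW].
  - move=> k; apply: le_trans (dC k t t0) _; rewrite ler_pM2r ?invr_gt0//; lra.
apply: cvg_trans c; apply: near_eq_cvg; apply: filterS (near_within tT).
move=> s [ts sT st]; have /andP[s0 _] := sT.
rewrite /diff_quotient (wE s)// (wE t)//.
apply: coef_inj => k.
rewrite (ip_multiplier (M := 2 * C / t)).
  rewrite ipZl ipBl (ip_multiplier _ _ (fun k => fM k _ s0)).
  rewrite (ip_multiplier _ _ (fun k => fM k _ t0)).
  by rewrite of_realM of_realB -mulrBl mulrA.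
by move=> j; apply: quotient_bound => //; [exact: fd|exact: dC|exact: ltW].
Qed.

Lemma derive_upto_multiplier (f : nat -> R -> R) (M : R -> R) (C T t : R) (x : H) (w : R -> H) :
  0 < t <= T -> 0 <= C -> (forall k c, 0 < c -> derivable (f k) c 1) ->
  (forall k c, 0 < c -> `|f k c| <= M c) ->
  (forall k c, 0 < c -> `|derive1 (f k) c| <= C / c) ->
  (forall s, 0 < s <= T -> w s = mul (f^~ s) x) ->
  derivable_upto T w t /\ derive_upto T w t = mul (fun k => derive1 (f k) t) x.
Proof.
move=> tT C0 fd fM dC wE; have h := diff_quotient_multiplier tT C0 fd fM dC wE.
have FF := proper_within tT.
split; first by apply/cvg_ex; eexists; exact: h.
exact: cvg_lim h.
Qed.

Lemma continuous_multiplier (f : nat -> R -> R) (C T t : R) (x : H) (w : R -> H) :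
  0 < t < T -> 0 <= C -> (forall k, {for t, continuous (f k)}) ->
  (forall k c, 0 < c -> `|f k c| <= C / c) ->
  (forall s, 0 < s < T -> w s = mul (f^~ s) x) ->
  w s @[s --> t] --> w t.
Proof.
move=> tT C0 fc fC wE; have /andP[t0 tlT] := tT.
have t2 : t / 2 < t by lra.
have c : mul (f^~ s) x @[s --> t] --> mul (f^~ t) x.
  apply: (multiplier_continuous (M := 2 * C / t)) => //.
  - apply: filterS (lt_nbhsr t2) => s s0 k.
    have s00 : 0 < s by apply: lt_trans s0; rewrite divr_gt0.
    apply: le_trans (fC k s s00) _; rewrite ler_pdivrMr// mulrAC ler_pdivlMr//.
    rewrite [leRHS](_ : _ = C * (2 * s)); last by ring.
    by rewrite ler_wpM2l//; lra.
  - move=> k; apply: le_trans (fC k t t0) _; rewrite ler_pM2r ?invr_gt0//; lra.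
have -> : w t = mul (f^~ t) x by exact: wE.
apply: cvg_trans c; apply: near_eq_cvg.
by apply: filterS2 (lt_nbhsr t0) (lt_nbhsl tlT) => s s0 sT; apply/esym/wE; rewrite s0.
Qed.


(** * Multiplier families that solve the equation *)

Variables (domA : set H) (A : H -> H) (lam : nat -> R).
Hypothesis hA : unbounded_positive_selfadjoint ip domA A.
Hypothesis heig : forall k : nat, domA (v k) /\ A (v k) = rc (lam k) *: v k.
Hypothesis lam_gt0 : forall k, 0 < lam k.
Variables (T gamma alpha : R).
Hypotheses (T_gt0 : 0 < T) (gamma_gt0 : 0 < gamma) (alpha01 : 0 < alpha < 1).
Variable B : R -> R -> R.
Hypothesis hB : forall l : R, 0 < l -> scalar_cauchy gamma alpha l (B l).

Lemma mode_cauchy k : scalar_cauchy gamma alpha (lam k) (B (lam k)).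
Proof. exact: hB. Qed.

Local Notation sfp := (scalar_frac_primitive alpha).

Lemma mode_norm_le1 k t : 0 <= t -> `|B (lam k) t| <= 1.
Proof.
move=> t0; rewrite ger0_norm ?(ltW (sc_gt0 gamma_gt0 alpha01 (lam_gt0 k) (mode_cauchy k) t0))//.
exact: (sc_le1 gamma_gt0 alpha01 (lam_gt0 k) (mode_cauchy k)).
Qed.

Lemma mode_operator_ge0 k t : 0 <= t -> 0 <= lam k * B (lam k) t.
Proof.
move=> t0; apply: mulr_ge0; apply: ltW; first exact: lam_gt0.
exact: (sc_gt0 gamma_gt0 alpha01 (lam_gt0 k) (mode_cauchy k)).
Qed.

Lemma mode_operator_norm k t : 0 < t -> `|lam k * B (lam k) t| <= 1 / t.
Proof.
move=> t0; rewrite (ger0_norm (mode_operator_ge0 k (ltW t0))) div1r.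
exact: (sc_le_inv gamma_gt0 alpha01 (lam_gt0 k) (mode_cauchy k)).
Qed.

Lemma mode_derive_norm k t : 0 < t -> `|derive1 (B (lam k)) t| <= 2 / t.
Proof. exact: (sc_derive_norm gamma_gt0 alpha01 (lam_gt0 k) (mode_cauchy k)). Qed.

Lemma mode_frac_norm k t : 0 < t -> `|lam k * sfp (B (lam k)) t| <= gamma^-1.
Proof.
move=> t0; have /andP[h0 h1] :=
  sc_frac_primitive_bound gamma_gt0 alpha01 (lam_gt0 k) (mode_cauchy k) t0.
by rewrite ger0_norm.
Qed.

Lemma mode_frac_derive k t : 0 < t ->
  derivable (fun s => lam k * sfp (B (lam k)) s) t 1 /\
  derive1 (fun s => lam k * sfp (B (lam k)) s) t = lam k * derive1 (sfp (B (lam k))) t.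
Proof.
move=> t0; apply: derivable_of_quotient.
have h : lam k * ((s - t)^-1 * (sfp (B (lam k)) s - sfp (B (lam k)) t)) @[s --> t^']
    --> lam k * derive1 (sfp (B (lam k))) t.
  apply: cvgM; first exact: cvg_cst.
  by apply: cvg_quotient; exact: sc_frac_derivable (mode_cauchy k) _ t0.
apply: cvg_trans h; apply: near_eq_cvg; apply: nearW => s /=.
by rewrite -mulrBr mulrCA.
Qed.

Lemma omega_mode_integral k t : 0 < t ->
  \int[mu]_(s in `]0, t[) (omega (1 - alpha) (t - s) * (lam k * B (lam k) s)) =
  lam k * sfp (B (lam k)) t.
Proof.
move=> t0; rewrite /scalar_frac_primitive -RintegralZl//.
  by apply: eq_Rintegral => s _; rewrite mulrCA.
apply: (integrable_omega_conv (M := 1) gamma_gt0 alpha01) => //.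
  exact: (@measurable_sc _ _ _ _ _ (mode_cauchy k) t).
by move=> s /andP[s0 _]; apply: mode_norm_le1; exact: ltW.
Qed.

Section Solution.
Variables (x : H) (w : R -> H).
Hypothesis wE : forall t, 0 <= t <= T -> w t = mul (fun k => B (lam k) t) x.

Lemma sol_within_continuous : {within `[0, T], continuous w}.
Proof.
apply/subspace_continuousP => t tT.
have tT' : 0 <= t <= T by move: tT; rewrite /= in_itv.
have c : mul (fun k => B (lam k) s) x @[s --> within `[0, T] (nbhs t)] -->
    mul (fun k => B (lam k) t) x.
  apply: (multiplier_continuous (M := 1)).
  - move=> k; have /subspace_continuousP := @sc_continuous_on _ _ _ _ _ (mode_cauchy k) T.
    by apply.
  - rewrite near_withinE; apply: nearW => s; rewrite /= in_itv/= => /andP[s0 _] k.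
    exact: mode_norm_le1.
  - by move=> k; apply: mode_norm_le1; case/andP : tT'.
suff : w s @[s --> within `[0, T] (nbhs t)] --> w t by [].
rewrite wE//; apply: cvg_trans c; apply: near_eq_cvg; rewrite near_withinE.
by apply: nearW => s; rewrite /= in_itv/= => sT; rewrite wE.
Qed.

Lemma sol_operator t : 0 < t <= T ->
  domA (w t) /\ A (w t) = mul (fun k => lam k * B (lam k) t) x.
Proof.
move=> /andP[t0 tT]; apply: (domain_of_coef hA heig) => k.
rewrite wE ?(ltW t0)// (ip_multiplier _ _ (fun k => mode_norm_le1 k (ltW t0))).
rewrite (ip_multiplier _ _ (fun k => mode_operator_norm k t0)).
by rewrite of_realM mulrA.
Qed.

Lemma sol_derive t : 0 < t <= T ->
  derivable_upto T w t /\ derive_upto T w t = mul (fun k => derive1 (B (lam k)) t) x.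
Proof.
move=> tT; apply: (derive_upto_multiplier (M := fun=> 1) (C := 2)) => //.
- by move=> k c c0; exact: sc_derivable (mode_cauchy k) _ c0.
- by move=> k c /ltW; exact: mode_norm_le1.
- by move=> k c c0; exact: mode_derive_norm.
- by move=> s /andP[s0 sT]; apply: wE; rewrite ltW.
Qed.

Definition conv_mode (t : R) (k : nat) (s : R) : R :=
  omega (1 - alpha) (t - s) * (lam k * B (lam k) s).

(** The bound does not depend on [k]: by [sc_le_powR] the large factor [lam k] is
    absorbed by the decay of the mode. *)
Lemma conv_mode_bound t k s : 0 < s ->
  0 <= conv_mode t k s <= Gamma (1 - alpha) / gamma *
    (omega (1 - alpha) (t - s) * s `^ (alpha - 1)).
Proof.
move=> s0; have o0 := omega_ge0 alpha01 (t - s).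
rewrite /conv_mode mulr_ge0 ?mode_operator_ge0 ?(ltW s0)//= [leRHS]mulrCA.
apply: ler_wpM2l => //.
exact: (sc_le_powR gamma_gt0 alpha01 (lam_gt0 k) (mode_cauchy k)).
Qed.

Lemma conv_mode_norm t k s : 0 < s ->
  `|conv_mode t k s| <= Gamma (1 - alpha) / gamma *
    (omega (1 - alpha) (t - s) * s `^ (alpha - 1)).
Proof. by move=> s0; have /andP[h0 h1] := conv_mode_bound t k s0; rewrite ger0_norm. Qed.

Lemma frac_integrand_multiplier t s : 0 < s < t -> t <= T ->
  frac_integrand alpha (A \o w) t s = mul ((conv_mode t)^~ s) x.
Proof.
move=> /andP[s0 st] tT.
have sT : 0 < s <= T by rewrite s0 (le_trans (ltW st)).
rewrite /frac_integrand /= (sol_operator sT).2; apply: coef_inj => k.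
rewrite (ip_multiplier _ _ (fun k => conv_mode_norm t k s0)) ipZl.
rewrite (ip_multiplier _ _ (fun k => mode_operator_norm k s0)).
by rewrite mulrA -of_realM.
Qed.

Lemma integrable_conv_mode t k : 0 < t ->
  mu.-integrable `]0, t[ (EFin \o conv_mode t k).
Proof.
move=> t0.
have mitv : measurable (`]0, t[ : set (measurableTypeR R)) by exact: measurable_itv.
have := integrableZl mitv (lam k) (integrable_omega_conv (M := 1) gamma_gt0 alpha01
  t0 (@measurable_sc _ _ _ _ _ (mode_cauchy k) t)
  (fun s st => mode_norm_le1 k (ltW (andP st).1))).
by apply: eq_integrable => // s _; rewrite /= -EFinM mulrCA.
Qed.

Lemma sol_bochner t : 0 < t <= T ->
  is_bochner_integral `]0, t[ (frac_integrand alpha (A \o w) t)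
    (mul (fun k => lam k * sfp (B (lam k)) t) x).
Proof.
move=> /andP[t0 tT]; set C := Gamma (1 - alpha) / gamma.
have mitv : measurable (`]0, t[ : set (measurableTypeR R)) by exact: measurable_itv.
have := @bochner_multiplier `]0, t[ (conv_mode t)
  (fun s => C * (omega (1 - alpha) (t - s) * s `^ (alpha - 1))) x mitv.
have -> : (fun k => \int[mu]_(s in `]0, t[) conv_mode t k s) =
    (fun k => lam k * sfp (B (lam k)) t).
  by apply/funext => k; exact: omega_mode_integral.
move=> bm; apply: is_bochner_integral_eq (bm _ _ _ _).
- by move=> s; rewrite /= in_itv/= => st; rewrite frac_integrand_multiplier.
- by rewrite lebesgue_measure_itv/= lte_fin t0 oppr0 adde0 ltry.
- by move=> k; apply/measurable_EFinP; exact: (measurable_int mu (integrable_conv_mode k t0)).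
- have := integrableZl mitv C (integrable_omega_powR alpha01 t0).
  by apply: eq_integrable => // s _; rewrite /= EFinM.
- by move=> k s; rewrite /= in_itv/= => /andP[s0 _]; exact: conv_mode_bound.
Qed.

Lemma sol_frac_primitive t : 0 < t <= T ->
  frac_primitive alpha (A \o w) t = mul (fun k => lam k * sfp (B (lam k)) t) x.
Proof.
move=> tT; have /andP[t0 tlT] := tT.
have mitv : measurable (`]0, t[ : set (measurableTypeR R)) by exact: measurable_itv.
have : is_bochner_integral `]0, t[ (frac_integrand alpha (A \o w) t)
    (frac_primitive alpha (A \o w) t).
  apply: (@xgetPex _ 0 [set I | is_bochner_integral `]0, t[
    (frac_integrand alpha (A \o w) t) I]).
  by exists (mul (fun k => lam k * sfp (B (lam k)) t) x); exact: sol_bochner.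
move=> /(is_bochner_integral_eq (g := fun s => mul ((conv_mode t)^~ s) x)) bI.
have := bochner_multiplier_unique (D := `]0, t[) (h := conv_mode t)
  (G := fun s => Gamma (1 - alpha) / gamma *
    (omega (1 - alpha) (t - s) * s `^ (alpha - 1))) (C := gamma^-1) (x := x)
  mitv _ _ _ (bI _).
have -> : (fun k => \int[mu]_(s in `]0, t[) conv_mode t k s) =
    (fun k => lam k * sfp (B (lam k)) t).
  by apply/funext => k; exact: omega_mode_integral.
apply.
- by move=> k; exact: integrable_conv_mode.
- by move=> k s; rewrite /= in_itv/= => /andP[s0 _]; exact: conv_mode_norm.
- by move=> k; rewrite (omega_mode_integral k t0); exact: mode_frac_norm.
- by move=> s; rewrite /= in_itv/= => st; rewrite frac_integrand_multiplier.
Qed.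

Lemma frac_constant_ge0 : 0 <= 3 / gamma.
Proof. by rewrite divr_ge0// ltW. Qed.

Lemma mode_frac_derive_norm k t : 0 < t ->
  `|lam k * derive1 (sfp (B (lam k))) t| <= 3 / gamma / t.
Proof.
move=> t0; rewrite -mulrA -invfM.
exact: (sc_frac_derive_norm gamma_gt0 alpha01 (lam_gt0 k) (mode_cauchy k)).
Qed.

Lemma sol_frac_derive t : 0 < t <= T ->
  frac_derivable T alpha (A \o w) t /\
  frac_derive T alpha (A \o w) t = mul (fun k => lam k * derive1 (sfp (B (lam k))) t) x.
Proof.
move=> tT; have /andP[t0 _] := tT.
have [] := @derive_upto_multiplier
  (fun k s => lam k * sfp (B (lam k)) s) (fun=> gamma^-1) (3 / gamma) T t x
  (frac_primitive alpha (A \o w)) tT frac_constant_ge0.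
- by move=> k c c0; exact: (mode_frac_derive k c0).1.
- by move=> k c c0; exact: mode_frac_norm.
- by move=> k c c0; rewrite (mode_frac_derive k c0).2; exact: mode_frac_derive_norm.
- by move=> s sT; exact: sol_frac_primitive.
move=> d dE; split.
  split=> //; by exists (mul (fun k => lam k * sfp (B (lam k)) t) x); exact: sol_bochner.
rewrite /frac_derive dE; congr (multiplier _ x).
by apply/funext => k; rewrite (mode_frac_derive k t0).2.
Qed.

Lemma sol_continuity :
  [/\ {in `]0, T[, continuous (derive_upto T w)},
      {in `]0, T[, continuous (A \o w)}
    & {in `]0, T[, continuous (frac_derive T alpha (A \o w))}].
Proof.
split=> t; rewrite in_itv/= => tT; have /andP[t0 _] := tT.
- apply: (@continuous_multiplier
    (fun k s => derive1 (B (lam k)) s) 2 T t x) => //.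
  + by move=> k; exact: (sc_derive_continuous gamma_gt0 alpha01 (lam_gt0 k) (mode_cauchy k)).
  + by move=> k c c0; exact: mode_derive_norm.
  + by move=> s /andP[s0 sT]; apply: (sol_derive _).2; rewrite s0 ltW.
- apply: (@continuous_multiplier
    (fun k s => lam k * B (lam k) s) 1 T t x) => //.
  + move=> k; apply: cvgM; first exact: cvg_cst.
    exact: (sc_continuous_at (mode_cauchy k) t0).
  + by move=> k c c0; exact: mode_operator_norm.
  + by move=> s /andP[s0 sT]; apply: (sol_operator _).2; rewrite s0 ltW.
- apply: (@continuous_multiplier
    (fun k s => lam k * derive1 (sfp (B (lam k))) s) (3 / gamma) T t x) => //.
  + exact: frac_constant_ge0.
  + by move=> k; exact: (sc_frac_derive_continuous gamma_gt0 alpha01 (lam_gt0 k) (mode_cauchy k)).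
  + by move=> k c c0; exact: mode_frac_derive_norm.
  + by move=> s /andP[s0 sT]; apply: (sol_frac_derive _).2; rewrite s0 ltW.
Qed.

Lemma sol_equation_modes t : 0 < t <= T ->
  derive_upto T w t + (A (w t) + rc gamma *: frac_derive T alpha (A \o w) t) = 0.
Proof.
move=> tT; have /andP[t0 _] := tT.
rewrite (sol_derive tT).2 (sol_operator tT).2 (sol_frac_derive tT).2.
apply: coef_inj => k; rewrite ip0l !ipDl ipZl.
rewrite (ip_multiplier _ _
  (fun k => mode_derive_norm k t0)).
rewrite (ip_multiplier _ _ (fun k => mode_operator_norm k t0)).
rewrite (ip_multiplier _ _ (fun k => mode_frac_derive_norm k t0)).
rewrite mulrA -!mulrDl -of_realM -!of_realD.
rewrite (_ : derive1 _ t + _ = 0) ?of_real0 ?mul0r//.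
have := sc_equation (mode_cauchy k) t0.
by rewrite mulrDr mulrCA.
Qed.

Lemma sol_estimate t : 0 < t <= T ->
  nrm (derive_upto T w t) ^+ 2 + nrm (A (w t)) ^+ 2 +
    nrm (frac_derive T alpha (A \o w) t) ^+ 2 <=
  (5 + (3 / gamma) ^+ 2) * t ^- 2 * nrm x ^+ 2.
Proof.
move=> tT; have /andP[t0 _] := tT.
rewrite (sol_derive tT).2 (sol_operator tT).2 (sol_frac_derive tT).2.
have sq (a : R) (y : H) : nrm y <= a / t * nrm x -> nrm y ^+ 2 <= a ^+ 2 * (t ^- 2 * nrm x ^+ 2).
  move=> h; rewrite mulrA -exprVn -!exprMn ler_sqr ?nnegrE ?nrm_ge0//.
  exact: le_trans (nrm_ge0 _) h.
set c := 3 / gamma; set r := t ^- 2.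
rewrite [leRHS](_ : _ = 2 ^+ 2 * (r * nrm x ^+ 2) + 1 ^+ 2 * (r * nrm x ^+ 2) +
  c ^+ 2 * (r * nrm x ^+ 2)); last by ring.
apply: lerD; first apply: lerD.
- apply: sq; apply: multiplier_le => k.
  exact: mode_derive_norm.
- by apply: sq; apply: multiplier_le => k; exact: mode_operator_norm.
- by apply: sq; apply: multiplier_le => k; exact: mode_frac_derive_norm.
Qed.

End Solution.


(** * Solutions are determined by their initial values *)

Lemma pairing_operator c k y : domA y ->
  pairing c k (A y) = lam k * pairing c k y.
Proof.
move=> Dy; rewrite /pairing !ipZr (coef_operator hA heig)//.
by rewrite mulrCA real_part_ofM.
Qed.

Lemma pairing_quotient c k (f : R -> H) t : nrm c <= 1 -> 0 < t < T ->
  derivable_upto T f t ->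
  (s - t)^-1 * (pairing c k (f s) - pairing c k (f t)) @[s --> t^'] -->
    pairing c k (derive_upto T f t).
Proof.
move=> c1 /andP[t0 tT] d.
have h : pairing c k (diff_quotient f t s) @[s --> within `[0, T] t^'] -->
    pairing c k (derive_upto T f t).
  apply: (functional_cvg (pairingD c k) (pairingZ c k)) => //.
  by move=> x; exact: (pairing_le).
have E s : pairing c k (diff_quotient f t s) =
    (s - t)^-1 * (pairing c k (f s) - pairing c k (f t)).
  rewrite /diff_quotient pairingZ; congr (_ * _).
  by rewrite (functionalB (pairingD c k) (pairingZ c k)).
have near_in : \forall s \near t^', `[0, T]%classic s.
  apply: nbhs_dnbhs; apply: filterS2 (lt_nbhsr t0) (lt_nbhsl tT) => s s0 sT.
  by rewrite /= in_itv/= !ltW.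
move=> P /h hP.
have {hP} : \forall s \near t^', `[0, T]%classic s -> P (pairing c k (diff_quotient f t s)).
  exact: hP.
by move=> hP; apply: filterS2 near_in hP => s sT /(_ sT); rewrite /= E.
Qed.

Section Solution.
Variables (t0 beta : R) (psi : H) (w : R -> H).
Hypothesis hw : is_solution domA A T gamma alpha t0 beta psi w.

Section Component.
Variables (c : K) (k : nat).
Hypothesis c1 : nrm c <= 1.
Local Notation u := (fun t => pairing c k (w t)).

Lemma component_continuous : {within `[0, T], continuous u}.
Proof.
move=> t; apply: (functional_cvg (pairingD c k) (pairingZ c k)).
  by move=> x; exact: (pairing_le).
exact: (sol_continuous hw).
Qed.

Lemma component_bounded : exists M : R, forall t : R, 0 <= t <= T -> `|u t| <= M.
Proof. exact: continuous_itv_bounded component_continuous. Qed.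

Lemma component_frac_primitive t : 0 < t <= T ->
  pairing c k (frac_primitive alpha (A \o w) t) =
  lam k * scalar_frac_primitive alpha u t.
Proof.
move=> tT; have /andP[tp tlT] := tT.
have [[I hI] _] := sol_frac_derivable hw tT.
have mitv : measurable (`]0, t[ : set (measurableTypeR R)) by exact: measurable_itv.
have bJ : is_bochner_integral `]0, t[ (frac_integrand alpha (A \o w) t)
    (frac_primitive alpha (A \o w) t).
  apply: (@xgetPex _ 0 [set I | is_bochner_integral `]0, t[
    (frac_integrand alpha (A \o w) t) I]); by exists I.
have E s : 0 < s < t -> pairing c k (frac_integrand alpha (A \o w) t s) =
    lam k * (omega (1 - alpha) (t - s) * u s).
  move=> /andP[s0 st]; rewrite /frac_integrand pairingZ /= pairing_operator 1?mulrCA//.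
  by apply: (sol_dom hw); rewrite s0 (le_trans (ltW st)).
have [M uM] := component_bounded.
have iu : mu.-integrable `]0, t[ (EFin \o (fun s => omega (1 - alpha) (t - s) * u s)).
  apply: (integrable_omega_conv (M := M) gamma_gt0 alpha01) => //.
    apply: subspace_continuous_measurable_fun; first exact: measurable_itv.
    apply: continuous_subspaceW component_continuous => s; rewrite /= !in_itv/=.
    by move=> /andP[s0 st]; rewrite ltW//= (le_trans (ltW st)).
  by move=> s /andP[s0 st]; apply: uM; rewrite ltW//= (le_trans (ltW st)).
have iu' := integrableZl mitv (lam k) iu.
rewrite (bochner_functional (pairingD c k) (pairingZ c k) _ mitv _ bJ).
- rewrite /scalar_frac_primitive -RintegralZl//.
  by apply: eq_Rintegral => s; rewrite inE/= in_itv/= => /E ->.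
- by move=> x; exact: (pairing_le).
- apply: eq_integrable iu' => // s; rewrite inE/= in_itv/= => /E ->.
  by rewrite -EFinM.
Qed.

Lemma component_derive t : 0 < t < T ->
  derivable u t 1 /\ derive1 u t = pairing c k (derive_upto T w t).
Proof.
move=> tT; apply: derivable_of_quotient; apply: pairing_quotient => //.
by apply: (sol_derivable hw); case/andP : tT => -> /ltW.
Qed.

Lemma component_frac_derive t : 0 < t < T ->
  derivable (scalar_frac_primitive alpha u) t 1 /\
  derive1 (scalar_frac_primitive alpha u) t =
    (lam k)^-1 * pairing c k (frac_derive T alpha (A \o w) t).
Proof.
move=> tT; have /andP[tp tlT] := tT; apply: derivable_of_quotient.
have l0 : lam k != 0 by rewrite gt_eqF.
have tT' : 0 < t <= T by rewrite tp ltW.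
have h : (s - t)^-1 * (pairing c k (frac_primitive alpha (A \o w) s) -
    pairing c k (frac_primitive alpha (A \o w) t)) @[s --> t^'] -->
    pairing c k (frac_derive T alpha (A \o w) t).
  by apply: pairing_quotient => //; have [] := sol_frac_derivable hw tT'.
have {}h := cvgM (cvg_cst (lam k)^-1) h.
apply: cvg_trans (h _ _); apply: near_eq_cvg; apply: nbhs_dnbhs.
apply: filterS2 (lt_nbhsr tp) (lt_nbhsl tlT) => s s0 sT /=.
have sT' : 0 < s <= T by rewrite s0 ltW.
rewrite (component_frac_primitive sT') (component_frac_primitive tT') -mulrBr mulrCA; congr (_ * _).
by rewrite mulrA mulVf// mul1r.
Qed.

(** The component of a solution along [pairing c k] solves the scalar problem for
    [lam k] on ]0, T[, with an arbitrary initial value. *)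
Lemma component_mode t : 0 <= t <= T -> u t = u 0 * B (lam k) t.
Proof.
apply: (sc_unique gamma_gt0 alpha01 (lam_gt0 k) (hB (lam_gt0 k)) T_gt0).
- exact: component_continuous.
- by move=> s /component_derive[].
- by move=> s /component_frac_derive[].
- move=> s sT; rewrite (component_derive sT).2 (component_frac_derive sT).2.
  have sT' : 0 < s <= T by case/andP : sT => -> /ltW.
  have := congr1 (pairing c k) (sol_equation hw sT').
  rewrite !pairingD pairingZ (pairing_operator _ _ (sol_dom hw sT')).
  rewrite (functional0 (pairingZ c k)) => h.
  rewrite mulrDr [lam k * (gamma * _)](_ : _ = gamma * (lam k * (lam k)^-1 *
    pairing c k (frac_derive T alpha (A \o w) s))); last by ring.
  by rewrite mulfV ?gt_eqF// mul1r.
Qed.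

End Component.

Lemma solution_modes t : 0 <= t <= T -> w t = mul (fun k => B (lam k) t) (w 0).
Proof.
move=> tT; apply: pairing_inj => c k c1.
have mM j : `|B (lam j) t| <= 1.
  by case/andP : tT => tp _; exact: mode_norm_le1.
by rewrite (pairing_multiplier _ _ _ mM) (component_mode k c1 tT) mulrC.
Qed.

End Solution.

(** As the evolution is determined mode by mode, the nonlocal condition is a
    diagonal equation for the initial value. *)
Lemma solution_iff t0 beta psi w : 0 < t0 <= T ->
  is_solution domA A T gamma alpha t0 beta psi w <->
  (forall t, 0 <= t <= T -> w t = mul (fun k => B (lam k) t) (w 0)) /\
  forall k, rc (B (lam k) t0 - beta) * coef (w 0) k = coef psi k.
Proof.
move=> t0T; have /andP[t00 t0lT] := t0T.
have t0T' : 0 <= t0 <= T by rewrite ltW.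
have nl : (forall t, 0 <= t <= T -> w t = mul (fun k => B (lam k) t) (w 0)) ->
    w t0 = rc beta *: w 0 + psi <->
    forall k, rc (B (lam k) t0 - beta) * coef (w 0) k = coef psi k.
  move=> wE; have cw k : coef (w t0) k = rc (B (lam k) t0) * coef (w 0) k.
    rewrite wE//; apply: (ip_multiplier (M := 1)) => j.
    by apply: mode_norm_le1; exact: ltW.
  split=> [h k|h].
    by rewrite of_realB mulrBl -cw h ipDl ipZl addrAC subrr add0r.
  apply: coef_inj => k; rewrite ipDl ipZl cw -h of_realB mulrBl.
  by rewrite addrC subrK.
split=> [hw|[wE hk]].
  have wE := solution_modes hw; split=> //; apply/(nl wE); exact: (sol_nonlocal hw).
have [d1 d2 d3] := sol_continuity wE.
split=> //.
- exact: (sol_within_continuous wE).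
- by move=> t tT; exact: (sol_operator wE tT).1.
- by move=> t tT; exact: (sol_derive wE tT).1.
- move=> t tT.
  exact: (sol_frac_derive wE tT).1.
- move=> t tT.
  exact: (sol_equation_modes wE tT).
- by apply/nl.
Qed.


(** * The nonlocal condition *)

Lemma sums_to_multiplier (S : set nat) (m : nat -> R) (M : R) (x : H) :
  (forall k, `|m k| <= M) ->
  sums_to S (fun k => (rc (m k) * coef x k) *: v k)
    (mul (fun k => if k \in S then m k else 0) x).
Proof.
move=> mM; have M0 : 0 <= M by exact: le_trans (mM 0%N).
have mS k : `|if k \in S then m k else 0| <= M by case: ifP => // _; rewrite normr0.
have h := multiplier_cvg (x := x) mS.
apply: cvg_trans h; apply: near_eq_cvg; apply: nearW => n.
rewrite /truncated /expansion [RHS]big_mkcond; apply: eq_bigr => k _.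
by case: ifP => // _; rewrite of_real0 mul0r scale0r.
Qed.

Lemma coef_sums_to (S : set nat) (a : nat -> K) (x : H) k :
  sums_to S (fun k => a k *: v k) x -> coef x k = if k \in S then a k else 0.
Proof.
move=> h; apply: (ip_continuous h); exists k.+1 => // n /= kn.
rewrite ip_suml; under eq_bigr do rewrite ipZl hv.
rewrite big_mkcond (bigD1_seq k) ?mem_index_iota ?iota_uniq//= eqxx mulr1.
rewrite big1 ?addr0// => i /negbTE ik; by rewrite ik mulr0; case: ifP.
Qed.

Hypothesis lam_infty : lam k @[k --> \oo] --> +oo.
Variables (t0 beta : R).
Hypothesis t0T : 0 < t0 <= T.
Local Notation b k := (B (lam k) t0).
Local Notation Kset := (K0 B lam t0 beta).

(** Multiplier that solves the nonlocal condition for the initial value; its value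
    is 0 at the resonant modes, those of [Kset], because 0^-1 = 0. *)
Definition inverse_symbol (k : nat) : R := (b k - beta)^-1.

Lemma nonlocal_termE psi t : nonlocal_term ip v lam B t0 beta psi t =
  (fun k => (rc (inverse_symbol k * B (lam k) t) * coef psi k) *: v k).
Proof.
apply/funext => k; rewrite /nonlocal_term of_realM of_realV; congr (_ *: _).
by rewrite -mulrA mulrC.
Qed.

Lemma free_termE x t : free_term v lam B (fun k => coef x k) t =
  (fun k => (rc (B (lam k) t) * coef x k) *: v k).
Proof. by apply/funext => k; rewrite /free_term mulrC. Qed.

Lemma mode_lt1 k : 0 < b k < 1.
Proof.
have /andP[t00 _] := t0T; have Hk := hB (lam_gt0 k).
by rewrite (sc_gt0 gamma_gt0 alpha01 (lam_gt0 k) Hk) ?ltW//= (sc_lt1 gamma_gt0 alpha01 (lam_gt0 k) Hk).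
Qed.

(** By [sc_le_inv] the k-th mode is at most 1 / (lam k t0) at time [t0]. *)
Lemma mode_small (e : R) : 0 < e -> exists N, forall k, (N <= k)%N -> b k < e.
Proof.
move=> e0; have /andP[t00 _] := t0T.
have /cvgryPgt/(_ (t0 * e)^-1) [N _ hN] := lam_infty.
exists N => k Nk; have lk := hN k Nk.
have := sc_le_inv gamma_gt0 alpha01 (lam_gt0 k) (hB (lam_gt0 k)) t00.
rewrite -ler_pdivlMl ?lam_gt0// => /le_lt_trans; apply.
rewrite -invfM invf_plt ?posrE ?mulr_gt0 ?lam_gt0//.
by rewrite -ltr_pdivrMr// mulrC -invfM.
Qed.

Lemma Kset_finite : beta != 0 -> exists N, forall k, Kset k -> (k < N)%N.
Proof.
move=> b0; have e0 : 0 < `|beta| / 2 by rewrite divr_gt0// normr_gt0.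
have [N hN] := mode_small e0; exists N => k kK; rewrite ltnNge; apply/negP => Nk.
have := hN k Nk; have /andP[bk _] := mode_lt1 k; move: kK; rewrite /K0 /= => kK.
by move: bk; rewrite kK => bk; rewrite ger0_norm ?ltW//; lra.
Qed.

(** All but finitely many modes are smaller than |beta| / 2 at time [t0]. *)
Lemma inverse_symbol_bounded : beta != 0 ->
  exists M : R, 0 <= M /\ forall k, `|inverse_symbol k| <= M.
Proof.
move=> b0; have e0 : 0 < `|beta| / 2 by rewrite divr_gt0// normr_gt0.
have [N hN] := mode_small e0.
have S0 : 0 <= \sum_(0 <= k < N) `|inverse_symbol k| by exact: sumr_ge0.
exists (2 / `|beta| + \sum_(0 <= k < N) `|inverse_symbol k|); split.
  by rewrite addr_ge0// divr_ge0.
move=> k; have [Nk|kN] := leqP N k.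
  apply: (@le_trans _ _ (2 / `|beta|)); last by rewrite lerDl.
  have := hN k Nk; have /andP[bk _] := mode_lt1 k => bk2.
  have h : `|beta| / 2 <= `|b k - beta|.
    have := ler_normD (b k) (beta - b k); rewrite addrC subrK (ger0_norm (ltW bk)).
    rewrite (distrC beta); lra.
  rewrite normfV -[2 / _]invf_div lef_pV2 ?posrE//; exact: lt_le_trans h.
rewrite (bigD1_seq k) ?mem_index_iota ?iota_uniq//= addrCA lerDl addr_ge0//.
exact: sumr_ge0.
Qed.

Lemma inverse_symbolK k : ~ Kset k -> (b k - beta) * inverse_symbol k = 1.
Proof.
by move=> nK; rewrite mulfV// subr_eq0; apply/eqP => h; exact: nK.
Qed.

Lemma resonant_symbol0 k : Kset k -> inverse_symbol k = 0.
Proof. by rewrite /K0/= /inverse_symbol => ->; rewrite subrr invr0. Qed.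

Lemma inverse_symbol_modeB M : (forall k, `|inverse_symbol k| <= M) ->
  forall t k, 0 <= t -> `|inverse_symbol k * B (lam k) t| <= M.
Proof.
move=> dM t k tp; rewrite normrM -[leRHS]mulr1 ler_pM//.
exact: mode_norm_le1.
Qed.

Lemma mode_at0 k : B (lam k) 0 = 1.
Proof. exact: (sc_initial (hB (lam_gt0 k))). Qed.

Lemma multiplier_mode0 x : mul (fun k => B (lam k) 0) x = x.
Proof.
by rewrite -[RHS]multiplier1; congr (multiplier _ x);
  apply/funext => k; exact: mode_at0.
Qed.

Local Notation is_sol := (is_solution domA A T gamma alpha t0 beta).

Lemma solution_exists M psi : (forall k, `|inverse_symbol k| <= M) ->
  (forall k, Kset k -> coef psi k = 0) ->
  is_sol psi (fun t => mul (fun k => B (lam k) t) (mul inverse_symbol psi)).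
Proof.
move=> dM psi0; apply/(solution_iff beta psi _ t0T); rewrite multiplier_mode0; split=> // k.
rewrite (ip_multiplier _ _ dM) mulrA -of_realM.
have [kK|nK] := pselect (Kset k); last by rewrite inverse_symbolK// of_real1 mul1r.
by rewrite resonant_symbol0// mulr0 of_real0 mul0r psi0.
Qed.

Lemma solution_coef psi w k : is_sol psi w -> ~ Kset k ->
  coef (w 0) k = rc (inverse_symbol k) * coef psi k.
Proof.
move=> /(solution_iff beta psi _ t0T)[_ hk] nK.
by rewrite -hk mulrA -of_realM mulrC (mulrC (inverse_symbol k)) inverse_symbolK// of_real1 mulr1.
Qed.

Lemma solution_orthogonal psi w k : is_sol psi w -> Kset k -> coef psi k = 0.
Proof.
move=> /(solution_iff beta psi _ t0T)[_ hk]; rewrite /K0 /= => kK.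
by rewrite -hk kK subrr of_real0 mul0r.
Qed.

Lemma solution_modesE psi w t : is_sol psi w -> 0 <= t <= T ->
  w t = mul (fun k => B (lam k) t) (w 0).
Proof.
by move=> /(solution_iff beta psi _ t0T)[wE _]; exact: wE.
Qed.

Lemma mode_bound t : 0 <= t <= T -> forall k, `|B (lam k) t| <= 1.
Proof.
by move=> /andP[tp _] k; exact: mode_norm_le1.
Qed.

Lemma nonresonant_case M : (forall k, `|inverse_symbol k| <= M) ->
  Kset = set0 -> forall psi, exists w : R -> H,
  [/\ is_sol psi w,
      forall w' : R -> H, is_sol psi w' -> forall t : R, 0 <= t <= T -> w' t = w t
    & forall t : R, 0 <= t <= T ->
        sums_to setT (nonlocal_term ip v lam B t0 beta psi t) (w t)].
Proof.
move=> dM Kempty psi; have nK k : ~ Kset k by rewrite Kempty.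
have K0psi k : Kset k -> coef psi k = 0 by move/nK.
have sol := solution_exists dM K0psi.
exists (fun t => mul (fun k => B (lam k) t) (mul inverse_symbol psi)); split=> //.
  move=> w' hw' t tT; rewrite (solution_modesE hw' tT); congr (multiplier _ _).
  apply: coef_inj => k.
  by rewrite (solution_coef hw' (nK k)) (ip_multiplier _ _ dM).
move=> t tT; have /andP[tp _] := tT.
have dBM k := inverse_symbol_modeB dM k tp.
rewrite nonlocal_termE.
rewrite (_ : mul _ _ = mul (fun k => if k \in setT then inverse_symbol k * B (lam k) t else 0) psi).
  exact: sums_to_multiplier.
apply: coef_inj => k.
rewrite (ip_multiplier _ _ (mode_bound tT)) (ip_multiplier _ _ dM).
rewrite (ip_multiplier (M := M)); last by move=> j; rewrite in_setT.
by rewrite in_setT of_realM mulrA (mulrC (rc (B _ _))).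
Qed.

Lemma resonant_case M : (forall k, `|inverse_symbol k| <= M) -> forall psi,
  ((exists w : R -> H, is_sol psi w) <-> (forall k, Kset k -> coef psi k = 0)) /\
  ((forall k, Kset k -> coef psi k = 0) ->
    forall w : R -> H, is_sol psi w <->
      exists h : nat -> K, forall t : R, 0 <= t <= T ->
        exists x y : H,
          [/\ sums_to (~` Kset) (nonlocal_term ip v lam B t0 beta psi t) x,
              sums_to Kset (free_term v lam B h t) y & w t = x + y]).
Proof.
move=> dM psi; have M0 : 0 <= M by exact: le_trans (dM 0%N).
split.
  split=> [[w hw] k|psi0]; first exact: solution_orthogonal hw.
  by eexists; exact: solution_exists psi0.
move=> psi0 w; split=> [hw|[h hh]].
  exists (fun k => coef (w 0) k) => t tT; have /andP[tp _] := tT.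
  have dBM k := inverse_symbol_modeB dM k tp.
  exists (mul (fun k => if k \in ~` Kset then inverse_symbol k * B (lam k) t else 0) psi).
  exists (mul (fun k => if k \in Kset then B (lam k) t else 0) (w 0)); split.
  - by rewrite nonlocal_termE; exact: sums_to_multiplier.
  - by rewrite free_termE; apply: sums_to_multiplier; exact: mode_bound.
  rewrite (solution_modesE hw tT); apply: coef_inj => k; rewrite ipDl.
  rewrite (ip_multiplier _ _ (mode_bound tT)).
  rewrite (ip_multiplier (M := M)); last first.
    by move=> j; case: ifP => // _; rewrite normr0.
  rewrite (ip_multiplier (M := 1)); last first.
    by move=> j; case: ifP => _; [exact: mode_bound|rewrite normr0].
  rewrite in_setC; have [kK|nK] := boolP (k \in Kset).
    by rewrite /= of_real0 mul0r add0r.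
  rewrite /= of_real0 mul0r addr0 (solution_coef hw); last by rewrite notin_setE in nK.
  by rewrite of_realM mulrA (mulrC (rc (B _ _))).
have cw t k : 0 <= t <= T -> coef (w t) k = rc (B (lam k) t) *
    (if k \in Kset then h k else rc (inverse_symbol k) * coef psi k).
  move=> /hh[x [y [hx hy ->]]]; rewrite ipDl.
  move: hx; rewrite nonlocal_termE => /coef_sums_to ->; rewrite (coef_sums_to k hy) in_setC.
  case: (k \in Kset) => /=; first by rewrite add0r mulrC.
  by rewrite addr0 of_realM mulrA (mulrC (rc (B _ _))).
have c0 k : coef (w 0) k = if k \in Kset then h k else rc (inverse_symbol k) * coef psi k.
  by rewrite cw ?lexx ?ltW// mode_at0 of_real1 mul1r.
apply/(solution_iff beta psi _ t0T); split=> [t tT|k].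
  apply: coef_inj => k.
  by rewrite (ip_multiplier _ _ (mode_bound tT)) cw// c0.
rewrite c0; case: ifPn => [kK|nK].
  have kK' : Kset k by rewrite -in_setE.
  by rewrite psi0// kK' subrr of_real0 mul0r.
by rewrite mulrA -of_realM inverse_symbolK ?of_real1 ?mul1r//; rewrite notin_setE in nK.
Qed.

Lemma Kset_sum N (F : nat -> K) : (forall k, Kset k -> (k < N)%N) ->
  \sum_(k \in Kset) F k = \sum_(0 <= k < N | k \in Kset) F k.
Proof.
move=> KN; have fK : finite_set Kset.
  by apply: (sub_finite_set _ (finite_II N)) => k /KN.
rewrite fsbig_finite// -[RHS]big_filter; apply: perm_big; apply: uniq_perm.
- exact: finmap.fset_uniq.
- by rewrite filter_uniq ?iota_uniq.
- move=> k; rewrite mem_filter mem_index_iota /= in_fset_set//.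
  by have [kK|//] := boolP (k \in Kset); rewrite KN//; rewrite inE in kK.
Qed.

(** Splitting the initial value into its resonant part, of which nothing is
    known, and the rest, which the symbol controls. *)
Lemma initial_bound M psi w N : (forall k, `|inverse_symbol k| <= M) ->
  (forall k, Kset k -> (k < N)%N) -> is_sol psi w ->
  nrm (w 0) ^+ 2 <= (2 * M ^+ 2 + 2) *
    (nrm psi ^+ 2 + \sum_(0 <= k < N | k \in Kset) nrm (coef (w 0) k) ^+ 2).
Proof.
move=> dM KN hw; have M0 : 0 <= M by exact: le_trans (dM 0%N).
pose y := expansion N (fun k => if k \in Kset then coef (w 0) k else 0).
have wE : w 0 = mul inverse_symbol psi + y.
  apply: coef_inj => k; rewrite ipDl (ip_multiplier _ _ dM).
  rewrite ip_expansion; have [kK|nK] := boolP (k \in Kset).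
    have kK' : Kset k by rewrite -in_setE.
    by rewrite KN// resonant_symbol0// of_real0 mul0r add0r.
  by rewrite if_same addr0; apply: solution_coef hw _; rewrite notin_setE in nK.
have yE : nrm y ^+ 2 = \sum_(0 <= k < N | k \in Kset) nrm (coef (w 0) k) ^+ 2.
  rewrite nrm_expansion [RHS]big_mkcond; apply: eq_bigr => k _.
  by case: ifP => // _; rewrite nrm0 expr0n.
rewrite -yE wE.
have h1 := nrmD (mul inverse_symbol psi) y.
have h2 := multiplier_le psi dM.
have := nrm_ge0 (mul inverse_symbol psi + y); have := nrm_ge0 y; have := nrm_ge0 psi.
move: h1 h2; set p := nrm (_ + y); set q := nrm (mul _ _); set r := nrm y; set s := nrm psi.
move=> h1 h2 s0 r0 p0.
have h3 : p <= M * s + r by lra.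
have h4 : p ^+ 2 <= (M * s + r) ^+ 2 by rewrite ler_sqr ?nnegrE// addr_ge0 ?mulr_ge0.
apply: (le_trans h4); rewrite -subr_ge0.
(* the square is the defect in (M s + r)^2 <= 2 (M s)^2 + 2 r^2 *)
rewrite (_ : _ - _ = (M * s - r) ^+ 2 + 2 * (M * r) ^+ 2 + 2 * s ^+ 2); last by ring.
by rewrite !addr_ge0 ?sqr_ge0// mulr_ge0 ?sqr_ge0.
Qed.

(** Each of the three norms is O(1 / t), and t^-2 is t^(- 2 (2 - alpha)) times a
    power of [t] that stays bounded on ]0, T]. *)
Lemma coercive_bound M psi w N t : (forall k, `|inverse_symbol k| <= M) ->
  (forall k, Kset k -> (k < N)%N) -> is_sol psi w -> 0 < t <= T ->
  `|derive_upto T w t| ^+ 2 + `|A (w t)| ^+ 2 + `|frac_derive T alpha (A \o w) t| ^+ 2 <=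
  rc ((5 + (3 / gamma) ^+ 2) * T `^ (2 - 2 * alpha) * (2 * M ^+ 2 + 2) *
      t `^ (- (2 * (2 - alpha)))) *
    (`|psi| ^+ 2 + \sum_(k \in Kset) `|coef (w 0) k| ^+ 2).
Proof.
move=> dM KN hw tT; have /andP[tp tlT] := tT.
have wE s (sT : 0 <= s <= T) := solution_modesE hw sT.
have := sol_estimate wE tT.
rewrite (Kset_sum _ KN) !nrmE -!of_realX.
have -> : \sum_(0 <= k < N | k \in Kset) `|coef (w 0) k| ^+ 2 =
    rc (\sum_(0 <= k < N | k \in Kset) nrm (coef (w 0) k) ^+ 2).
  by rewrite of_real_sum; apply: eq_bigr => k _; rewrite of_realX -nrmE.
rewrite -!of_realD -of_realM of_real_le => /le_trans; apply.
have h := initial_bound dM KN hw.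
have C0 : 0 <= 5 + (3 / gamma) ^+ 2 by rewrite addr_ge0// sqr_ge0.
have /andP[a0 a1] := alpha01.
have ht : t ^- 2 <= T `^ (2 - 2 * alpha) * t `^ (- (2 * (2 - alpha))).
  have -> : t ^- 2 = t `^ (2 - 2 * alpha) * t `^ (- (2 * (2 - alpha))).
    rewrite -powRD; last by rewrite (negbT (gt_eqF tp)) implybT.
    rewrite (_ : _ + _ = - 2%:R); last by ring.
    by rewrite powRN powR_mulrn// ltW.
  rewrite ler_wpM2r ?powR_ge0// ge0_ler_powR ?nnegrE ?(ltW tp) ?(ltW T_gt0)//.
  lra.
set P := T `^ _ in ht *; set S := _ + \sum_(0 <= k < N | _) _ in h *.
set Q := 2 * M ^+ 2 + 2 in h *; set Z := t `^ _ in ht *; set C := 5 + _ in C0 *.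
rewrite [leRHS](_ : _ = C * ((P * Z) * (Q * S))); last by ring.
rewrite -mulrA; apply: ler_wpM2l => //; apply: ler_pM => //.
- by rewrite invr_ge0 exprn_ge0// ltW.
- exact: sqr_ge0.
Qed.


End Orthonormal.

End Scalars.

Theorem theorem4p3 (R : realType) (cplx : bool)
  (H : completeNormedModType (scalars R cplx))
  (ip : {dot H for conj_scalar cplx})
  (hip : inner_product_of_norm ip)
  (hsep : separable_space H)
  (domA : set H) (A : H -> H)
  (hA : unbounded_positive_selfadjoint ip domA A)
  (lam : nat -> R) (v : nat -> H)
  (hev : complete_eigensystem ip domA A lam v)
  (T gamma alpha t0 beta : R)
  (hT : 0 < T) (hgamma : 0 < gamma) (halpha : 0 < alpha < 1)
  (ht0 : 0 < t0 <= T)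
  (B : R -> R -> R)
  (hB : forall l : R, 0 < l -> scalar_cauchy gamma alpha l (B l)) :
  let Kset := K0 B lam t0 beta in
  let solution := is_solution domA A T gamma alpha t0 beta in
  let case_i := ~~ (0 <= beta < 1) \/ (0 < beta < 1 /\ Kset = set0) in
  let case_ii := 0 < beta < 1 /\ Kset !=set0 in
  let term := nonlocal_term ip v lam B t0 beta in
  [/\ forall psi : H, case_i ->
        exists w : R -> H,
          [/\ solution psi w,
              forall w' : R -> H, solution psi w' ->
                forall t : R, 0 <= t <= T -> w' t = w t
            & forall t : R, 0 <= t <= T -> sums_to setT (term psi t) (w t)],
      forall psi : H, case_ii ->
        ((exists w : R -> H, solution psi w) <->
           (forall k, Kset k -> ip psi (v k) = 0)) /\
        ((forall k, Kset k -> ip psi (v k) = 0) ->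
          forall w : R -> H, solution psi w <->
            exists h : nat -> scalars R cplx, forall t : R, 0 <= t <= T ->
              exists x y : H,
                [/\ sums_to (~` Kset) (term psi t) x,
                    sums_to Kset (free_term v lam B h t) y
                  & w t = x + y])
    & exists2 C : R, 0 < C &
        forall (psi : H) (w : R -> H), solution psi w ->
        forall t : R, 0 < t <= T ->
        let lhs := `|derive_upto T w t| ^+ 2 + `|A (w t)| ^+ 2
                   + `|frac_derive T alpha (A \o w) t| ^+ 2 in
        let factor := of_real cplx (C * t `^ (- (2 * (2 - alpha)))) in
        (case_i -> lhs <= factor * `|psi| ^+ 2) /\
        (* The free coefficients h k = ip (w 0) (v k), k in Kset, are not
           controlled by psi, so they enter the bound; it is the bound of the
           first case for the solution whose free coefficients are 0. *)
        (case_ii -> lhs <= factor *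
           (`|psi| ^+ 2 + \sum_(k \in Kset) `|ip (w 0) (v k)| ^+ 2))].

Proof.
have [hv vd he lam_gt0 _ lam_oo] := hev.
move=> Kset solution case_i case_ii term.
have case_i_beta : case_i -> beta != 0 /\ Kset = set0.
  move=> [nb|[/andP[b0 _] KE]]; last by split=> //; rewrite gt_eqF.
  split; first by apply: contra nb => /eqP ->; rewrite lexx ltr01.
  apply/seteqP; split=> // k; rewrite /Kset /K0 /= => bk.
  have /andP[h1 h2] := mode_lt1 lam_gt0 hgamma halpha hB ht0 k.
  by move: nb; rewrite -bk (ltW h1) h2.
have case_ii_beta : case_ii -> beta != 0 by move=> [/andP[b0 _] _]; rewrite gt_eqF.
split.
- move=> psi ci; have [b0 KE] := case_i_beta ci.
  have [M [_ dM]] := inverse_symbol_bounded lam_gt0 hgamma halpha hB lam_oo ht0 b0.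
  exact: (nonresonant_case hip hv vd hA he lam_gt0 hT hgamma halpha hB ht0 dM KE).
- move=> psi ci; have b0 := case_ii_beta ci.
  have [M [_ dM]] := inverse_symbol_bounded lam_gt0 hgamma halpha hB lam_oo ht0 b0.
  exact: (resonant_case hip hv vd hA he lam_gt0 hT hgamma halpha hB ht0 dM).
have [b0|b0] := eqVneq beta 0.
  (* neither case allows beta = 0, so any constant will do *)
  exists 1 => // psi w _ t _ lhs factor; split=> [/case_i_beta[]|/case_ii_beta];
    by rewrite b0 eqxx.
have [M [M0 dM]] := inverse_symbol_bounded lam_gt0 hgamma halpha hB lam_oo ht0 b0.
have [N KN] := Kset_finite lam_gt0 hgamma halpha hB lam_oo ht0 b0.
exists ((5 + (3 / gamma) ^+ 2) * T `^ (2 - 2 * alpha) * (2 * M ^+ 2 + 2)).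
  rewrite !mulr_gt0 ?powR_gt0//; first by rewrite ltr_wpDr ?sqr_ge0.
  by rewrite ltr_wpDl// mulr_ge0 ?sqr_ge0.
move=> psi w hw t tT lhs factor.
have h := coercive_bound hip hv vd hA he lam_gt0 hT hgamma halpha hB ht0 dM KN hw tT.
split=> // /case_i_beta[_ KE].
by move: h; rewrite -/Kset KE fsbig_set0 addr0.
Qed.
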